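(* Let $\mathscr T=(V,\mathcal E)$ be a leafless, rooted directed tree with finite branching index $k_{\mathscr T}$. Let $S_\lambda\in B(l^2(V))$ be a left-invertible weighted shift on $\mathscr T$ and let $E:=\ker S_\lambda^*$. Then: (i) The point spectrum $\sigma_p(S_\lambda)$ of $S_\lambda$ is empty. (ii) If $r_\lambda$ is the radius of convergence for $S_\lambda$, then $\mathbb D_{r_\lambda}\subseteq\sigma_p(S_\lambda^* )\subseteq\sigma(S_\lambda)=\overline{\mathbb D}_{r(S_\lambda)}$. (iii) $\bigvee\{\ker(S_\lambda^*-w):w\in\mathbb D_\epsilon\}=l^2(V)$ for every positive number $\epsilon$. If, in addition, $E$ is finite dimensional, then: (iv) $\sigma_{ap}(S_\lambda)=\sigma_e(S_\lambda)$ is a union of at most $\dim E$ number of annuli centered at the origin. (v) The Fredholm index $\mathrm{ind}\,(S_\lambda-w)$ of $S_\lambda-w$ is at least $-\dim E$ on any connected component of $\mathbb C\setminus\sigma_e(S_\lambda)$. Moreover, $\mathrm{ind}\,(S_\lambda-w)$ is exactly $-\dim E$ on the connected component of $\mathbb C\setminus\sigma_e(S_\lambda)$ that contains $0$. (vi) For any positive integer $k$, $\dim\big(\ker S_\lambda^{*k}/\ker S_\lambda^{*k-1}\big)=\dim E$.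
   Context: Directed trees. A directed graph is a pair $\mathscr T=(V,\mathcal E)$ with $V$ non-empty and $\mathcal E\subseteq V\times V\setminus\{(v,v):v\in V\}$. A circuit is a finite sequence of distinct vertices $v_1,\dots,v_n$, $n\ge2$, with $(v_i,v_{i+1})\in\mathcal E$ for $1\le i\le n-1$ and $(v_n,v_1)\in\mathcal E$. The graph is connected if any two distinct vertices are joined by a finite sequence of vertices in which, for consecutive vertices $a,b$, $(a,b)\in\mathcal E$ or $(b,a)\in\mathcal E$. A root is a vertex $v$ such that $(u,v)\in\mathcal E$ for no $u$; $V^\circ$ is the set of non-root vertices. A directed tree is a connected directed graph without circuits in which every $v\in V^\circ$ has a unique $u$ (the parent $\mathsf{par}(v)$) with $(u,v)\in\mathcal E$. A directed tree has at most one root; it is rooted if it has one, denoted $\mathsf{root}$. For $W\subseteq V$, $\mathsf{Chi}(W)=\bigcup_{u\in W}\{v:(u,v)\in\mathcal E\}$, $\mathsf{Chi}^{\langle0\rangle}(W)=W$, $\mathsf{Chi}^{\langle n\rangle}(W)=\mathsf{Chi}(\mathsf{Chi}^{\langle n-1\rangle}(W))$, and $\mathsf{Chi}^{\langle n\rangle}(v)=\mathsf{Chi}^{\langle n\rangle}(\{v\})$; $\mathsf{par}^{\langle n\rangle}$ is the $n$-fold iterate of $\mathsf{par}$. Leafless means every vertex has at least one child. All directed trees are assumed countably infinite and leafless. Weighted shifts. $l^2(V)$ has orthonormal basis $e_u=\chi_{\{u\}}$, $u\in V$. Given weights $\{\lambda_v\}_{v\in V^\circ}$ (always assumed positive), the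 weighted shift $S_\lambda$ is $(S_\lambda f)(v)=\lambda_vf(\mathsf{par}(v))$ for $v\in V^\circ$ and $(S_\lambda f)(\mathsf{root})=0$; it is assumed to be bounded on $l^2(V)$. $S_\lambda$ is left-invertible if it has a bounded left inverse; then its Cauchy dual $S_{\lambda'}:=S_\lambda(S_\lambda^*S_\lambda)^{-1}$ is the weighted shift on $\mathscr T$ with weights $\lambda'_v=\lambda_v/\|S_\lambda e_{\mathsf{par}(v)}\|^2$, $v\in V^\circ$. Branching index. $n_u$ is the unique integer with $u\in\mathsf{Chi}^{\langle n_u\rangle}(\mathsf{root})$. Let $V_\prec=\{u\in V:\mathrm{card}(\mathsf{Chi}(u))\ge2\}$. The branching index is $k_{\mathscr T}=1+\sup\{n_w:w\in V_\prec\}$ if $V_\prec\ne\emptyset$, and $k_{\mathscr T}=0$ otherwise. Radius of convergence. For an integer $n$ let $W_n=\bigcup_{j=n}^{k_{\mathscr T}+n}\mathsf{Chi}^{\langle j\rangle}(\mathsf{root})$. The radius of convergence for $S_\lambda$ is the non-negative number $$r_\lambda=\liminf_{n\to\infty}\Big(\sum_{v\in W_n}\big(\lambda'_v\lambda'_{\mathsf{par}(v)}\cdots\lambda'_{\mathsf{par}^{\langle n-1\rangle}(v)}\big)^2\Big)^{-\frac1{2n}}.$$ Other notation. $\mathbb D_r=\{z\in\mathbb C:|z|<r\}$; $\bigvee$ denotes closed linear span; $\sigma,\sigma_p,\sigma_{ap},\sigma_e$ denote the spectrum, point spectrum, approximate point spectrum and essential spectrum, and $r(\cdot)$ the spectral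 radius. Annuli are closed and may be degenerate (circles). *)

(* Defs.v *)
From HB Require Import structures.
From mathcomp Require Import all_boot all_order all_algebra.
From mathcomp Require Import all_classical all_reals all_analysis.
From mathcomp Require Import complex ring lra.

Set Implicit Arguments.
Unset Strict Implicit.
Unset Printing Implicit Defensive.

Import Order.TTheory GRing.Theory Num.Theory.
Import numFieldNormedType.Exports.

Local Open Scope classical_set_scope.
Local Open Scope ring_scope.
Local Open Scope complex_scope.

(* The real-valued modulus; the norm [`|z|] of [z : R[i]] lives in [R[i]]. *)
Notation normc := ComplexField.Normc.normc.

Section DirectedTree.
Variables (V : choiceType) (E : rel V).

Definition is_root (v : V) : Prop := forall u, ~~ E u v.

(* A circuit is a sequence [s] with [uniq s], [1 < size s] and [cycle E s]. *)
Record directed_tree : Prop := DirectedTree {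
  edge_irreflexive : irreflexive E;
  tree_connected : forall u v, u != v ->
    exists p, path (fun a b => E a b || E b a) u p /\ last u p = v;
  tree_no_circuit : forall s, uniq s -> (1 < size s)%N -> ~~ cycle E s;
  tree_unique_parent : forall v, ~ is_root v -> exists! u, E u v }.

Definition leafless : Prop := forall u, exists v, E u v.

(* [par v] is only meaningful when [v] is not a root. *)
Definition par (v : V) : V := xget v [set u | E u v].

Definition children (W : set V) : set V := \bigcup_(u in W) [set v | E u v].

Definition nchildren (n : nat) (W : set V) : set V := iter n children W.

Definition branching_vertices : set V :=
  [set u | (`I_2 #<= children [set u])%card].

Variable root : V.

Definition depth (u : V) : nat :=
  xget 0%N [set n | nchildren n [set root] u].

Definition finite_branching_index : Prop :=
  has_ubound [set depth w | w in branching_vertices].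

(* Only meaningful under [finite_branching_index]. *)
Definition branching_index : nat :=
  if branching_vertices == set0 then 0%N
  else (supremum 0%N [set depth w | w in branching_vertices]).+1.

Definition generations_from (n : nat) : set V :=
  [set v | exists j, [/\ (n <= j)%N, (j <= branching_index + n)%N
                       & nchildren j [set root] v]].

End DirectedTree.

Section Operators.
Variables (C : numFieldType) (H : normedModType C).
Implicit Types (T L : H -> H) (A B : set H).

Definition bounded_operator T : Prop :=
  linear T /\ exists M : C, forall x, `|T x| <= M * `|x|.

Definition left_invertible T : Prop :=
  exists2 L, bounded_operator L & cancel T L.

Definition invertible T : Prop :=
  exists L, [/\ bounded_operator L, cancel T L & cancel L T].

Definition shifted T (w : C) : H -> H := fun x => T x - w *: x.

Definition ker T : set H := [set x | T x = 0].

Definition spectrum T : set C := [set w | ~ invertible (shifted T w)].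

Definition point_spectrum T : set C :=
  [set w | exists2 x, x != 0 & T x = w *: x].

Definition ap_spectrum T : set C :=
  [set w | exists x : nat -> H, (forall n, `|x n| = 1) /\
     (fun n => shifted T w (x n)) @ \oo --> (0 : H)].

(* [b] is a basis of the subspace [A] modulo the subspace [B]. *)
Definition has_dim_quot A B (n : nat) : Prop :=
  exists b : 'I_n -> H, (forall i, A (b i)) /\
    forall x, A x -> exists! c : {ffun 'I_n -> C}, B (x - \sum_i c i *: b i).

Definition has_dim A (n : nat) : Prop := has_dim_quot A [set 0] n.

Definition has_codim A (n : nat) : Prop := has_dim_quot setT A n.

Definition fredholm T : Prop :=
  [/\ exists n, has_dim (ker T) n, closed (range T)
    & exists n, has_codim (range T) n].

(* By Atkinson's theorem, the spectrum of the class of [T] in the Calkin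
   algebra. *)
Definition ess_spectrum T : set C := [set w | ~ fredholm (shifted T w)].

(* Only meaningful when [T] is Fredholm. *)
Definition fredholm_index T : int :=
  (xget 0%N [set n | has_dim (ker T) n])%:Z
  - (xget 0%N [set n | has_codim (range T) n])%:Z.

Definition closed_span A : set H :=
  closure [set x | exists (n : nat) (c : 'I_n -> C) (b : 'I_n -> H),
    (forall i, A (b i)) /\ x = \sum_i c i *: b i].

End Operators.

Section Plane.
Variable R : realType.

Definition open_disc (r : \bar R) : set R[i] :=
  [set z | ((normc z)%:E < r)%E].

Definition closed_disc (r : R) : set R[i] := [set z | normc z <= r].

Definition annulus (a b : R) : set R[i] := [set z | a <= normc z <= b].

(* [R[i]^o] is [R[i]] with the topology of its norm. *)
Definition plane_component (A : set R[i]) (z : R[i]) : set R[i] :=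
  @connected_component R[i]^o A z.

End Plane.

Definition spectral_radius (R : realType) (H : normedModType R[i])
  (T : H -> H) : R := sup [set normc w | w in spectrum T].

Section L2Closed.
Variables (R : realType) (V : choiceType).
Implicit Types f g : V -> R[i].

Definition sqsum f : \bar R := \esum_(v in [set: V]) (normc (f v) ^+ 2)%:E.

Definition l2pred : {pred V -> R[i]} := fun f => `[< (sqsum f < +oo)%E >].

Lemma normc_real (z : R[i]) : (normc z)%:C = `|z|.
Proof. by case: z. Qed.

Lemma normc_ge0 (z : R[i]) : 0 <= normc z.
Proof. by case: z => a b; exact: sqrtr_ge0. Qed.

Lemma ler_normcD (z w : R[i]) : normc (z + w) <= normc z + normc w.
Proof. by rewrite -lecR rmorphD/= !normc_real ler_normD. Qed.

Lemma esumZl (a : R) (h : V -> R) : 0 <= a -> (forall v, 0 <= h v) ->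
  (\esum_(v in [set: V]) (a * h v)%:E = a%:E * \esum_(v in [set: V]) (h v)%:E)%E.
Proof.
have key (b : R) (k : V -> R) : 0 <= b -> (forall v, 0 <= k v) ->
    (\esum_(v in [set: V]) (b * k v)%:E
       <= b%:E * \esum_(v in [set: V]) (k v)%:E)%E.
  move=> b0 k0; apply: ge_ereal_sup => _ [F [finF _] <-].
  under eq_fsbigr do rewrite EFinM.
  rewrite -ge0_mule_fsumr => [|v]; last by rewrite lee_fin.
  by apply: lee_wpmul2l; rewrite ?lee_fin//; apply: ereal_sup_ubound; exists F.
move=> a0 h0; apply/eqP; rewrite eq_le key//=.
have [->|an0] := eqVneq a 0.
  by rewrite mul0e; apply: esum_ge0 => v _; rewrite lee_fin mul0r.
have {1}-> : h = (fun v => a^-1 * (a * h v)) by apply/funext => v; rewrite mulKf.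
have a'0 : 0 <= a^-1 by rewrite invr_ge0.
have := key a^-1 (fun v => a * h v) a'0 (fun v => mulr_ge0 a0 (h0 v)).
move=> /(lee_wpmul2l (x := a%:E)); rewrite lee_fin => /(_ a0).
by rewrite muleA -EFinM mulfV// mul1e.
Qed.

Lemma sqsum_ge0 f : (0 <= sqsum f)%E.
Proof. by apply: esum_ge0 => v _; rewrite lee_fin sqr_ge0. Qed.

Lemma sqsumZ (c : R[i]) f : (sqsum (c *: f) = (normc c ^+ 2)%:E * sqsum f)%E.
Proof.
rewrite /sqsum -esumZl ?sqr_ge0//; last by move=> v; rewrite sqr_ge0.
by apply: eq_esum => v _; rewrite /= Normc.normcM exprMn.
Qed.

Lemma sqsum_coord f v : ((normc (f v) ^+ 2)%:E <= sqsum f)%E.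
Proof.
apply: esum_ge; exists [set v]; first by split.
by rewrite fsbig_set1.
Qed.

Lemma sqsum_eq0 f : sqsum f = 0%E -> f = 0.
Proof.
move=> f0; apply/funext => v; apply: Normc.eq0_normc.
have := sqsum_coord f v; rewrite f0 lee_fin => vle0.
by apply/eqP; rewrite -sqrf_eq0 eq_le vle0 sqr_ge0.
Qed.

Lemma sqsumD_le f g (s t : R) : 0 < s -> 0 < t ->
  (sqsum f <= (s ^+ 2)%:E)%E -> (sqsum g <= (t ^+ 2)%:E)%E ->
  (sqsum (f + g)%R <= ((s + t) ^+ 2)%:E)%E.
Proof.
move=> s0 t0 fs gt.
have st0 : 0 < s + t by exact: addr_gt0.
pose k := s + t.
apply: (@le_trans _ _ (\esum_(v in [set: V])
   ((k / s * normc (f v) ^+ 2)%:E + (k / t * normc (g v) ^+ 2)%:E))%E).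
  apply: le_esum => v _; rewrite -EFinD lee_fin.
  apply: (@le_trans _ _ ((normc (f v) + normc (g v)) ^+ 2)).
    by rewrite ler_sqr ?nnegrE ?addr_ge0 ?normc_ge0 ?ler_normcD.
  move: (normc (f v)) (normc (g v)) => a b.
  rewrite -subr_ge0.
  have -> : k / s * a ^+ 2 + k / t * b ^+ 2 - (a + b) ^+ 2
            = (t * a - s * b) ^+ 2 / (s * t).
    by rewrite /k; field; rewrite !gt_eqF.
  by rewrite divr_ge0 ?sqr_ge0 ?mulr_ge0 ?ltW.
have ks0 : 0 <= k / s by rewrite divr_ge0// ltW.
have kt0 : 0 <= k / t by rewrite divr_ge0// ltW.
rewrite esumD => [|v _|v _]; try by rewrite lee_fin mulr_ge0 ?sqr_ge0.
rewrite !esumZl//; try by move=> v; exact: sqr_ge0.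
have -> : ((s + t) ^+ 2)%:E
    = ((k / s)%:E * (s ^+ 2)%:E + (k / t)%:E * (t ^+ 2)%:E :> \bar R)%E.
  by rewrite -!EFinM -EFinD; congr EFin; rewrite /k; field; rewrite !gt_eqF.
by apply: leeD; apply: lee_wpmul2l; rewrite ?lee_fin.
Qed.

Lemma l2predP f : reflect (exists2 s : R, 0 < s & (sqsum f <= (s ^+ 2)%:E)%E)
  (f \in l2pred).
Proof.
apply: (iffP idP) => [/asboolP fy|[s s0 fs]]; last first.
  by apply/asboolP; rewrite (le_lt_trans fs)// ltry.
have ffin : sqsum f \is a fin_num by rewrite ge0_fin_numE ?sqsum_ge0.
have f0 : 0 <= fine (sqsum f) by rewrite fine_ge0 ?sqsum_ge0.
exists (fine (sqsum f) + 1); first by rewrite ltr_wpDl.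
rewrite -{1}(fineK ffin) lee_fin; move: (fine _) f0 => x x0.
by rewrite sqrrD1; have := sqr_ge0 x; lra.
Qed.

Lemma l2pred_submod : submod_closed l2pred.
Proof.
split.
  apply/asboolP; rewrite /sqsum esum1 ?ltry// => v _.
  by rewrite Normc.normc0 expr0n.
move=> c f g /asboolP fy /l2predP[t t0 gt].
have /l2predP[s s0 fs] : c *: f \in l2pred.
  by apply/asboolP; rewrite sqsumZ lte_mul_pinfty ?lee_fin ?sqr_ge0.
by apply/l2predP; exists (s + t); [exact: addr_gt0 | exact: sqsumD_le].
Qed.

HB.instance Definition _ :=
  GRing.isSubmodClosed.Build R[i] (V -> R[i]) l2pred l2pred_submod.

End L2Closed.

Record l2 (R : realType) (V : choiceType) := L2 {
  l2val :> V -> R[i];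
  l2valP : l2val \in @l2pred R V }.

HB.instance Definition _ (R : realType) (V : choiceType) :=
  [isSub for @l2val R V].
HB.instance Definition _ (R : realType) (V : choiceType) :=
  [Choice of l2 R V by <:].
HB.instance Definition _ (R : realType) (V : choiceType) :=
  [SubChoice_isSubLmodule of l2 R V by <:].

Section L2Norm.
Variables (R : realType) (V : choiceType).
Implicit Types f g : l2 R V.

Definition l2norm f : R := Num.sqrt (fine (sqsum f)).

Lemma l2norm_sq f : sqsum f = (l2norm f ^+ 2)%:E.
Proof.
have /asboolP fy := l2valP f.
rewrite /l2norm sqr_sqrtr ?fine_ge0 ?sqsum_ge0// fineK//.
by rewrite ge0_fin_numE ?sqsum_ge0.
Qed.

Lemma l2norm_ge0 f : 0 <= l2norm f. Proof. exact: sqrtr_ge0. Qed.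

Lemma l2norm_eq0 f : l2norm f = 0 -> f = 0.
Proof.
move=> f0; apply/val_inj; rewrite raddf0 /=; apply: sqsum_eq0.
by rewrite l2norm_sq f0 expr0n.
Qed.

Lemma l2normZ (c : R[i]) f : l2norm (c *: f) = normc c * l2norm f.
Proof.
rewrite /l2norm (_ : l2val (c *: f) = c *: l2val f)//.
rewrite sqsumZ l2norm_sq -EFinM/= -exprMn.
by rewrite !sqrtr_sqr !ger0_norm ?mulr_ge0 ?normc_ge0 ?l2norm_ge0.
Qed.

Lemma ler_l2normD f g : l2norm (f + g) <= l2norm f + l2norm g.
Proof.
have n0 : l2norm 0 = 0.
  by have := l2normZ 0 0; rewrite scale0r Normc.normc0 mul0r.
have := l2norm_ge0 f; rewrite le_eqVlt => /predU1P[/esym/l2norm_eq0->|fp].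
  by rewrite add0r n0 add0r.
have := l2norm_ge0 g; rewrite le_eqVlt => /predU1P[/esym/l2norm_eq0->|gp].
  by rewrite addr0 n0 addr0.
have := @sqsumD_le _ _ f g _ _ fp gp; rewrite -!l2norm_sq => /(_ (lexx _) (lexx _)).
have -> : sqsum (l2val f + l2val g) = sqsum (f + g) by [].
by rewrite l2norm_sq lee_fin ler_sqr ?nnegrE ?addr_ge0 ?l2norm_ge0.
Qed.

Let cnorm f : R[i] := (l2norm f)%:C.

Let cnormD f g : cnorm (f + g) <= cnorm f + cnorm g.
Proof. by rewrite /cnorm -rmorphD/= lecR ler_l2normD. Qed.

Let cnormZ (c : R[i]) f : cnorm (c *: f) = `|c| * cnorm f.
Proof. by rewrite /cnorm l2normZ rmorphM/= normc_real. Qed.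

Let cnorm_eq0 f : cnorm f = 0 -> f = 0.
Proof. by move=> /eqP; rewrite fmorph_eq0 => /eqP/l2norm_eq0. Qed.

HB.instance Definition _ :=
  @Lmodule_isNormed.Build R[i] (l2 R V) cnorm cnormD cnormZ cnorm_eq0.

Lemma l2_normE f : `|f| = (l2norm f)%:C. Proof. by []. Qed.

(* Unordered sum of an absolutely summable family. *)
Definition rsum (h : V -> R) : R :=
  fine (\esum_(v in [set: V]) (EFin \o h)^\+ v
        - \esum_(v in [set: V]) (EFin \o h)^\- v)%E.

Definition csum (h : V -> R[i]) : R[i] :=
  rsum (@complex.Re R \o h) +i* rsum (@complex.Im R \o h).

Definition inner f g : R[i] := csum (fun v => f v * (g v)^*).

(* By the Riesz theorem, the only choice when [A] is a bounded operator. *)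
Definition adjoint (A : l2 R V -> l2 R V) : l2 R V -> l2 R V :=
  xget (fun=> 0)
    [set B : l2 R V -> l2 R V | forall f g, inner (A f) g = inner f (B g)].

Lemma indic_l2 (u : V) : (fun v => (v == u)%:R) \in @l2pred R V.
Proof.
apply/asboolP; rewrite /sqsum (esumID [set u])//; last first.
  by move=> v _; rewrite lee_fin sqr_ge0.
rewrite !setTI esum_set1 ?lee_fin ?sqr_ge0// esum1 ?adde0 ?ltry// => v /=.
by move=> /eqP/negbTE ->; rewrite Normc.normc0 expr0n.
Qed.

Definition basis_vec (u : V) : l2 R V := L2 (indic_l2 u).

End L2Norm.

Section WeightedShift.
Variables (R : realType) (V : choiceType) (E : rel V) (root : V).
Variables (lam : V -> R) (S : l2 R V -> l2 R V).

Definition weighted_shift : Prop := forall (f : l2 R V) (v : V),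
  (is_root E v -> S f v = 0) /\
  (~ is_root E v -> S f v = (lam v)%:C * f (par E v)).

Definition dual_weight (v : V) : R :=
  lam v / l2norm (S (basis_vec R (par E v))) ^+ 2.

(* The power [-1/(2n)] is written as an inverse since [poweR] sends [+oo] to
   [+oo] even when the exponent is negative; the sum may be infinite. *)
Definition convergence_radius : \bar R :=
  limn_einf (fun n : nat =>
    ((\esum_(v in generations_from E root n)
        ((\prod_(i < n) dual_weight (iter i (par E) v)) ^+ 2)%:E)
      `^ (2 * n%:R)^-1)^-1)%E.

End WeightedShift.

(* Main.v *)
Require Import Defs.
From mathcomp Require Import all_boot all_order all_algebra.
From mathcomp Require Import all_classical all_reals all_analysis.
From mathcomp Require Import complex ring lra.

(** The shift acts on coordinates by (S f) v = lam v * f (par v), and the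
    whole proof exploits how explicit this is.

    Bounds.  The operators whose norm has to be estimated, S and its
    restrictions, its Cauchy dual and its backward version, have the form
    (T f) v = m v * f (phi v) ([wcomp]).  Such a T sends distinct basis vectors
    to vectors with disjoint supports, so its norm is the supremum of the norms
    of the T (e u) ([wcomp_le]).  The form is stable under composition, so powers are
    controlled in the same way, and [neumann] turns geometric bounds on powers
    into inverses.

    Parts (i) and (ii).  For w != 0 the equation (S - w) f = g determines f
    recursively from the root, so S has no eigenvalue.  If S - w is invertible,
    the solution for g = e u carries, up to signs and powers of w, the vectors
    S^k (e u) on successive generations; hence the norm of S^k is O(|w|^k)
    ([shift_power_bound]) and every w' with |w'| > |w| is in the resolvent set.
    As 0 is in the spectrum and the resolvent set is open, the spectrum is a
    disc ([spectrum_disc]).  The Cauchy dual T satisfies S^* T = 1, so the sum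
    of the w^n T^n g with S^* g = 0 is an eigenvector of S^* for w as soon as
    it converges; for g = e root the norms of the terms are what the radius of
    convergence measures ([radius_disc_point_spectrum]).

    Part (iii).  The closed span of the eigenvectors of S^* with small
    eigenvalues is invariant under T, and contains the kernel of S^*.  For a
    child v of u the vector e v is a multiple of T (e u) plus an element of
    that kernel, so all the e v are in the span by induction on the depth.

    Part (vi).  S^{*k} T^k = 1 makes T^k map a basis of the kernel of S^* to
    one of the k-th quotient of kernels.

    Parts (iv) and (v).  Below the depth K past all branching, the tree is a
    disjoint union of rays, one for each vertex of generation K.  Along a ray,
    let P n be the square of the product of the weights from the root down to
    its n-th vertex.  Compared with |w|^(2n), the sequence P may decay
    exponentially, grow exponentially (both uniformly in the starting point),
    or do neither; the moduli of the third kind form a compact interval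
    ([growth_radii]), which gives one annulus for each ray.
    - If every ray decays or grows at |w|, then S - w has a bounded left
      inverse made of two Neumann series, a forward one away from the growing
      rays and a backward one on them ([split_resolvent]).  Its range misses
      exactly one dimension for each growing ray ([split_codim]).
    - If some ray does neither, finite pieces of the formal eigenvector along
      this ray are approximate eigenvectors, and they can be found arbitrarily
      far away ([late_blocks], [approx_eigenvector]).  Adding infinitely many
      with disjoint supports produces a limit of elements of the range whose
      only preimage has infinite norm ([ray_range_not_closed]).
    So the approximate point spectrum and the essential spectrum are both the
    union of the annuli, and elsewhere the index is minus the number of growing
    rays.  For small w all the rays grow, whereas the codimension of the range
    of S - w is that of the range of S, that is dim E; so there are dim E rays
    ([generation_enum]).  A component of the complement that contains 0 cannot
    cross a circle, so all the rays grow on it. *)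

Set Implicit Arguments.
Unset Strict Implicit.
Unset Printing Implicit Defensive.

Import Order.TTheory GRing.Theory Num.Theory.
Import numFieldNormedType.Exports.

Local Open Scope classical_set_scope.
Local Open Scope ring_scope.

(** * Square-summable families and weighted composition operators *)

Section Sums.
Variables (R : realType).

Lemma esum_fiber (I J : choiceType) (phi : I -> J) (a : I -> \bar R) :
  (forall i, (0 <= a i)%E) ->
  \esum_(i in [set: I]) a i
  = \esum_(j in [set: J]) \esum_(i in [set i | phi i = j]) a i.
Proof.
move=> a0.
rewrite (@esum_esum R J I setT (fun j => [set i | phi i = j]) (fun=> a))//.
rewrite (@reindex_esum R I (J * I)%type setT _ (fun i => (phi i, i)))//.
split => [i _ //|i j _ _ [_ ->]//|[j i] /= [_ <-]].
by exists i.
Qed.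

Variable V : choiceType.
Implicit Types f g : l2 R V.

(** The fibres of phi partition V, and on the fibre of u the sum of squares is
    |f u|^2 times that of the column of u. *)
Lemma sqsum_wcomp_le (m : V -> R[i]) (phi : V -> V) (f : V -> R[i]) (C : R) :
  0 <= C ->
  (forall u, f u != 0 -> (sqsum (fun v => if phi v == u then m v else 0)%R <= C%:E)%E) ->
  (sqsum (fun v => m v * f (phi v))%R
   <= C%:E * sqsum f)%E.
Proof.
move=> C0 mC; rewrite /sqsum (@esum_fiber _ _ phi); last first.
  by move=> v; rewrite lee_fin sqr_ge0.
rewrite -esumZl//; last by move=> v; exact: sqr_ge0.
apply: le_esum => u _.
rewrite [leLHS](_ : _ = ((normc (f u) ^+ 2)%:E
   * sqsum (fun v => if phi v == u then m v else 0)%R))%E; last first.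
  rewrite esum_mkcond /sqsum -esumZl ?sqr_ge0//; last by move=> v; rewrite sqr_ge0.
  apply: eq_esum => v _; have [pu|pu] := eqVneq (phi v) u.
    by rewrite mem_set// pu Normc.normcM exprMn [in RHS]mulrC.
  rewrite memNset; last exact/eqP.
  by rewrite Normc.normc0 expr0n/= mulr0.
have [->|fu] := eqVneq (f u) 0.
  by rewrite Normc.normc0 expr0n/= mul0e mulr0.
rewrite muleC [leRHS]EFinM; apply: lee_wpmul2r; last exact: mC.
by rewrite lee_fin sqr_ge0.
Qed.

Lemma l2val0 (v : V) : (0 : l2 R V) v = 0. Proof. by []. Qed.
Lemma l2valD f g v : (f + g) v = f v + g v. Proof. by []. Qed.
Lemma l2valN f v : (- f) v = - f v. Proof. by []. Qed.
Lemma l2valB f g v : (f - g) v = f v - g v. Proof. by []. Qed.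
Lemma l2valZ (c : R[i]) f v : (c *: f) v = c * f v. Proof. by []. Qed.
Lemma l2val_sum n (F : 'I_n -> l2 R V) v : (\sum_i F i) v = \sum_i F i v.
Proof.
by elim/big_ind2 : _ => // f x g y; rewrite l2valD => -> ->.
Qed.
Lemma basis_vecE (u v : V) : basis_vec R u v = (v == u)%:R :> R[i].
Proof. by []. Qed.

Lemma l2_eq f g : (forall v, f v = g v) -> f = g.
Proof. by move=> fg; apply: val_inj; apply/funext. Qed.

Definition l2valE := (l2val0, l2valD, l2valN, l2valZ).

Lemma sqsum_le_l2norm f (C : R) : 0 <= C ->
  (sqsum f <= (C ^+ 2)%:E)%E = (l2norm f <= C).
Proof.
by move=> C0; rewrite l2norm_sq lee_fin ler_sqr ?nnegrE ?l2norm_ge0.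
Qed.

Lemma normc_coord f (v : V) : normc (f v) <= l2norm f.
Proof.
have := sqsum_coord f v; rewrite l2norm_sq lee_fin.
by rewrite ler_sqr ?nnegrE ?l2norm_ge0 ?normc_ge0.
Qed.

Lemma l2norm0 : l2norm (0 : l2 R V) = 0.
Proof. by have := l2normZ 0 (0 : l2 R V); rewrite scale0r Normc.normc0 mul0r. Qed.

Lemma l2normN f : l2norm (- f) = l2norm f.
Proof.
rewrite -scaleN1r l2normZ (_ : normc (-1) = 1) ?mul1r//.
by rewrite [LHS]normcN Normc.normc1.
Qed.

Lemma ler_l2normB f g : l2norm (f - g) <= l2norm f + l2norm g.
Proof. by rewrite -(l2normN g) ler_l2normD. Qed.

Lemma l2norm_le0 f : l2norm f <= 0 -> f = 0.
Proof.
by move=> f0; apply: l2norm_eq0; apply/eqP; rewrite eq_le f0 l2norm_ge0.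
Qed.

Lemma sqsum_supp1 (h : V -> R[i]) a : (forall v, v != a -> h v = 0) ->
  sqsum h = (normc (h a) ^+ 2)%:E.
Proof.
move=> h0; rewrite /sqsum (esumID [set a])//; last first.
  by move=> v _; rewrite lee_fin sqr_ge0.
rewrite !setTI esum_set1 ?lee_fin ?sqr_ge0// esum1 ?adde0 ?ltry// => v /= /eqP va.
by rewrite h0// Normc.normc0 expr0n.
Qed.

Lemma l2norm_basis (u : V) : l2norm (basis_vec R u) = 1.
Proof.
rewrite /l2norm (@sqsum_supp1 _ u)/=.
  by rewrite eqxx Normc.normc1 expr1n sqrtr1.
by move=> v /negbTE ->.
Qed.

Lemma le_sqsum (h k : V -> R[i]) : (forall v, normc (h v) <= normc (k v)) ->
  (sqsum h <= sqsum k)%E.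
Proof.
move=> hk; apply: le_esum => v _.
by rewrite lee_fin ler_sqr ?nnegrE ?normc_ge0.
Qed.

Lemma normc_id (x : R) : normc (x%:C)%C = `|x|.
Proof. by rewrite /= expr0n/= addr0 sqrtr_sqr. Qed.

Lemma normcX (z : R[i]) k : normc (z ^+ k) = normc z ^+ k.
Proof.
elim: k => [|k ih]; first by rewrite !expr0 Normc.normc1.
by rewrite !exprS Normc.normcM ih.
Qed.

Lemma normc_gt0 (z : R[i]) : (0 < normc z) = (z != 0).
Proof.
rewrite lt_neqAle normc_ge0 andbT eq_sym; congr (~~ _).
by apply/eqP/eqP => [/Normc.eq0_normc//|->]; rewrite Normc.normc0.
Qed.

(** Norms of [l2 R V] live in R[i]; bounds are handled through the real-valued
    [l2norm]. *)
Definition bounded_by (T : l2 R V -> l2 R V) (M : R) :=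
  forall x, l2norm (T x) <= M * l2norm x.

Lemma bounded_operatorP (T : l2 R V -> l2 R V) :
  bounded_operator T <-> linear T /\ exists2 M : R, 0 < M & bounded_by T M.
Proof.
split=> -[linT] => [[M TM]|[M M0 TM]]; split => //; last first.
  exists (M%:C)%C => x; rewrite !l2_normE -rmorphM/= lecR; exact: TM.
exists (Num.max (complex.Re M) 1); first by rewrite lt_max ltr01 orbT.
move=> x; have := TM x; rewrite !l2_normE.
case: M TM => a b TM /=; rewrite lecE /= => /andP[_].
rewrite mulr0 subr0 => /le_trans; apply.
by rewrite ler_wpM2r ?l2norm_ge0// le_max lexx.
Qed.

Lemma bounded_by_comp T1 T2 M1 M2 : 0 <= M1 -> bounded_by T1 M1 -> bounded_by T2 M2 ->
  bounded_by (T1 \o T2) (M1 * M2).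
Proof.
move=> M10 b1 b2 x /=; apply: (le_trans (b1 _)).
by rewrite -mulrA ler_wpM2l.
Qed.

Section Linear.
Variable T : l2 R V -> l2 R V.
Hypothesis linT : linear T.
Lemma linZD c x y : T (c *: x + y) = c *: T x + T y. Proof. exact: linT. Qed.
Lemma lin0 : T 0 = 0.
Proof. by have := linZD (-1) 0 0; rewrite scaler0 addr0 scaleN1r addNr. Qed.
Lemma linD x y : T (x + y) = T x + T y.
Proof. by rewrite -{1}[x]scale1r linZD scale1r. Qed.
Lemma linZ c x : T (c *: x) = c *: T x.
Proof. by rewrite -[c *: x]addr0 linZD lin0 addr0. Qed.
Lemma linN x : T (- x) = - T x. Proof. by rewrite -scaleN1r linZ scaleN1r. Qed.
Lemma linB x y : T (x - y) = T x - T y. Proof. by rewrite linD linN. Qed.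
Lemma lin_sum n (F : 'I_n -> l2 R V) : T (\sum_i F i) = \sum_i T (F i).
Proof. exact: (big_morph T linD lin0). Qed.
Lemma lin_iter k : linear (iter k T).
Proof. by elim: k => [//|k ih] c x y; rewrite !iterS [X in T X]ih linT. Qed.
End Linear.

Lemma lin_comp (T1 T2 : l2 R V -> l2 R V) :
  linear T1 -> linear T2 -> linear (T1 \o T2).
Proof. by move=> l1 l2 c x y /=; rewrite l2 l1. Qed.

Lemma bounded_iter T M k : 0 <= M -> bounded_by T M -> bounded_by (iter k T) (M ^+ k).
Proof.
move=> M0 TM; elim: k => [x|k ih x]; first by rewrite expr0 mul1r.
by rewrite iterS exprS; exact: (@bounded_by_comp T (iter k T)).
Qed.

Definition wcomp (T : l2 R V -> l2 R V) (m : V -> R[i]) (phi : V -> V) :=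
  forall f v, T f v = m v * f (phi v).

Lemma wcomp_linear T m phi : wcomp T m phi -> linear T.
Proof.
move=> Tm c f g; apply: l2_eq => v.
by rewrite l2valD l2valZ !Tm l2valD l2valZ; ring.
Qed.

Lemma wcomp_comp T1 m1 phi1 T2 m2 phi2 : wcomp T1 m1 phi1 -> wcomp T2 m2 phi2 ->
  wcomp (T1 \o T2) (fun v => m1 v * m2 (phi1 v)) (phi2 \o phi1).
Proof. by move=> T1m T2m f v /=; rewrite T1m T2m mulrA. Qed.

Lemma wcomp_iter T m phi k : wcomp T m phi ->
  exists mk, wcomp (iter k T) mk (iter k phi).
Proof.
move=> Tm; elim: k => [|k [mk ih]].
  by exists (fun=> 1) => f v; rewrite mul1r.
exists (fun v => m v * mk (phi v)) => f v.
rewrite iterS (wcomp_comp Tm ih)/=; congr (_ * f _).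
by rewrite -iterSr.
Qed.

(** Images of distinct basis vectors have disjoint supports, so only the
    columns met by f matter.  Restricting to these columns is what allows bounds
    to be proved generation by generation. *)
Lemma wcomp_le T m phi (C : R) (f : l2 R V) : wcomp T m phi -> 0 <= C ->
  (forall u, f u != 0 -> l2norm (T (basis_vec R u)) <= C) ->
  l2norm (T f) <= C * l2norm f.
Proof.
move=> Tm C0 TC; rewrite -sqsum_le_l2norm ?mulr_ge0 ?l2norm_ge0//.
rewrite exprMn EFinM -l2norm_sq.
rewrite (_ : l2val (T f) = fun v => m v * f (phi v)); last first.
  by apply/funext => v; rewrite Tm.
apply: sqsum_wcomp_le => [|u fu]; first exact: sqr_ge0.
have := TC _ fu; rewrite -sqsum_le_l2norm//; congr (_ <= _)%E.
by congr sqsum; apply/funext => v; rewrite Tm basis_vecE mulr_natr mulrb.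
Qed.

Lemma wcomp_ex (m : V -> R[i]) (phi : V -> V) (C : R) : 0 <= C ->
  (forall u, (sqsum (fun v => if phi v == u then m v else 0)%R <= (C ^+ 2)%:E)%E) ->
  exists2 T : l2 R V -> l2 R V, wcomp T m phi & bounded_by T C.
Proof.
move=> C0 mC.
have key (f : l2 R V) : (sqsum (fun v => m v * f (phi v))%R <= ((C * l2norm f) ^+ 2)%:E)%E.
  rewrite exprMn EFinM -l2norm_sq; apply: sqsum_wcomp_le => //; exact: sqr_ge0.
have inl2 (f : l2 R V) : (fun v => m v * f (phi v)) \in @l2pred R V.
  by apply/asboolP; rewrite (le_lt_trans (key f))// ltry.
exists (fun f => L2 (inl2 f)) => // f.
by rewrite -sqsum_le_l2norm ?mulr_ge0 ?l2norm_ge0//; exact: key.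
Qed.

End Sums.

Ltac l2ring := apply: l2_eq => ?; rewrite ?l2valE; ring.

(** * Completeness and Neumann series *)

Section Complete.
Variables (R : realType) (V : choiceType).
Implicit Types f g : l2 R V.

Lemma ler_normcB (a b : R[i]) : `|normc a - normc b| <= normc (a - b).
Proof.
have h (x y : R[i]) : normc x - normc y <= normc (x - y).
  by rewrite lerBlDr; have := ler_normcD (x - y) y; rewrite subrK.
rewrite ler_norml h andbT lerNl opprB (le_trans (h _ _))//.
by rewrite -[X in _ <= X]normcN opprB.
Qed.

Lemma normc_ReIm (z : R[i]) : normc z <= `|complex.Re z| + `|complex.Im z|.
Proof.
case: z => a b /=.
have -> : `|a| + `|b| = Num.sqrt ((`|a| + `|b|) ^+ 2).
  by rewrite sqrtr_sqr [RHS]ger0_norm ?addr_ge0.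
apply: ler_wsqrtr; rewrite sqrrD !real_normK ?num_real//.
by rewrite -addrA lerD2l lerDr mulrn_wge0// mulr_ge0.
Qed.

Lemma le_Re_normc (z : R[i]) : `|complex.Re z| <= normc z.
Proof. by case: z => a b /=; rewrite -sqrtr_sqr ler_wsqrtr// lerDl sqr_ge0. Qed.

Lemma le_Im_normc (z : R[i]) : `|complex.Im z| <= normc z.
Proof. by case: z => a b /=; rewrite -sqrtr_sqr ler_wsqrtr// lerDr sqr_ge0. Qed.

Lemma cvg0_le (u w : nat -> R) : (forall n, 0 <= u n <= w n) ->
  w @ \oo --> (0 : R) -> u @ \oo --> (0 : R).
Proof.
move=> uw w0; apply: (@squeeze_cvgr _ _ _ _ (fun=> 0) w) => //; last exact: cvg_cst.
by apply: nearW.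
Qed.

Lemma le_cvg0 (u : nat -> R) a : (forall n, a <= u n) ->
  u @ \oo --> (0 : R) -> a <= 0.
Proof.
move=> au u0; rewrite -(cvg_lim (@Rhausdorff R) u0).
apply: limr_ge; first by apply/cvg_ex; exists 0.
by apply: nearW.
Qed.

Definition ptw_cvg (f : nat -> l2 R V) (h : V -> R[i]) :=
  forall v, (fun n => normc (f n v - h v)) @ \oo --> (0 : R).

(** Fatou's lemma for sums of squares: every finite partial sum passes to the
    limit. *)
Lemma sqsum_fatou (f : nat -> l2 R V) (h : V -> R[i]) C : 0 <= C ->
  (forall n, l2norm (f n) <= C) -> ptw_cvg f h ->
  (sqsum h <= (C ^+ 2)%:E)%E.
Proof.
move=> C0 fC fh; apply: ge_ereal_sup => _ [F [finF _] <-].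
rewrite fsbig_finite//= sumEFin lee_fin.
have cv v : (fun n => normc (f n v) ^+ 2) @ \oo --> normc (h v) ^+ 2.
  have cv1 : (fun n => normc (f n v)) @ \oo --> normc (h v).
    apply/subr_cvg0; apply/norm_cvg0P.
    apply: cvg0_le (fh v) => n; rewrite normr_ge0/= -normrN opprB.
    by rewrite -normrN opprB ler_normcB.
  by under eq_fun do rewrite expr2; apply: cvgM.
have cvs : (fun n => \sum_(v <- finmap.enum_fset (fset_set F)) normc (f n v) ^+ 2) @ \oo
   --> \sum_(v <- finmap.enum_fset (fset_set F)) normc (h v) ^+ 2.
  elim: (finmap.enum_fset _) => [|v s ih].
    by rewrite big_nil; under eq_fun do rewrite big_nil; exact: cvg_cst.
  by rewrite big_cons; under eq_fun do rewrite big_cons; exact: cvgD.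
rewrite -(cvg_lim (@Rhausdorff R) cvs); apply: limr_le.
  by apply/cvg_ex; eexists; exact: cvs.
apply: nearW => n.
have := fC n; rewrite -sqsum_le_l2norm//; rewrite -lee_fin; apply: le_trans.
rewrite -sumEFin -fsbig_finite//.
by apply: ereal_sup_ubound; exists F.
Qed.

Lemma real_cauchy (u e : nat -> R) : e @ \oo --> (0 : R) ->
  (forall n m, (n <= m)%N -> `|u m - u n| <= e n) ->
  exists l : R, u @ \oo --> l.
Proof.
move=> e0 ue; apply/cvg_ex; apply: R_complete; apply: cauchy_exP => eps eps0.
have /cvgrPdist_lt/(_ _ eps0)[N _ hN] := e0.
exists (u N); exists N => // m /= Nm; rewrite /ball/=.
have := hN N (leqnn N); rewrite sub0r normrN => eN.
rewrite distrC (le_lt_trans (ue _ _ Nm))//.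
by rewrite (le_lt_trans (ler_norm _)).
Qed.

(** The limit is taken coordinatewise, and [sqsum_fatou] applied to the tails
    gives both its membership in l2 and the rate. *)
Lemma l2_complete (x : nat -> l2 R V) (e : nat -> R) : e @ \oo --> (0 : R) ->
  (forall n m, (n <= m)%N -> l2norm (x m - x n) <= e n) ->
  exists y, forall n, l2norm (y - x n) <= e n.
Proof.
move=> e0 xe.
have e_ge0 n : 0 <= e n by apply: le_trans (xe n n (leqnn n)); exact: l2norm_ge0.
have coord v n m : (n <= m)%N -> normc (x m v - x n v) <= e n.
  by move=> nm; apply: le_trans (xe _ _ nm); rewrite -l2valB normc_coord.
have exh v : exists z : R[i], (fun n => normc (x n v - z)) @ \oo --> (0 : R).
  have [a ua] : exists a : R, (fun n => complex.Re (x n v)) @ \oo --> a.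
    apply: (real_cauchy e0) => n m nm; apply: le_trans (coord v _ _ nm).
    by rewrite -raddfB le_Re_normc.
  have [b ub] : exists b : R, (fun n => complex.Im (x n v)) @ \oo --> b.
    apply: (real_cauchy e0) => n m nm; apply: le_trans (coord v _ _ nm).
    by rewrite -raddfB le_Im_normc.
  exists (a +i* b)%C.
  apply: (@cvg0_le _ (fun n => `|complex.Re (x n v) - a| + `|complex.Im (x n v) - b|)).
    move=> n; rewrite normc_ge0/=; apply: le_trans (normc_ReIm _) _.
    by case: (x n v).
  rewrite -[X in _ --> X]addr0; apply: cvgD; apply/norm_cvg0P; exact/subr_cvg0.
have [h xh] := choice exh.
have key n : (sqsum (fun v => h v - x n v)%R <= ((e n) ^+ 2)%:E)%E.
  apply: (@sqsum_fatou (fun m => x (m + n)%N - x n)) => // [m|v].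
    by apply: xe; rewrite leq_addl.
  have := xh v; rewrite -(cvg_shiftn n) => /= cv.
  apply: cvg_trans cv; apply: near_eq_cvg; apply: nearW => m.
  congr normc; change (x (m + n)%N v - h v = (x (m + n)%N v - x n v) - (h v - x n v)).
  by rewrite opprB addrA subrK.
have hl2 : (fun v => h v - x 0%N v) \in @l2pred R V.
  by apply/asboolP; rewrite (le_lt_trans (key 0%N))// ltry.
exists (L2 hl2 + x 0%N) => n.
rewrite -sqsum_le_l2norm//; have := key n; congr (_ <= _)%E; congr sqsum.
by apply/funext => v; rewrite l2valB l2valD/= subrK.
Qed.

Lemma cvg_geom0 (C q : R) : 0 <= q < 1 -> (fun n => C * q ^+ n) @ \oo --> (0 : R).
Proof.
move=> /andP[q0 q1]; rewrite -[X in _ --> X](mulr0 C); apply: cvgM; first exact: cvg_cst.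
by apply: cvg_expr; rewrite ger0_norm.
Qed.

Lemma l2_geometric_series (x : nat -> l2 R V) (C q : R) : 0 <= q < 1 ->
  (forall n, l2norm (x n) <= C * q ^+ n) ->
  exists y, forall n, l2norm (y - \sum_(k < n) x k) <= C / (1 - q) * q ^+ n.
Proof.
move=> q01 xC; have /andP[q0 q1] := q01; apply: l2_complete; first exact: cvg_geom0.
have q'0 : 0 < 1 - q by rewrite subr_gt0.
have C0 : 0 <= C by have := xC 0%N; rewrite expr0 mulr1; apply: le_trans; exact: l2norm_ge0.
move=> n m nm; rewrite -(subnKC nm); move: (m - n)%N => j.
suff : l2norm (\sum_(k < n + j) x k - \sum_(k < n) x k)
    <= C / (1 - q) * (q ^+ n - q ^+ (n + j)).
  move=> /le_trans; apply; rewrite ler_wpM2l ?divr_ge0 ?(ltW q'0)//.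
  by rewrite lerBlDr lerDl exprn_ge0.
elim: j => [|j ih]; first by rewrite addn0 !subrr l2norm0 mulr0.
rewrite addnS big_ord_recr/= addrAC (le_trans (ler_l2normD _ _))//.
apply: le_trans (lerD ih (xC _)) _; rewrite exprS.
by rewrite le_eqVlt; apply/orP; left; apply/eqP; field; lra.
Qed.

(** Pointwise form of the Neumann series: only the orbit of y has to decay.
    It yields single eigenvectors where no operator bound is available. *)
Lemma neumann_vector (N : l2 R V -> l2 R V) (M C q : R) (y : l2 R V) :
  linear N -> 0 <= M -> bounded_by N M -> 0 <= q < 1 ->
  (forall k, l2norm (iter k N y) <= C * q ^+ k) ->
  exists2 x : l2 R V, x - N x = y & l2norm x <= C / (1 - q).
Proof.
move=> linN M0 NM q01 NC; have /andP[q0 q1] := q01.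
have [x hx] := l2_geometric_series q01 NC; exists x; last first.
  by have := hx 0%N; rewrite big_ord0 subr0 expr0 mulr1.
apply/eqP; rewrite -subr_eq0; apply/eqP/l2norm_le0.
set c := C / (1 - q) in hx.
apply: (@le_cvg0 (fun n => c * q ^+ n + (M * c) * q ^+ n)); last first.
  by rewrite -[X in _ --> X]addr0; apply: cvgD; exact: cvg_geom0.
move=> n; set s := fun n => \sum_(k < n) iter k N y in hx *.
have sN : s n.+1 = y + N (s n) by rewrite /s big_ord_recl/= (lin_sum linN).
have -> : x - N x - y = (x - s n.+1) - N (x - s n).
  by rewrite (linB linN) sN; l2ring.
apply: le_trans (ler_l2normB _ _) _; apply: lerD.
  apply: le_trans (hx _) _; rewrite exprS mulrCA ler_piMl// ?(ltW q1)//.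
  by have := hx n; apply: le_trans; exact: l2norm_ge0.
apply: le_trans (NM _) _; rewrite -mulrA; apply: ler_wpM2l => //; exact: hx.
Qed.

(** Injectivity follows from the decay of the powers, so the solution of
    x - N x = y depends linearly on y without further work. *)
Lemma neumann (N : l2 R V -> l2 R V) (C q : R) : linear N ->
  0 <= C -> 0 <= q < 1 ->
  (forall k x, l2norm (iter k N x) <= C * q ^+ k * l2norm x) ->
  exists J, [/\ bounded_operator J, forall x, J (x - N x) = x
              & forall x, J x - N (J x) = x].
Proof.
move=> linN C0 q01 NC; have /andP[q0 q1] := q01.
have q'0 : 0 < 1 - q by rewrite subr_gt0.
have ex (y : l2 R V) : exists2 x : l2 R V,
    x - N x = y & l2norm x <= Num.max 1 (C / (1 - q)) * l2norm y.
  have [||k|x xy xC] := @neumann_vector N (C * q) (C * l2norm y) q y linN _ _ q01.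
  - exact: mulr_ge0.
  - by move=> x; have := NC 1%N x; rewrite expr1.
  - by rewrite mulrAC.
  exists x => //; apply: le_trans xC _.
  by rewrite mulrAC ler_wpM2r ?l2norm_ge0// le_max lexx orbT.
have inj (x : l2 R V) : x - N x = 0 -> x = 0.
  move=> /eqP; rewrite subr_eq0 => /eqP Nx.
  have itx k : iter k N x = x by elim: k => //= k ->.
  apply: l2norm_le0; apply: (@le_cvg0 (fun n => (C * l2norm x) * q ^+ n)); last exact: cvg_geom0.
  by move=> n; rewrite -{1}(itx n) mulrAC.
have [J JN] := choice (fun y => let: ex_intro2 x h1 h2 := ex y in
   ex_intro (fun x => x - N x = y /\ l2norm x <= Num.max 1 (C / (1 - q)) * l2norm y) x
     (conj h1 h2)).
have J1 (x : l2 R V) : J (x - N x) = x.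
  apply/eqP; rewrite -subr_eq0; apply/eqP/inj.
  have := (JN (x - N x)).1; set z := J _ => zx.
  by rewrite (linB linN) -[RHS](subrr (x - N x)) -{1}zx; l2ring.
exists J; split => //; last by move=> x; exact: (JN x).1.
apply/bounded_operatorP; split.
  move=> c x y; rewrite -{1}(JN x).1 -{1}(JN y).1.
  set a := J x; set b := J y.
  by rewrite -[RHS]J1 linN; congr J; l2ring.
exists (Num.max 1 (C / (1 - q))); first by rewrite lt_max ltr01.
by move=> x; exact: (JN x).2.
Qed.

End Complete.

(** * Finite combinations of basis vectors, and density *)

Section FiniteCombinations.
Variables (R : realType) (V : choiceType).
Implicit Types f g : l2 R V.

Definition finite_comb (s : seq V) (c : V -> R[i]) : l2 R V :=
  \sum_(u <- s) c u *: basis_vec R u.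

Lemma finite_combE s c v : uniq s -> finite_comb s c v = if v \in s then c v else 0.
Proof.
rewrite /finite_comb; elim: s => [|u s ih] /=; first by rewrite big_nil.
move=> /andP[us /ih{}ih]; rewrite big_cons l2valD ih l2valZ basis_vecE in_cons.
have [->|vu] /= := eqVneq v u; first by rewrite (negbTE us) mulr1 addr0.
by rewrite mulr0 add0r.
Qed.

Lemma sqsum_finite_comb s c : uniq s ->
  sqsum (finite_comb s c) = (\sum_(u <- s) normc (c u) ^+ 2)%:E.
Proof.
move=> us; rewrite -sumEFin (_ : sqsum _ =
    \esum_(v in [set` s]) (normc (c v) ^+ 2)%:E); last first.
  rewrite [RHS]esum_mkcond; apply: eq_esum => v _.
  rewrite finite_combE// mem_setE; case: ifP => //.
  by rewrite Normc.normc0 expr0n.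
rewrite esum_fset//; last by move=> v _; rewrite lee_fin sqr_ge0.
by rewrite -fsbig_seq.
Qed.

Lemma sqsum_ub (h : V -> R[i]) (C : \bar R) :
  (forall s, uniq s -> ((\sum_(u <- s) normc (h u) ^+ 2)%:E <= C)%E) ->
  (sqsum h <= C)%E.
Proof.
move=> hC; apply: ge_ereal_sup => _ [F [finF _] <-].
by rewrite fsbig_finite//= sumEFin hC.
Qed.

(** Truncation to a finite set that captures the squared norm of f up to (e / 2)^2. *)
Lemma l2norm_ex_finite_comb f (e : R) : 0 < e ->
  exists2 s, uniq s & l2norm (f - finite_comb s f) < e.
Proof.
move=> e0; have : ((l2norm f ^+ 2 - (e / 2) ^+ 2)%:E < sqsum f)%E.
  by rewrite l2norm_sq lte_fin ltrBlDr ltrDl exprn_gt0// divr_gt0.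
move=> /ereal_sup_gt[_ [F [finF _] <-]].
rewrite fsbig_finite//= sumEFin lte_fin; set s := finmap.enum_fset _ => Fs.
have us : uniq s by exact: finmap.fset_uniq.
exists s => //.
have fs : (sqsum f
    = sqsum (finite_comb s f) + sqsum (l2val (f - finite_comb s f)%R))%E.
  rewrite -esumD; try by move=> v _; rewrite lee_fin sqr_ge0.
  apply: eq_esum => v _; rewrite l2valB finite_combE// -EFinD; congr EFin.
  by case: ifP => _; rewrite ?subrr ?subr0 Normc.normc0 expr0n/= ?addr0 ?add0r.
move: fs; rewrite sqsum_finite_comb// !l2norm_sq -EFinD => -[fs].
apply: (@le_lt_trans _ _ (e / 2)); last by lra.
rewrite -(@ler_pXn2r _ 2)// ?nnegrE ?l2norm_ge0 ?divr_ge0 ?(ltW e0)//.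
by move: Fs fs; lra.
Qed.

Lemma finite_comb_ind (A : l2 R V -> Prop) : A 0 ->
  (forall c x y, A x -> A y -> A (c *: x + y)) ->
  (forall u, A (basis_vec R u)) -> forall s c, A (finite_comb s c).
Proof.
move=> A0 AD Ae s c; rewrite /finite_comb; elim: s => [|u s ih].
  by rewrite big_nil.
by rewrite big_cons; exact: AD.
Qed.

Definition restr_proof (P : pred V) f : (fun v => if P v then f v else 0) \in @l2pred R V.
Proof.
apply/asboolP; apply: (@le_lt_trans _ _ (sqsum f)); last by rewrite l2norm_sq ltry.
by apply: le_sqsum => v; case: ifP => _ //; rewrite Normc.normc0 normc_ge0.
Qed.

Definition restr (P : pred V) f : l2 R V := L2 (restr_proof P f).

Lemma restrE P f v : restr P f v = if P v then f v else 0. Proof. by []. Qed.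

Lemma restr_linear P : linear (restr P).
Proof.
move=> c f g; apply: l2_eq => v; rewrite !l2valE !restrE.
by case: ifP => _; rewrite ?l2valE ?mulr0 ?addr0.
Qed.

Lemma l2norm_le_coord f g : (forall v, normc (f v) <= normc (g v)) -> l2norm f <= l2norm g.
Proof.
move=> fg; rewrite -sqsum_le_l2norm ?l2norm_ge0// -l2norm_sq.
exact: le_sqsum.
Qed.

Lemma l2norm_restr P f : l2norm (restr P f) <= l2norm f.
Proof.
apply: l2norm_le_coord => v; rewrite restrE; case: ifP => _ //.
by rewrite Normc.normc0 normc_ge0.
Qed.

End FiniteCombinations.

Section Topology.
Variables (R : realType) (V : choiceType).
Implicit Types f g : l2 R V.

Lemma ltc0_real (e : R[i]) : 0 < e -> exists2 r : R, 0 < r & e = (r%:C)%C.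
Proof.
case: e => a b; rewrite ltcE/= => /andP[/eqP-> a0].
by exists a.
Qed.

Lemma l2_closureP (A : set (l2 R V)) x :
  closure A x <-> forall e : R, 0 < e -> exists2 y, A y & l2norm (x - y) < e.
Proof.
split=> [clA e e0|h B].
  have ec : 0 < (e%:C)%C :> R[i] by rewrite ltcR.
  have [y [Ay]] := clA _ (nbhsx_ballx x _ ec).
  rewrite -ball_normE /= l2_normE ltcR => xy; by exists y.
move=> /nbhs_ballP[_ /ltc0_real[e e0 ->]] eB.
have [y Ay xy] := h e e0; exists y; split => //.
by apply: eB; rewrite -ball_normE /= l2_normE ltcR.
Qed.

Lemma l2_cvg0P (x : nat -> l2 R V) :
  x @ \oo --> (0 : l2 R V) <-> (fun n => l2norm (x n)) @ \oo --> (0 : R).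
Proof.
split.
  move=> /cvgrPdist_lt h; apply/cvgrPdist_lt => e e0.
  have ec : 0 < (e%:C)%C :> R[i] by rewrite ltcR.
  have := h _ ec; apply: filterS => n.
  by rewrite sub0r l2_normE ltcR l2normN sub0r normrN ger0_norm ?l2norm_ge0.
move=> /cvgrPdist_lt h; apply/cvgrPdist_lt => _ /ltc0_real[e e0 ->].
have := h _ e0; apply: filterS => n.
by rewrite !sub0r l2_normE ltcR l2normN normrN ger0_norm ?l2norm_ge0.
Qed.

Lemma closure_lin (A : set (l2 R V)) : 
  (forall c x y, A x -> A y -> A (c *: x + y)) ->
  forall c x y, closure A x -> closure A y -> closure A (c *: x + y).
Proof.
move=> AD c f g /l2_closureP Af /l2_closureP Ag; apply/l2_closureP => d d0.
have c1 : 0 < normc c + 1 by rewrite ltr_wpDl ?normc_ge0.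
have [f' Af' ff'] := Af (d / 2 / (normc c + 1)) ltac:(by rewrite !divr_gt0).
have [g' Ag' gg'] := Ag (d / 2) ltac:(by rewrite divr_gt0).
exists (c *: f' + g'); first exact: AD.
have -> : c *: f + g - (c *: f' + g') = c *: (f - f') + (g - g') by l2ring.
apply: (le_lt_trans (ler_l2normD _ _)); rewrite l2normZ [ltRHS](splitr d).
rewrite ler_ltD//; move: ff'; rewrite ltr_pdivlMr// => /ltW; apply: le_trans.
by rewrite mulrC ler_wpM2l ?l2norm_ge0// lerDl.
Qed.

Lemma subspace_dense (A : set (l2 R V)) : A 0 ->
  (forall c x y, A x -> A y -> A (c *: x + y)) ->
  (forall u, closure A (basis_vec R u)) -> closure A = setT.
Proof.
move=> A0 AD Ae; rewrite -subTset => x _; apply: closed_closure.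
apply/l2_closureP => e e0; have [s us xs] := l2norm_ex_finite_comb x e0.
exists (finite_comb s x) => //; apply: finite_comb_ind => //; first exact: subset_closure.
exact: closure_lin.
Qed.

End Topology.

(** * Inner product and adjoint *)

Section AbsolutelySummable.
Variables (R : realType) (V : choiceType).

Definition asum (h : V -> R[i]) : \bar R := \esum_(v in [set: V]) (normc (h v))%:E.

Lemma asum_ge0 h : (0 <= asum h)%E.
Proof. by apply: esum_ge0 => v _; rewrite lee_fin normc_ge0. Qed.

Lemma esum_fin_num (k : V -> R) : (forall v, 0 <= k v) ->
  (\esum_(v in [set: V]) (k v)%:E < +oo)%E ->
  (\esum_(v in [set: V]) (k v)%:E)%E \is a fin_num.
Proof.
by move=> k0; rewrite ge0_fin_numE//; apply: esum_ge0 => v _; rewrite lee_fin.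
Qed.

(** Frees [rsum] from positive and negative parts: any decomposition into
    summable nonnegative families computes it.  Additivity and homogeneity
    follow by choosing decompositions that add up. *)
Lemma rsum_split (h p q : V -> R) : (forall v, 0 <= p v) -> (forall v, 0 <= q v) ->
  (\esum_(v in [set: V]) (p v)%:E < +oo)%E ->
  (\esum_(v in [set: V]) (q v)%:E < +oo)%E ->
  (forall v, h v = p v - q v) ->
  rsum h = fine (\esum_(v in [set: V]) (p v)%:E) - fine (\esum_(v in [set: V]) (q v)%:E).
Proof.
move=> p0 q0 sp sq hpq.
have sE (k : V -> R) : (forall v, 0 <= k v) ->
    (\esum_(v in [set: V]) (k v)%:E < +oo)%E -> summable [set: V] (EFin \o k).
  move=> k0 sk; rewrite /summable; apply: le_lt_trans sk.
  by apply: le_esum => v _ /=; rewrite lee_fin ger0_norm.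
rewrite /rsum (_ : EFin \o h = (EFin \o p) \- (EFin \o q))%E; last first.
  by apply/funext => v /=; rewrite hpq EFinB.
rewrite esumB; [|exact: sE|exact: sE|by move=> v _; rewrite lee_fin|
  by move=> v _; rewrite lee_fin].
by rewrite fineB; [|exact: esum_fin_num|exact: esum_fin_num].
Qed.

Lemma max0B (x : R) : Num.max x 0 - Num.max (- x) 0 = x.
Proof.
have [x0|x0] := leP 0 x.
  by rewrite max_r ?oppr_le0// subr0.
by rewrite max_l ?oppr_ge0 ?(ltW x0)// opprK add0r.
Qed.

Lemma rsum_parts (h : V -> R) : (\esum_(v in [set: V]) (`|h v|)%:E < +oo)%E ->
  rsum h = fine (\esum_(v in [set: V]) (Num.max (h v) 0)%:E)
     - fine (\esum_(v in [set: V]) (Num.max (- h v) 0)%:E)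
  /\ (\esum_(v in [set: V]) (Num.max (h v) 0)%:E < +oo)%E
  /\ (\esum_(v in [set: V]) (Num.max (- h v) 0)%:E < +oo)%E.
Proof.
move=> sh.
have s1 : (\esum_(v in [set: V]) (Num.max (h v) 0)%:E < +oo)%E.
  apply: le_lt_trans sh; apply: le_esum => v _.
  by rewrite lee_fin ge_max normr_ge0 ler_norm.
have s2 : (\esum_(v in [set: V]) (Num.max (- h v) 0)%:E < +oo)%E.
  apply: le_lt_trans sh; apply: le_esum => v _.
  by rewrite lee_fin ge_max normr_ge0 -normrN ler_norm.
split=> //; apply: rsum_split => // v; try by rewrite le_max lexx orbT.
by rewrite max0B.
Qed.

Lemma rsumD (h k : V -> R) :
  (\esum_(v in [set: V]) (`|h v|)%:E < +oo)%E ->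
  (\esum_(v in [set: V]) (`|k v|)%:E < +oo)%E ->
  rsum (fun v => h v + k v) = rsum h + rsum k.
Proof.
move=> /rsum_parts[-> [h1 h2]] /rsum_parts[-> [k1 k2]].
have pos (x : R) : 0 <= Num.max x 0 by rewrite le_max lexx orbT.
have sD (l l' : V -> R) :
    (\esum_(v in [set: V]) (Num.max (l v) 0 + Num.max (l' v) 0)%:E)%E
    = (\esum_(v in [set: V]) (Num.max (l v) 0)%:E
      + \esum_(v in [set: V]) (Num.max (l' v) 0)%:E)%E.
  rewrite -esumD; try by move=> v _; rewrite lee_fin.
  by apply: eq_esum => v _; rewrite EFinD.
rewrite (@rsum_split _ (fun v => Num.max (h v) 0 + Num.max (k v) 0)
  (fun v => Num.max (- h v) 0 + Num.max (- k v) 0)); rewrite ?sD ?lte_add_pinfty//.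
- by rewrite !fineD ?esum_fin_num//; lra.
- by move=> v; rewrite addr_ge0.
- by move=> v; rewrite addr_ge0.
by move=> v; have := max0B (h v); have := max0B (k v); lra.
Qed.

Lemma rsumN (h : V -> R) : (\esum_(v in [set: V]) (`|h v|)%:E < +oo)%E ->
  rsum (fun v => - h v) = - rsum h.
Proof.
move=> sh; have := sh; move=> /rsum_parts[-> _].
have [|-> _] := @rsum_parts (fun v => - h v).
  by under eq_esum do rewrite normrN.
by under [in X in X - _]eq_esum do rewrite ?opprK; under [in X in _ - X]eq_esum do rewrite opprK;
  rewrite opprB.
Qed.

Lemma rsumZ (a : R) (h : V -> R) : (\esum_(v in [set: V]) (`|h v|)%:E < +oo)%E ->
  rsum (fun v => a * h v) = a * rsum h.
Proof.
have key (b : R) (k : V -> R) : 0 <= b ->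
    (\esum_(v in [set: V]) (`|k v|)%:E < +oo)%E ->
    rsum (fun v => b * k v) = b * rsum k.
  move=> b0 /rsum_parts[-> [k1 k2]].
  have pos (x : R) : 0 <= Num.max x 0 by rewrite le_max lexx orbT.
  rewrite (@rsum_split _ (fun v => b * Num.max (k v) 0)
    (fun v => b * Num.max (- k v) 0)).
  - by rewrite !esumZl// !fineM ?esum_fin_num// mulrBr.
  - by move=> v; rewrite mulr_ge0.
  - by move=> v; rewrite mulr_ge0.
  - by rewrite esumZl// lte_mul_pinfty ?lee_fin// .
  - by rewrite esumZl// lte_mul_pinfty ?lee_fin// .
  - move=> v; rewrite -mulrBr; congr (_ * _).
    by rewrite max0B.
have [a0|a0] := leP 0 a; first exact: key.
move=> sh; rewrite -[a]opprK (_ : (fun v => _) = (fun v => - a * - h v)); last first.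
  by apply/funext => v; rewrite opprK mulrNN.
rewrite key ?oppr_ge0 ?(ltW a0)//.
  by rewrite rsumN// opprK mulrNN.
by under eq_esum do rewrite normrN.
Qed.

Lemma rsum_bound (h : V -> R) : (\esum_(v in [set: V]) (`|h v|)%:E < +oo)%E ->
  `|rsum h| <= fine (\esum_(v in [set: V]) (`|h v|)%:E).
Proof.
move=> sh; have [-> [h1 h2]] := rsum_parts sh.
have pos (x : R) : 0 <= Num.max x 0 by rewrite le_max lexx orbT.
have le0 (l : V -> R) : (forall v, 0 <= l v) ->
    0 <= fine (\esum_(v in [set: V]) (l v)%:E).
  by move=> l0; rewrite fine_ge0//; apply: esum_ge0 => v _; rewrite lee_fin.
rewrite ler_norml lerBlDr lerBrDr addrC.
have l1 : fine (\esum_(v in [set: V]) (Num.max (h v) 0)%:E)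
   <= fine (\esum_(v in [set: V]) (`|h v|)%:E).
  rewrite fine_le ?esum_fin_num//; apply: le_esum => v _.
  by rewrite lee_fin ge_max normr_ge0 ler_norm.
have l2 : fine (\esum_(v in [set: V]) (Num.max (- h v) 0)%:E)
   <= fine (\esum_(v in [set: V]) (`|h v|)%:E).
  rewrite fine_le ?esum_fin_num//; apply: le_esum => v _.
  by rewrite lee_fin ge_max normr_ge0 -normrN ler_norm.
have := le0 (fun v => Num.max (h v) 0) (fun v => pos _).
have := le0 (fun v => Num.max (- h v) 0) (fun v => pos _).
by move: l1 l2; lra.
Qed.

Lemma asum_Re (h : V -> R[i]) : (asum h < +oo)%E ->
  (\esum_(v in [set: V]) (`|complex.Re (h v)|)%:E < +oo)%E.
Proof. by apply: le_lt_trans; apply: le_esum => v _; rewrite lee_fin le_Re_normc. Qed.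

Lemma asum_Im (h : V -> R[i]) : (asum h < +oo)%E ->
  (\esum_(v in [set: V]) (`|complex.Im (h v)|)%:E < +oo)%E.
Proof. by apply: le_lt_trans; apply: le_esum => v _; rewrite lee_fin le_Im_normc. Qed.

Lemma csum_lin (c : R[i]) (h k : V -> R[i]) : (asum h < +oo)%E -> (asum k < +oo)%E ->
  csum (fun v => c * h v + k v) = c * csum h + csum k.
Proof.
case: c => a b sh sk.
have hr := asum_Re sh; have hi := asum_Im sh.
have kr := asum_Re sk; have ki := asum_Im sk.
have sZ (x : R) (l : V -> R) : (\esum_(v in [set: V]) (`|l v|)%:E < +oo)%E ->
    (\esum_(v in [set: V]) (`|x * l v|)%:E < +oo)%E.
  move=> sl; under eq_esum do rewrite normrM.
  by rewrite esumZl// lte_mul_pinfty ?lee_fin.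
have sD (l l' : V -> R) : (\esum_(v in [set: V]) (`|l v|)%:E < +oo)%E ->
    (\esum_(v in [set: V]) (`|l' v|)%:E < +oo)%E ->
    (\esum_(v in [set: V]) (`|l v + l' v|)%:E < +oo)%E.
  move=> sl sl'; apply: (@le_lt_trans _ _ (\esum_(v in [set: V]) (`|l v|%:E + `|l' v|%:E))%E).
    by apply: le_esum => v _; rewrite -EFinD lee_fin ler_normD.
  rewrite esumD; try by move=> v _; rewrite lee_fin.
  by rewrite lte_add_pinfty.
have reE : complex.Re (csum (fun v => (a +i* b)%C * h v + k v))
   = a * rsum (fun v => complex.Re (h v)) + (- b) * rsum (fun v => complex.Im (h v))
     + rsum (fun v => complex.Re (k v)).
  rewrite -(rsumZ a hr) -(rsumZ (- b) hi) -(rsumD (sZ _ _ hr) (sZ _ _ hi)).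
  rewrite -(rsumD (sD _ _ (sZ _ _ hr) (sZ _ _ hi)) kr).
  congr rsum; apply/funext => v /=; case: (h v) => x y; case: (k v) => z t /=.
  by rewrite mulNr.
have imE : complex.Im (csum (fun v => (a +i* b)%C * h v + k v))
   = a * rsum (fun v => complex.Im (h v)) + b * rsum (fun v => complex.Re (h v))
     + rsum (fun v => complex.Im (k v)).
  rewrite -(rsumZ a hi) -(rsumZ b hr) -(rsumD (sZ _ _ hi) (sZ _ _ hr)).
  rewrite -(rsumD (sD _ _ (sZ _ _ hi) (sZ _ _ hr)) ki).
  congr rsum; apply/funext => v /=; case: (h v) => x y; case: (k v) => z t /=.
  by [].
by rewrite [LHS]complexE reE imE [RHS]complexE /csum /= mulNr.
Qed.

(** Real and imaginary parts are bounded separately, hence the factor 2; only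
    the existence of a bound matters below. *)
Lemma csum_bound (h : V -> R[i]) : (asum h < +oo)%E -> normc (csum h) <= 2 * fine (asum h).
Proof.
move=> sh; apply: le_trans (normc_ReIm _) _; rewrite /csum /=.
rewrite mulr_natl mulr2n; apply: lerD.
  apply: le_trans (rsum_bound (asum_Re sh)) _; rewrite fine_le ?esum_fin_num ?asum_Re//.
    by move=> v; rewrite normc_ge0.
  by apply: le_esum => v _; rewrite lee_fin le_Re_normc.
apply: le_trans (rsum_bound (asum_Im sh)) _; rewrite fine_le ?esum_fin_num ?asum_Im//.
  by move=> v; rewrite normc_ge0.
by apply: le_esum => v _; rewrite lee_fin le_Im_normc.
Qed.

Lemma csum_conj (h : V -> R[i]) : (asum h < +oo)%E ->
  csum (fun v => (h v)^*)%C = ((csum h)^*)%C.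
Proof.
move=> sh; rewrite /csum /=; congr (_ +i* _)%C.
  by congr rsum; apply/funext => v /=; case: (h v).
rewrite -(rsumN (asum_Im sh)); congr rsum; apply/funext => v /=.
by case: (h v).
Qed.

Lemma csum_supp1 (h : V -> R[i]) u : (forall v, v != u -> h v = 0) -> csum h = h u.
Proof.
move=> h0.
have r1 (k : V -> R) : (forall v, v != u -> k v = 0) -> rsum k = k u.
  move=> k0.
  have s1 (l : V -> R) : 0 <= l u -> (forall v, v != u -> l v = 0) ->
      (\esum_(v in [set: V]) (l v)%:E)%E = (l u)%:E.
    move=> l0 lu; rewrite (esumID [set u])//; last first.
      by move=> v _; have [->|/lu->] := eqVneq v u; rewrite lee_fin.
    rewrite !setTI esum_set1 ?lee_fin// esum1 ?adde0// => v /= /eqP vu.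
    by rewrite lu.
  have [] := @rsum_parts k.
    by rewrite s1// ?ltry// => v /k0->; rewrite normr0.
  move=> -> _; rewrite !s1/= ?max0B//; try by rewrite le_max lexx orbT.
    by move=> v /k0->; rewrite oppr0 maxxx.
  by move=> v /k0->; rewrite maxxx.
rewrite /csum (r1 (@complex.Re R \o h)) ?(r1 (@complex.Im R \o h))/=.
- by case: (h u).
- by move=> v /h0->.
by move=> v /h0->.
Qed.

Implicit Types f g : l2 R V.

Lemma normc_conj (z : R[i]) : normc (z^*)%C = normc z.
Proof. by case: z => a b /=; rewrite sqrrN. Qed.

Lemma mulc_conj (z : R[i]) : z * (z^*)%C = ((normc z ^+ 2)%:C)%C.
Proof.
case: z => a b /=; rewrite sqr_sqrtr ?addr_ge0 ?sqr_ge0//.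
by apply/eqP; rewrite eq_complex/=; apply/andP; split; apply/eqP; ring.
Qed.

Lemma asum_inner f g :
  (asum (fun v => f v * (g v)^*%C)%R <= ((l2norm f ^+ 2 + l2norm g ^+ 2)%:E))%E.
Proof.
rewrite EFinD -!l2norm_sq -esumD; try by move=> v _; rewrite lee_fin sqr_ge0.
apply: le_esum => v _; rewrite -EFinD lee_fin Normc.normcM.
rewrite normc_conj; have := normc_ge0 (f v); have := normc_ge0 (g v).
move: (normc (f v)) (normc (g v)) => a b b0 a0.
have := sqr_ge0 (a - b); rewrite sqrrB mulr2n; have := mulr_ge0 a0 b0; nra.
Qed.

Lemma asum_inner_lt f g : (asum (fun v => f v * (g v)^*%C)%R < +oo)%E.
Proof. by apply: le_lt_trans (asum_inner f g) _; rewrite ltry. Qed.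

Lemma inner_linl c f f' g : inner (c *: f + f') g = c * inner f g + inner f' g.
Proof.
rewrite /inner -csum_lin; try exact: asum_inner_lt.
by congr csum; apply/funext => v; rewrite l2valD l2valZ mulrDl mulrA.
Qed.

Lemma inner_conj f g : inner g f = ((inner f g)^*)%C.
Proof.
rewrite /inner -csum_conj; last exact: asum_inner_lt.
congr csum; apply/funext => v; rewrite rmorphM/= mulrC.
by case: (f v) (g v) => [a b] [c d]; rewrite /= opprK.
Qed.

Lemma inner_linr c f g g' : inner f (c *: g + g') = (c^*)%C * inner f g + inner f g'.
Proof.
by rewrite inner_conj inner_linl rmorphD rmorphM (inner_conj g f) (inner_conj g' f).
Qed.

Lemma inner0l g : inner 0 g = 0.
Proof. by have := inner_linl (-1) 0 0 g; rewrite scaler0 addr0 mulN1r addNr. Qed.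

Lemma inner0r g : inner g 0 = 0.
Proof. by rewrite inner_conj inner0l rmorph0. Qed.

Lemma innerZl c f g : inner (c *: f) g = c * inner f g.
Proof. by rewrite -[c *: f]addr0 inner_linl inner0l addr0. Qed.

Lemma innerZr c f g : inner f (c *: g) = (c^*)%C * inner f g.
Proof. by rewrite -[c *: g]addr0 inner_linr inner0r addr0. Qed.

Lemma inner_basisr f u : inner f (basis_vec R u) = f u.
Proof.
rewrite /inner (@csum_supp1 _ u); first by rewrite basis_vecE eqxx rmorph1 mulr1.
by move=> v /negbTE vu; rewrite basis_vecE vu rmorph0 mulr0.
Qed.

Lemma inner_self f : inner f f = ((l2norm f ^+ 2)%:C)%C.
Proof.
have ff v : f v * ((f v)^*)%C = ((normc (f v) ^+ 2)%:C)%C.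
  exact: mulc_conj.
have := l2norm_sq f; rewrite /sqsum => sE.
rewrite /inner /csum; congr (_ +i* _)%C.
  rewrite (@rsum_split _ (fun v => normc (f v) ^+ 2) (fun=> 0)).
  - by rewrite sE/= esum1//= subr0.
  - by move=> v; rewrite sqr_ge0.
  - by [].
  - by rewrite sE ltry.
  - by rewrite esum1// ltry.
  by move=> v /=; rewrite ff/= subr0.
rewrite (@rsum_split _ (fun=> 0) (fun=> 0)) ?subrr// ?esum1//.
by move=> v /=; rewrite ff.
Qed.

(** A Cauchy-Schwarz inequality with a loose constant: a bound by
    a multiple of |f|^2 + |g|^2 is applied to the normalized vectors. *)
Lemma inner_bound f g : normc (inner f g) <= 4 * (l2norm f * l2norm g).
Proof.
have weak (x y : l2 R V) : normc (inner x y) <= 2 * (l2norm x ^+ 2 + l2norm y ^+ 2).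
  apply: le_trans (csum_bound (asum_inner_lt x y)) _.
  rewrite ler_wpM2l// -lee_fin fineK ?asum_inner//.
  by rewrite ge0_fin_numE ?asum_ge0// asum_inner_lt.
have z0 (x y : l2 R V) : l2norm x = 0 -> inner x y = 0.
  by move=> /l2norm_eq0->; rewrite inner0l.
have [f0|f0] := eqVneq (l2norm f) 0.
  by rewrite z0// Normc.normc0 f0 mul0r mulr0.
have [g0|g0] := eqVneq (l2norm g) 0.
  by rewrite inner_conj z0// rmorph0 Normc.normc0 g0 !mulr0.
have fp : 0 < l2norm f by rewrite lt_def f0 l2norm_ge0.
have gp : 0 < l2norm g by rewrite lt_def g0 l2norm_ge0.
have := weak (((l2norm f)^-1%:C)%C *: f) (((l2norm g)^-1%:C)%C *: g).
rewrite innerZl innerZr !Normc.normcM normc_conj !l2normZ !normc_id !gtr0_norm ?invr_gt0// !mulVf//.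
rewrite expr1n ler_pdivrMl// ler_pdivrMl// => /le_trans; apply.
by rewrite le_eqVlt; apply/orP; left; apply/eqP; ring.
Qed.

End AbsolutelySummable.

Section Adjoint.
Variables (R : realType) (V : choiceType).
Implicit Types f g : l2 R V.
Variables (A : l2 R V -> l2 R V) (M : R).
Hypotheses (linA : linear A) (M0 : 0 < M) (AM : bounded_by A M).

(** Riesz representation in coordinates: the adjoint is forced on basis
    vectors, and testing A on finite combinations whose coefficients are the
    candidate's own coordinates bounds its norm. *)
Lemma adjoint_l2 g : (fun u => inner g (A (basis_vec R u))) \in @l2pred R V.
Proof.
pose b u := inner g (A (basis_vec R u)).
pose K := 4 * (M * l2norm g).
have K0 : 0 <= K by rewrite !mulr_ge0 ?l2norm_ge0 ?(ltW M0).
apply/asboolP; apply: (@le_lt_trans _ _ (K ^+ 2)%:E); last by rewrite ltry.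
apply: sqsum_ub => s us; rewrite lee_fin -/b.
set t := \sum_(u <- s) _.
have t0 : 0 <= t by apply: sumr_ge0 => u _; rewrite sqr_ge0.
have nt : l2norm (finite_comb s b) = Num.sqrt t by rewrite /l2norm sqsum_finite_comb.
have it : inner g (A (finite_comb s b)) = (t%:C)%C.
  rewrite /finite_comb /t {us t t0 nt}; elim: s => [|u s ih].
    by rewrite !big_nil (lin0 linA) inner_conj inner0l rmorph0.
  rewrite !big_cons (linZD linA) inner_linr ih rmorphD; congr (_ + _).
  by rewrite -/(b u) mulrC mulc_conj.
have := inner_bound g (A (finite_comb s b)); rewrite it normc_id ger0_norm// => h.
have {h} : t <= K * Num.sqrt t.
  apply: le_trans h _; rewrite -nt /K -!mulrA ler_wpM2l// mulrCA.
  by rewrite ler_wpM2l ?l2norm_ge0.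
rewrite -{1}(sqr_sqrtr t0) expr2; have := sqrtr_ge0 t.
rewrite le_eqVlt => /predU1P[t00 _|tp].
  by rewrite -(sqr_sqrtr t0) -t00 expr0n sqr_ge0.
rewrite ler_pM2r// => tK; rewrite -(sqr_sqrtr t0).
by rewrite ler_sqr// ?nnegrE ?sqrtr_ge0.
Qed.

Definition adj g : l2 R V := L2 (adjoint_l2 g).

(** Both sides agree on finite combinations, are linear in f and continuous. *)
Lemma adj_spec f g : inner (A f) g = inner f (adj g).
Proof.
have cs s c : inner (A (finite_comb s c)) g = inner (finite_comb s c) (adj g).
  rewrite /finite_comb; elim: s => [|u s ih]; first by rewrite !big_nil (lin0 linA) !inner0l.
  rewrite !big_cons (linZD linA) !inner_linl ih; congr (_ * _ + _).
  by rewrite [RHS]inner_conj inner_basisr; exact: inner_conj.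
apply/eqP; rewrite -subr_eq0; apply/negPn; rewrite -normc_gt0; apply/negP => h0.
set d := normc _ in h0.
pose K := 4 * (M * l2norm g) + 4 * l2norm (adj g) + 1.
have K0 : 0 < K by rewrite ltr_wpDl// addr_ge0// !mulr_ge0 ?l2norm_ge0 ?(ltW M0).
have [s us fs] := l2norm_ex_finite_comb f (divr_gt0 h0 K0).
have dE : inner (A f) g - inner f (adj g)
  = inner (A (f - finite_comb s f)) g - inner (f - finite_comb s f) (adj g).
  have -> : f - finite_comb s f = (-1) *: finite_comb s f + f by l2ring.
  by rewrite (linZD linA) !inner_linl cs; ring.
have : d < d.
  rewrite {1}/d dE; apply: le_lt_trans (ler_normcD _ _) _.
  rewrite [X in _ + X]normcN.
  apply: le_lt_trans (lerD (inner_bound _ _) (inner_bound _ _)) _.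
  move: fs; rewrite ltr_pdivlMr//; apply: le_lt_trans; rewrite /K.
  have := AM (f - finite_comb s f); have := l2norm_ge0 (f - finite_comb s f).
  have := l2norm_ge0 (A (f - finite_comb s f)); have := l2norm_ge0 g.
  have := l2norm_ge0 (adj g).
  move: (l2norm (A (f - finite_comb s f))) (l2norm (f - finite_comb s f)).
  move: (l2norm g) (l2norm (adj g)).
  move=> y z p q z0 y0 p0 q0 pq.
  have : p * y <= M * q * y by rewrite ler_wpM2r.
  by nra.
by rewrite ltxx.
Qed.

Lemma adjointE g u : adjoint A g u = inner g (A (basis_vec R u)).
Proof.
have spec : forall f g, inner (A f) g = inner f (adjoint A g).
  rewrite /adjoint; case: xgetP => [B _ //|/(_ adj) []]; exact: adj_spec.
have := spec (basis_vec R u) g.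
by rewrite inner_conj [RHS]inner_conj inner_basisr => /(congr1 (fun z => z^*%C)); rewrite !conjcK.
Qed.

Lemma adjoint_spec f g : inner (A f) g = inner f (adjoint A g).
Proof.
by rewrite (_ : adjoint A g = adj g) ?adj_spec//; apply: l2_eq => u; rewrite adjointE.
Qed.

Lemma adjoint_linear : linear (adjoint A).
Proof.
by move=> c f g; apply: l2_eq => u; rewrite !l2valE !adjointE inner_linl.
Qed.

End Adjoint.

(** * Resolvents, and operators whose spectrum is a disc *)

Section Resolvent.
Variables (R : realType) (V : choiceType).
Implicit Types (x y : l2 R V) (N T L : l2 R V -> l2 R V) (w : R[i]).

Lemma bounded_comp T L : bounded_operator T -> bounded_operator L ->
  bounded_operator (T \o L).
Proof.
move=> /bounded_operatorP[linT [M M0 TM]] /bounded_operatorP[linL [M' M'0 LM']].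
apply/bounded_operatorP; split; first exact: lin_comp.
exists (M * M'); first exact: mulr_gt0.
by apply: bounded_by_comp; rewrite ?ltW.
Qed.

Lemma bounded_lin T L c : bounded_operator T -> bounded_operator L ->
  bounded_operator (fun x => c *: T x + L x).
Proof.
move=> /bounded_operatorP[linT [M M0 TM]] /bounded_operatorP[linL [M' M'0 LM']].
apply/bounded_operatorP; split.
  by move=> a x y; rewrite linT linL; l2ring.
exists (normc c * M + M'); first by rewrite ltr_wpDl// mulr_ge0 ?normc_ge0 ?ltW.
move=> x; apply: le_trans (ler_l2normD _ _) _; rewrite l2normZ mulrDl lerD//.
by rewrite -mulrA ler_wpM2l ?normc_ge0.
Qed.

Lemma bounded_id : bounded_operator (fun x => x).
Proof.
apply/bounded_operatorP; split => //.
by exists 1 => // x; rewrite mul1r.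
Qed.

Lemma bounded_0 : bounded_operator (fun _ : l2 R V => (0 : l2 R V)).
Proof.
apply/bounded_operatorP; split; first by move=> c x y; rewrite scaler0 addr0.
by exists 1 => // x; rewrite l2norm0 mul1r l2norm_ge0.
Qed.

Lemma bounded_scale c T : bounded_operator T -> bounded_operator (fun x => c *: T x).
Proof.
move=> bT; have := bounded_lin c bT bounded_0.
by congr bounded_operator; apply/funext => x; rewrite addr0.
Qed.

Lemma bounded_shifted T w : bounded_operator T -> bounded_operator (shifted T w).
Proof.
move=> bT; have := bounded_lin (- w) bounded_id bT.
by congr bounded_operator; apply/funext => x; rewrite scaleNr addrC.
Qed.

Lemma iter_scale c N k x : linear N ->
  iter k (fun y => c *: N y) x = c ^+ k *: iter k N x.
Proof.
move=> linN; elim: k => [|k ih]; first by rewrite scale1r.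
by rewrite !iterS ih (linZ linN) scalerA exprS.
Qed.

(** Neumann series for S - w = - w (1 - w^-1 S). *)
Lemma invertible_shifted N w (C q : R) : linear N -> 0 <= C -> 0 <= q < normc w ->
  (forall k x, l2norm (iter k N x) <= C * q ^+ k * l2norm x) ->
  invertible (shifted N w).
Proof.
move=> linN C0 /andP[q0 qw] NC.
have wp : 0 < normc w by exact: le_lt_trans qw.
have w0 : w != 0 by rewrite -normc_gt0.
pose Nw x := w^-1 *: N x.
have linNw : linear Nw by move=> c x y; rewrite /Nw linN; l2ring.
have [J [bJ J1 J2]] : exists J, [/\ bounded_operator J, forall x, J (x - Nw x) = x
              & forall x, J x - Nw (J x) = x].
  apply: (@neumann _ _ Nw C (q / normc w)) => //.
    by rewrite divr_ge0 ?normc_ge0//= ltr_pdivrMr// mul1r.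
  move=> k x; rewrite /Nw iter_scale// l2normZ normcX Normc.normcV exprMn.
  rewrite mulrA [leRHS]mulrAC mulrC ler_wpM2r ?exprn_ge0 ?invr_ge0 ?normc_ge0//.
have sE x : shifted N w x = - w *: (x - Nw x).
  apply: l2_eq => v; rewrite /shifted /Nw !l2valE; field; exact: w0.
exists (fun x => - w^-1 *: J x); split; first exact: bounded_scale.
  move=> x; rewrite sE; have /bounded_operatorP[linJ _] := bJ.
  by rewrite (linZ linJ) J1 scalerA mulrNN mulVf// scale1r.
move=> x; rewrite sE /Nw (linZ linN) -/(Nw (J x)).
rewrite [w^-1 *: _](_ : _ = - w^-1 *: Nw (J x)).
  by rewrite -scalerBr J2 scalerA mulrNN mulfV// scale1r.
by rewrite /Nw; l2ring.
Qed.

Lemma invertible_comp T L : invertible T -> invertible L -> invertible (T \o L).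
Proof.
move=> [T' [bT' T1 T2]] [L' [bL' L1 L2]]; exists (L' \o T'); split.
- exact: bounded_comp.
- by move=> x /=; rewrite T1 L1.
- by move=> x /=; rewrite L2 T2.
Qed.

Lemma invertible_scale c T : c != 0 -> linear T -> invertible T -> invertible (fun x => c *: T x).
Proof.
move=> c0 linT [T' [bT' T1 T2]]; exists (fun x => c^-1 *: T' x).
have /bounded_operatorP[linT' _] := bT'.
split; first exact: bounded_scale.
- by move=> x; rewrite (linZ linT') T1 scalerA mulVf// scale1r.
by move=> x; rewrite (linZ linT) T2 scalerA mulfV// scale1r.
Qed.

Lemma norm_notin_spectrum T w (M : R) : linear T -> bounded_by T M -> 0 <= M ->
  M < normc w -> invertible (shifted T w).
Proof.
move=> linT TM M0 Mw; apply: (@invertible_shifted T w 1 M) => //.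
  by rewrite M0 Mw.
by move=> k x; rewrite mul1r; exact: bounded_iter.
Qed.

(** Openness of the resolvent set, used only in the radial direction:
    T - (1 - t) w is a product of T - w and of a small perturbation of 1. *)
Lemma resolvent_shrink T w : linear T -> w != 0 -> invertible (shifted T w) ->
  exists w', normc w' < normc w /\ invertible (shifted T w').
Proof.
move=> linT w0 invw; have [A [bA A1 A2]] := invw.
have /bounded_operatorP[linA [M M0 AM]] := bA.
have wp : 0 < normc w by rewrite normc_gt0.
(* this t makes t |w| M smaller than 1, so that 1 is beyond the norm of t w A *)
pose t := (2 * M * normc w + 1)^-1.
have t'0 : 0 < 2 * M * normc w + 1 by rewrite ltr_wpDl// !mulr_ge0 ?normc_ge0// ltW.
have t0 : 0 < t by rewrite invr_gt0.
have t1 : t < 1.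
  by rewrite invf_lt1// ltrDr !mulr_gt0.
pose w' := ((1 - t)%:C)%C * w; exists w'.
have nw' : normc w' = (1 - t) * normc w.
  by rewrite Normc.normcM normc_id ger0_norm// subr_ge0 ltW.
split; first by rewrite nw' gtr_pMl// gtrBl.
have -> : shifted T w' = shifted (fun x => (- (t%:C)%C * w) *: A x) (1) \o
     (fun x => (- 1) *: shifted T w x).
  apply/funext => x /=; rewrite /shifted (linZ linA) -/(shifted T w x) A1.
  rewrite /w'; apply: l2_eq => v; rewrite !l2valE.
  by rewrite rmorphB/= (_ : (1%:C)%C = 1 :> R[i])//; ring.
apply: invertible_comp; last first.
  apply: invertible_scale; [by rewrite oppr_eq0 oner_eq0| |exact: invw].
  by move=> c x y; rewrite /shifted linT; l2ring.
apply: (@norm_notin_spectrum _ _ (t * normc w * M)).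
- by move=> c x y; rewrite linA; l2ring.
- move=> x; rewrite l2normZ Normc.normcM.
  have -> : normc (- (t%:C)%C) = t by rewrite [LHS]normcN normc_id gtr0_norm.
  by rewrite -[leRHS]mulrA ler_wpM2l ?mulr_ge0 ?normc_ge0 ?(ltW t0).
- by rewrite !mulr_ge0 ?normc_ge0 ?(ltW t0) ?(ltW M0).
rewrite Normc.normc1 /t -mulrA mulrC ltr_pdivrMr// mul1r.
by have := mulr_gt0 M0 wp; lra.
Qed.

(** The moduli of the resolvent points form an upward closed set without least
    element, by [resolvent_shrink]. *)
Lemma spectrum_disc T (M : R) : linear T -> bounded_by T M -> 0 <= M ->
  spectrum T 0 ->
  (forall w w', invertible (shifted T w) -> normc w < normc w' ->
     invertible (shifted T w')) ->
  spectrum T = closed_disc (spectral_radius T).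
Proof.
move=> linT TM M0 s0 up.
have ubT : has_sup [set normc w | w in spectrum T].
  split; first by exists (normc 0); exists 0.
  exists M => _ [w sw <-]; rewrite leNgt; apply/negP => Mw; apply: sw.
  exact: norm_notin_spectrum TM _ _.
apply/seteqP; split => w.
  by move=> sw; rewrite /closed_disc/=; apply: (sup_upper_bound ubT); exists w.
rewrite /closed_disc/= => wr iw.
have w0 : w != 0 by apply: contra_notN s0 => /eqP <-.
have [w' [w'w iw']] := resolvent_shrink linT w0 iw.
have : normc w' < sup [set normc w | w in spectrum T] by exact: lt_le_trans wr.
move=> /(sup_gt ubT.1)[_ [z sz <-] w'z].
by apply: sz; exact: up w'z.
Qed.

End Resolvent.

(** * Dimension of quotients and the Fredholm index *)

Section Dimension.
Variables (C : numFieldType) (H : normedModType C).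
Implicit Types (A B : set H) (d n : nat).

Definition lin_closed A := A 0 /\ forall (c : C) x y, A x -> A y -> A (c *: x + y).

Lemma lin_closed_sum A n (F : 'I_n -> H) (c : 'I_n -> C) : lin_closed A ->
  (forall i, A (F i)) -> A (\sum_i c i *: F i).
Proof.
move=> [A0 AD] AF; elim/big_ind : _ => // [x y Ax Ay|i _].
  by rewrite -[x]scale1r; exact: AD.
by rewrite -[_ *: _]addr0; exact: AD.
Qed.

(** With more vectors than the dimension, the matrix of their coordinates has a
    nonzero row in its kernel, which is a relation between them modulo B. *)
Lemma indep_le_dim A B d n (b' : 'I_n -> H) : lin_closed B -> has_dim_quot A B d ->
  (forall j, A (b' j)) ->
  (forall c : 'I_n -> C, B (\sum_j c j *: b' j) -> forall j, c j = 0) -> (n <= d)%N.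
Proof.
move=> linB [b [Ab hb]] Ab' indep.
have [m hm] := choice (fun j => let: ex_intro c hc := hb (b' j) (Ab' j) in
  ex_intro (fun c : {ffun 'I_d -> C} => B (b' j - \sum_i c i *: b i)) c hc.1).
rewrite leqNgt; apply/negP => dn.
pose M := \matrix_(j < n, i < d) m j i.
have : kermx M != 0.
  rewrite -mxrank_eq0 mxrank_ker subn_eq0 -ltnNge.
  by apply: leq_ltn_trans dn; exact: rank_leq_col.
move=> /rowV0Pn[v /sub_kermxP vM]; apply/negP/negPn/eqP/rowP => j.
rewrite mxE; apply: (indep (fun j => v 0 j)).
have -> : \sum_j v 0 j *: b' j = \sum_j v 0 j *: (b' j - \sum_i m j i *: b i).
  under [in RHS]eq_bigr do rewrite scalerBr.
  rewrite [RHS]sumrB (_ : \sum_j v 0 j *: \sum_i m j i *: b i = 0) ?subr0//.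
  under eq_bigr do rewrite scaler_sumr.
  rewrite exchange_big big1//= => i _.
  under eq_bigr do rewrite scalerA.
  rewrite -scaler_suml; have /rowP/(_ i) := vM; rewrite !mxE => vMi.
  rewrite (_ : \sum_j0 _ = 0) ?scale0r//; rewrite -[RHS]vMi.
  by apply: eq_bigr => k _; rewrite mxE.
exact: lin_closed_sum.
Qed.

Lemma dim_quot_indep A B d (b : 'I_d -> H) : lin_closed A -> lin_closed B ->
  (forall i, A (b i)) ->
  (forall x, A x -> exists! c : {ffun 'I_d -> C}, B (x - \sum_i c i *: b i)) ->
  forall c : 'I_d -> C, B (\sum_j c j *: b j) -> forall j, c j = 0.
Proof.
move=> linA linB Ab hb c Bc j.
have [c' [_ uc']] := hb _ (lin_closed_sum c linA Ab).
have e1 : c' = finfun c.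
  apply: uc'; under [X in _ - X]eq_bigr do rewrite ffunE.
  by rewrite subrr; exact: linB.1.
have e2 : c' = [ffun => 0].
  apply: uc'; under [X in _ - X]eq_bigr do rewrite ffunE scale0r.
  by rewrite big1_eq subr0.
by move: e1; rewrite e2 => /ffunP/(_ j); rewrite !ffunE.
Qed.

Lemma dim_quot_uniq A B d d' : lin_closed A -> lin_closed B ->
  has_dim_quot A B d -> has_dim_quot A B d' -> d = d'.
Proof.
move=> linA linB h h'; apply/eqP; rewrite eqn_leq; apply/andP; split.
  have [b [Ab hb]] := h; apply: (indep_le_dim linB h' Ab).
  exact: dim_quot_indep hb.
have [b [Ab hb]] := h'; apply: (indep_le_dim linB h Ab).
exact: dim_quot_indep hb.
Qed.

Lemma fredholm_indexE (T : H -> H) a b : linear T ->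
  has_dim (ker T) a -> has_codim (range T) b -> fredholm_index T = a%:Z - b%:Z.
Proof.
move=> linT ha hb; rewrite /fredholm_index.
have TD c x y : T (c *: x + y) = c *: T x + T y by exact: linT.
have T0 : T 0 = 0 by have := TD (-1) 0 0; rewrite scaler0 addr0 scaleN1r addNr.
have lk : lin_closed (ker T).
  split; first exact: T0.
  by move=> c x y; rewrite /ker/= TD => -> ->; rewrite scaler0 addr0.
have l0 : lin_closed [set (0 : H)].
  by split => // c x y -> ->; rewrite scaler0 addr0.
have lr : lin_closed (range T).
  split; first by exists 0.
  by move=> c _ _ [x _ <-] [y _ <-]; exists (c *: x + y).
have lT : lin_closed [set: H] by [].
congr (_%:Z - _%:Z).
  case: xgetP => [n _ hn|/(_ a)//]; exact: dim_quot_uniq hn ha.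
case: xgetP => [n _ hn|/(_ b)//]; exact: dim_quot_uniq hn hb.
Qed.

Lemma has_dim0 : has_dim [set (0 : H)] 0.
Proof.
exists (fun=> 0); split => [[]//|x /= ->].
exists [ffun => 0]; split; first by rewrite big_ord0 subr0.
by move=> c _; apply/ffunP => -[].
Qed.

End Dimension.

(** * Rooted directed trees *)

Section Tree.
Variables (V : choiceType) (E : rel V) (root : V).
Hypotheses (treeE : directed_tree E) (rootE : is_root E root) (leafE : leafless E).

Lemma nchildrenSP n (W : set V) v :
  nchildren E n.+1 W v <-> exists2 u, nchildren E n W u & E u v.
Proof. by split=> [[u nu uv]|[u nu uv]]; exists u. Qed.

(** Along an undirected path from the root, each step goes to a child or to the
    unique parent, so it stays among the descendants of the root. *)
Lemma nchildren_total v : exists n, nchildren E n [set root] v.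
Proof.
have [->|vr] := eqVneq root v; first by exists 0%N.
have [p [] ] := tree_connected treeE vr.
suff : forall r, (exists n, nchildren E n [set root] r) ->
    path (fun a b => E a b || E b a) r p -> last r p = v ->
    exists n, nchildren E n [set root] v.
  by apply; exists 0%N.
elim: p => [|a p ih] r /=; first by move=> rn _ <-.
move=> [n rn] /andP[/orP[ra|ar] pa] lp; apply: ih pa lp.
  by exists n.+1; apply/nchildrenSP; exists r.
case: n rn => [rr|n /nchildrenSP[u nu ur]].
  by have := rootE a; rewrite -(_ : r = root) ?ar//.
have nr : ~ is_root E r by move=> /(_ u); rewrite ur.
have [w [_ wu]] := tree_unique_parent treeE nr.
by exists n; rewrite -(wu a ar) (wu u ur).
Qed.

Lemma is_rootE v : is_root E v <-> v = root.
Proof.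
split=> [vr|->//]; have [[//|n]] := nchildren_total v.
by move=> /nchildrenSP[u _ uv]; have := vr u; rewrite uv.
Qed.

Lemma not_rootP v : ~ is_root E v <-> v != root.
Proof.
split=> [h|/eqP h /is_rootE//].
by apply/eqP => vr; apply: h; apply/is_rootE.
Qed.

Lemma edge_not_root u v : E u v -> v != root.
Proof. by move=> uv; apply/not_rootP => /(_ u); rewrite uv. Qed.

Lemma par_edge v : v != root -> E (par E v) v.
Proof.
move=> /not_rootP nr; rewrite /par; case: xgetP => [u _ //|h].
by exfalso; apply: nr => u; apply/negP => uv; exact: (h u).
Qed.

Lemma edge_par u v : E u v -> par E v = u.
Proof.
move=> uv; have vr := edge_not_root uv.
have [w [_ wu]] := tree_unique_parent treeE ((not_rootP _).2 vr).
by rewrite -(wu u uv) -(wu _ (par_edge vr)).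
Qed.

Lemma edgeE u v : E u v = (v != root) && (par E v == u).
Proof.
apply/idP/andP => [uv|[vr /eqP <-]]; last exact: par_edge.
by rewrite (edge_not_root uv) (edge_par uv) eqxx.
Qed.

Lemma nchildren_inj n m v :
  nchildren E n [set root] v -> nchildren E m [set root] v -> n = m.
Proof.
elim: n m v => [|n ih] [|m] v //.
- by move=> -> /nchildrenSP[u _]; rewrite edgeE eqxx.
- by move=> /nchildrenSP[u _ uv] vr; move: uv; rewrite vr edgeE eqxx.
move=> /nchildrenSP[u nu uv] /nchildrenSP[w mw wv].
by congr S; apply: (ih _ u) => //; rewrite -(edge_par uv) (edge_par wv).
Qed.

Local Notation depth := (depth E root).
Local Notation par := (par E).

Lemma depthP n v : nchildren E n [set root] v <-> depth v = n.
Proof.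
have dv : nchildren E (depth v) [set root] v.
  rewrite /Defs.depth; case: xgetP => [//|h].
  by have [m hm] := nchildren_total v; have := h m.
split=> [nv|<-//]; exact: nchildren_inj dv nv.
Qed.

Lemma depth_root : depth root = 0%N.
Proof. exact/depthP. Qed.

Lemma depth_edge u v : E u v -> depth v = (depth u).+1.
Proof.
by move=> uv; apply/depthP/nchildrenSP; exists u => //; exact/depthP.
Qed.

Lemma depth_par v : v != root -> depth v = (depth (par v)).+1.
Proof. by move=> /par_edge/depth_edge. Qed.

Lemma depth_eq0 v : (depth v == 0%N) = (v == root).
Proof.
apply/eqP/eqP => [|->]; last exact: depth_root.
by move=> /depthP.
Qed.

Lemma par_root : par root = root.
Proof.
rewrite /Defs.par; case: xgetP => [u _ ur|//].
by have := rootE u; rewrite ur.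
Qed.

Lemma tree_ind (P : V -> Prop) : P root ->
  (forall v, v != root -> P (par v) -> P v) -> forall v, P v.
Proof.
move=> P0 PS v; move: {2}(depth v) (erefl (depth v)) => n; elim: n v => [|n ih] v.
  by move=> /eqP; rewrite depth_eq0 => /eqP->.
have [->//|vr] := eqVneq v root.
by rewrite (depth_par vr) => -[/ih]; exact: PS.
Qed.

Lemma depth_iter_par k v : depth (iter k par v) = (depth v - k)%N.
Proof.
elim: k => [|k ih]; first by rewrite subn0.
rewrite iterS subnS -ih; move: (iter k par v) => u.
have [->|ur] := eqVneq u root; first by rewrite par_root depth_root.
by rewrite (depth_par ur).
Qed.

(** Meaningful as the only child when u is not branching; elsewhere an
    arbitrary one. *)
Definition child (u : V) : V := xget u [set v | E u v].

Lemma child_edge u : E u (child u).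
Proof.
rewrite /child; case: xgetP => [v _ //|h].
by have [v uv] := leafE u; have := h v.
Qed.

Lemma child_not_root u : child u != root. Proof. exact: edge_not_root (child_edge u). Qed.
Lemma par_child u : par (child u) = u. Proof. exact: edge_par (child_edge u). Qed.
Lemma depth_child u : depth (child u) = (depth u).+1.
Proof. exact: depth_edge (child_edge u). Qed.

Lemma depth_iter_child n u : depth (iter n child u) = (depth u + n)%N.
Proof. by elim: n => [|n ih]; rewrite ?addn0//= depth_child ih addnS. Qed.

Lemma branching_bound : finite_branching_index E root ->
  exists K : nat, forall u v w, (K <= depth u)%N -> E u v -> E u w -> v = w.
Proof.
move=> [K hK]; exists K.+1 => u v w Ku uv uw; apply: contrapT => vw.
have : (depth u <= K)%N.
  rewrite -leEnat; apply: hK; exists u => //; rewrite /branching_vertices /=.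
  pose f n := if n == 0%N then v else w.
  have finj : {in `I_2 &, injective f}.
    move=> [|[|n]] [|[|m]]; rewrite ?inE//= /f/= => _ _ h; exfalso; apply: vw => //.
  rewrite -(card_le_eql (inj_card_eq finj)); apply: subset_card_le.
  by move=> _ [n _ <-]; rewrite /f; exists u => //=; case: ifP.
by rewrite leqNgt Ku.
Qed.

End Tree.

(** * The weighted shift, its spectrum and its Cauchy dual *)

Section Shift.
Variables (R : realType) (V : choiceType) (E : rel V) (root : V).
Variables (lam : V -> R) (S : l2 R V -> l2 R V).
Hypotheses (treeE : directed_tree E) (rootE : is_root E root).
Hypothesis lam_gt0 : forall v, ~ is_root E v -> 0 < lam v.
Hypothesis shS : weighted_shift E lam S.
Hypothesis bS : bounded_operator S.
Hypothesis liS : left_invertible S.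

Local Notation depth := (depth E root).
Local Notation par := (par E).
Local Notation e := (basis_vec R).
Local Notation S' := (adjoint S).
Implicit Types (f g x : l2 R V) (u v : V).

(** The value 0 at the root makes the definition of S a single formula. *)
Definition lam0 (v : V) : R[i] := if v == root then 0 else ((lam v)%:C)%C.

Lemma lam_pos v : v != root -> 0 < lam v.
Proof. by move=> /(not_rootP treeE rootE); exact: lam_gt0. Qed.

Lemma shift_wcomp : wcomp S lam0 par.
Proof.
move=> f v; rewrite /lam0; have [h1 h2] := shS f v.
have [->|vr] := eqVneq v root; first by rewrite mul0r; apply: (shS f root).1.
by apply: h2; exact/(not_rootP treeE rootE).
Qed.

Lemma shift_root f : S f root = 0.
Proof. by rewrite shift_wcomp /lam0 eqxx mul0r. Qed.

Lemma shift_par f v : v != root -> S f v = ((lam v)%:C)%C * f (par v).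
Proof. by move=> vr; rewrite shift_wcomp /lam0 (negbTE vr). Qed.

Lemma shift_edge f u v : E u v -> S f v = ((lam v)%:C)%C * f u.
Proof.
move=> uv; rewrite shift_par ?(edge_not_root treeE rootE uv)//.
by rewrite (edge_par treeE rootE uv).
Qed.

Lemma shift_basis u v : S (e u) v = if E u v then ((lam v)%:C)%C else 0.
Proof.
rewrite (edgeE treeE rootE); have [->|vr] /= := eqVneq v root; first by rewrite shift_root.
by rewrite shift_par// basis_vecE; case: eqP => _; rewrite ?mulr1 ?mulr0.
Qed.

Lemma linS : linear S. Proof. by have /bounded_operatorP[] := bS. Qed.

(** The lower bound comes from the left inverse of S. *)
Lemma shift_bounds : exists c M : R, [/\ 0 < c, 0 < M, bounded_by S M,
  forall u, c <= l2norm (S (e u)) & forall u, l2norm (S (e u)) <= M].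
Proof.
have [_ [M M0 SM]] := (bounded_operatorP S).1 bS.
have [L /bounded_operatorP[_ [M' M'0 LM]] LS] := liS.
exists M'^-1, M; split => //; first by rewrite invr_gt0.
  move=> u; have := LM (S (e u)); rewrite LS l2norm_basis.
  by rewrite -ler_pdivrMl// mulr1.
by move=> u; have := SM (e u); rewrite l2norm_basis mulr1.
Qed.

Lemma norm_shift_gt0 u : 0 < l2norm (S (e u)).
Proof. by have [c [M [c0 _ _ cS _]]] := shift_bounds; exact: lt_le_trans (cS u). Qed.

(** An eigenvector vanishes at the root, hence everywhere by induction along
    the tree; the eigenvalue 0 is excluded by the left inverse. *)
Lemma shift_point_spectrum : point_spectrum S = set0.
Proof.
apply/seteqP; split => // w [x x0 Sx]; apply: (negP x0); apply/eqP.
have [w0|w0] := eqVneq w 0.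
  have [L _ LS] := liS.
  by rewrite -(LS x) -(LS 0) Sx w0 scale0r (lin0 linS).
apply: l2_eq => v; rewrite l2val0; have coord u : S x u = w * x u by rewrite Sx l2valZ.
elim/(tree_ind treeE rootE) : v => [|v vr ih].
  by have := coord root; rewrite shift_root => /esym/eqP; rewrite mulf_eq0 (negbTE w0) => /eqP.
have := coord v; rewrite shift_par// ih mulr0 => /esym/eqP.
by rewrite mulf_eq0 (negbTE w0) => /eqP.
Qed.

Lemma shift_iter_supp k u v : iter k S (e u) v != 0 -> depth v = (depth u + k)%N.
Proof.
elim: k v => [|k ih] v.
  rewrite addn0 (_ : iter 0 S (e u) = e u)// basis_vecE.
  by have [->//|_] := eqVneq v u; rewrite eqxx.
rewrite iterS; have [->|vr] := eqVneq v root; first by rewrite shift_root eqxx.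
rewrite shift_par// mulf_eq0 negb_or => /andP[_ /ih h].
by rewrite (depth_par treeE rootE vr) h addnS.
Qed.

(** Solving (S - w) f = e u from the root down: f vanishes above the generation
    of u, and k generations below it is - w^-(k+1) S^k (e u). *)
Lemma resolvent_basis w (f : l2 R V) u : w != 0 -> shifted S w f = e u ->
  (forall v, (depth v < depth u)%N -> f v = 0) /\
  forall k v, depth v = (depth u + k)%N -> w ^+ k.+1 * f v = - iter k S (e u) v.
Proof.
move=> w0 fu.
have coord v : S f v - w * f v = (v == u)%:R by rewrite -basis_vecE -fu.
have vanish v : (depth v < depth u)%N -> f v = 0.
  elim/(tree_ind treeE rootE) : v => [|v vr ih] vu; last first.
    have := coord v; rewrite shift_par// ih; last first.
      by apply: leq_trans vu; rewrite (depth_par treeE rootE vr).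
    have -> : (v == u) = false by apply: contraTF vu => /eqP->; rewrite ltnn.
    by rewrite mulr0 sub0r => /eqP; rewrite oppr_eq0 mulf_eq0 (negbTE w0) => /eqP.
  have := coord root; rewrite shift_root.
  have -> : (root == u) = false by apply: contraTF vu => /eqP->; rewrite ltnn.
  by rewrite sub0r => /eqP; rewrite oppr_eq0 mulf_eq0 (negbTE w0) => /eqP.
split=> // k; elim: k => [|k ih] v.
  rewrite addn0 expr1 (_ : iter 0 S (e u) = e u)// basis_vecE -coord => vu.
  have [->|vr] := eqVneq v root; first by rewrite shift_root sub0r opprK.
  rewrite shift_par// (vanish (par v)); first by rewrite mulr0 sub0r opprK.
  by rewrite -vu (depth_par treeE rootE vr).
have [->|vr] := eqVneq v root; first by rewrite (depth_root treeE rootE) addnS.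
move=> dv; have dp : depth (par v) = (depth u + k)%N.
  by move: dv; rewrite (depth_par treeE rootE vr) addnS => -[].
have := coord v; have -> : (v == u) = false.
  by apply/eqP => vu; move: dv; rewrite vu -{1}[depth u]addn0 => /addnI.
rewrite shift_par// => /eqP; rewrite subr_eq0 => /eqP wf.
by rewrite exprSr -mulrA -wf mulrCA ih// iterS shift_par// mulrN.
Qed.

(** By [resolvent_basis] the vectors S^k (e u) are, up to scalars, pieces of
    the bounded vector (S - w)^-1 (e u). *)
Lemma shift_power_bound w : w != 0 -> invertible (shifted S w) ->
  exists2 C : R, 0 <= C & forall k x, l2norm (iter k S x) <= C * normc w ^+ k * l2norm x.
Proof.
move=> w0 [A [/bounded_operatorP[_ [M M0 AM]] _ A2]].
exists (M * normc w); first by rewrite mulr_ge0 ?normc_ge0 ?ltW.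
move=> k x; have [mk Smk] := wcomp_iter k shift_wcomp.
apply: (wcomp_le Smk); first by rewrite !mulr_ge0 ?exprn_ge0 ?normc_ge0 ?ltW.
move=> u _; have [_ fk] := resolvent_basis w0 (A2 (e u)).
apply: (@le_trans _ _ (l2norm (w ^+ k.+1 *: A (e u)))).
  apply: l2norm_le_coord => v; rewrite l2valZ.
  have [->|h] := eqVneq (iter k S (e u) v) 0; first by rewrite Normc.normc0 normc_ge0.
  by rewrite fk ?(shift_iter_supp h)// [leRHS]normcN.
rewrite l2normZ normcX exprS; have := AM (e u); rewrite l2norm_basis mulr1 => h.
by rewrite mulrC mulrA ler_wpM2r ?exprn_ge0 ?normc_ge0// ler_wpM2r ?normc_ge0.
Qed.

(** e root is not in the range of S. *)
Lemma zero_in_spectrum : spectrum S 0.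
Proof.
move=> [L [_ _ L2]]; have := congr1 (fun f : l2 R V => f root) (L2 (e root)).
rewrite /shifted l2valB l2valZ mul0r subr0 shift_root basis_vecE eqxx.
by move/eqP; rewrite eq_sym oner_eq0.
Qed.

Lemma shift_spectrum : spectrum S = closed_disc (spectral_radius S).
Proof.
have [c [M [_ M0 SM _ _]]] := shift_bounds.
apply: (spectrum_disc linS SM (ltW M0) zero_in_spectrum) => w w' iw ww'.
have w0 : w != 0 by apply/eqP => w0; move: iw; rewrite w0; exact: zero_in_spectrum.
have [C C0 SC] := shift_power_bound w0 iw.
by apply: (invertible_shifted linS C0 _ SC); rewrite normc_ge0.
Qed.

Local Lemma bdata : exists2 M, 0 < M & bounded_by S M.
Proof. by have /bounded_operatorP[] := bS. Qed.

Lemma adjS g u : S' g u = inner g (S (e u)).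
Proof. have [M M0 SM] := bdata; exact: (adjointE linS M0 SM). Qed.

Lemma adjS_linear : linear S'.
Proof. have [M M0 SM] := bdata; exact: (adjoint_linear linS M0 SM). Qed.

(** The children of different vertices being different, S^* S is diagonal. *)
Lemma adjS_shift f u : S' (S f) u = ((l2norm (S (e u)) ^+ 2)%:C)%C * f u.
Proof.
rewrite adjS mulrC -inner_self -innerZl; congr csum.
apply/funext => v; rewrite l2valZ shift_basis.
case: ifP => uv; last by rewrite rmorph0 !mulr0.
by rewrite (shift_edge _ uv) [_ * f u]mulrC.
Qed.

Lemma adjS_root : S' (e root) = 0.
Proof.
apply: l2_eq => u; rewrite adjS inner_conj inner_basisr shift_root.
by rewrite rmorph0.
Qed.

(** T is S composed with the inverse of the diagonal operator S^* S. *)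
Lemma cauchy_dual : exists T, [/\ bounded_operator T, forall f, S' (T f) = f,
  range T = range S
  & forall f v, T f v = lam0 v * (((l2norm (S (e (par v))) ^+ 2)^-1)%:C)%C * f (par v)].
Proof.
have [c [M [c0 M0 SM cS _]]] := shift_bounds.
pose m u : R[i] := (((l2norm (S (e u)) ^+ 2)^-1)%:C)%C.
have m0 u : 0 < l2norm (S (e u)) ^+ 2 by rewrite exprn_gt0 ?norm_shift_gt0.
have [D Dm Dc] : exists2 D : l2 R V -> l2 R V, wcomp D m id & bounded_by D (c ^+ 2)^-1.
  apply: wcomp_ex; first by rewrite invr_ge0 sqr_ge0.
  move=> u; rewrite (@sqsum_supp1 _ _ _ u)/=; last by move=> v /negbTE->.
  rewrite eqxx lee_fin ler_sqr ?nnegrE ?normc_ge0 ?invr_ge0 ?sqr_ge0//.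
  rewrite normc_id ger0_norm ?invr_ge0 ?sqr_ge0//.
  by rewrite lef_pV2 ?posrE ?exprn_gt0 ?norm_shift_gt0// ler_sqr ?nnegrE ?l2norm_ge0 ?(ltW c0).
exists (S \o D); split.
- apply: bounded_comp => //; apply/bounded_operatorP; split; first exact: wcomp_linear Dm.
  by exists (c ^+ 2)^-1 => //; rewrite invr_gt0 exprn_gt0.
- move=> f; apply: l2_eq => u; rewrite adjS_shift Dm mulrA -rmorphM/=.
  by rewrite mulfV ?mul1r// gt_eqF.
- apply/seteqP; split=> _ [f _ <-]; first by exists (D f).
  exists (S' (S f)) => //=; congr S; apply: l2_eq => u.
  by rewrite Dm adjS_shift mulrA -rmorphM/= mulVf ?mul1r// gt_eqF.
by move=> f v /=; rewrite shift_wcomp Dm -mulrA.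
Qed.

(** T^k lifts a basis of the kernel of S^* to one modulo the kernel of
    S^{*k}, since S^{*k} T^k = 1. *)
Lemma ker_power_dim d : has_dim (ker S') d -> forall k : nat, (0 < k)%N ->
  has_dim_quot (ker (iter k S')) (ker (iter k.-1 S')) d.
Proof.
have [T [_ ST _ _]] := cauchy_dual.
have STk k f : iter k S' (iter k T f) = f by elim: k => // k ih; rewrite iterSr iterS ST.
move=> [b [bker bdim]] [//|k] _; exists (fun i => iter k T (b i)); split.
  by move=> i; rewrite /ker/= -iterS iterS STk; exact: bker.
move=> x xk; have : ker S' (iter k S' x) by rewrite /ker/= -iterS.
move=> /bdim[c [hc uc]]; have linSk := lin_iter adjS_linear k.
have eqv c' : ker (iter k S') (x - \sum_i c' i *: iter k T (b i)) <->
    iter k S' x - \sum_i c' i *: b i = 0.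
  rewrite /ker/= (linB linSk) (lin_sum linSk).
  rewrite (eq_bigr (fun i => c' i *: b i)) // => i _.
  by rewrite -[in RHS](STk k (b i)); exact: linZ.
exists c; split; first by apply/eqv.
by move=> c' /eqv/uc.
Qed.

(** An eigenvector of S^* for w is orthogonal to the range of S - conj w, so
    conj w is in the spectrum; the latter is a disc, hence stable under
    conjugation. *)
Lemma adj_point_spectrum : point_spectrum S' `<=` spectrum S.
Proof.
move=> w [f f0 Sf].
suff : spectrum S (w^*)%C by rewrite shift_spectrum /closed_disc/= normc_conj.
move=> [A [_ _ A2]]; apply: (negP f0); apply/eqP; apply: l2_eq => u.
have [M M0 SM] := bdata.
rewrite l2val0 -inner_basisr -(A2 (e u)) inner_conj.
have -> : shifted S (w^*)%C (A (e u)) = (- (w^*)%C) *: A (e u) + S (A (e u)).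
  by rewrite /shifted; l2ring.
rewrite inner_linl (adjoint_spec linS M0 SM) Sf innerZr mulNr addNr.
by rewrite rmorph0.
Qed.

Lemma le_of_poweR_root (A : \bar R) (r : R) n : (0 <= A)%E -> 0 < r -> (0 < n)%N ->
  (r%:E <= (A `^ (2 * n%:R)^-1)^-1)%E -> (A <= ((r^-1 ^+ n) ^+ 2)%:E)%E.
Proof.
move=> A0 r0 n0; have n2 : 0 < 2 * n%:R :> R by rewrite mulr_gt0// ltr0n.
have p0 : 0 < (2 * n%:R)^-1 :> R by rewrite invr_gt0.
case: A A0 => [s| |]//; last first.
  by move=> _; rewrite poweRyr ?gt_eqF// invey lee_fin leNgt r0.
rewrite lee_fin poweR_EFin => s0; have [->|sn0] := eqVneq s 0.
  by move=> _; rewrite lee_fin sqr_ge0.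
have sp : 0 < s by rewrite lt_def sn0.
have pp : 0 < s `^ (2 * n%:R)^-1 by exact: powR_gt0.
rewrite inver gt_eqF// !lee_fin -[X in X <= _ -> _]invrK lef_pV2 ?posrE ?invr_gt0// => h.
have -> : s = (s `^ (2 * n%:R)^-1) ^+ (n * 2).
  by rewrite -powR_mulrn ?powR_ge0// -powRrM natrM [n%:R * _]mulrC mulVf ?powRr1// gt_eqF.
by rewrite -exprM; apply: lerXn2r; rewrite ?nnegrE ?invr_ge0 ?powR_ge0 ?(ltW r0).
Qed.

Lemma cauchy_dual_root (T : l2 R V -> l2 R V) :
  (forall f v, T f v = lam0 v * (((l2norm (S (e (par v))) ^+ 2)^-1)%:C)%C * f (par v)) ->
  forall n v, iter n T (e root) v = if depth v == n
    then ((\prod_(i < n) dual_weight E lam S (iter i par v))%:C)%C else 0.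
Proof.
move=> Tv; elim=> [|n ih] v.
  rewrite (_ : iter 0 T (e root) = e root)// basis_vecE (depth_eq0 treeE rootE) big_ord0.
  by case: eqP.
rewrite iterS Tv /lam0; have [->|vr] := eqVneq v root.
  by rewrite !mul0r (depth_root treeE rootE).
rewrite (depth_par treeE rootE vr) eqSS ih; case: eqP => _; last by rewrite mulr0.
rewrite -!rmorphM/=; congr (_%:C)%C; rewrite big_ord_recl; congr (_ * _).
by apply: eq_bigr => i _; rewrite lift0 iterSr.
Qed.

(** The eigenvector is the sum of the w^n T^n (e root).  The square of the norm
    of T^n (e root) is a part of the n-th sum in the radius of convergence,
    which is an upper bound because generation n is among the generations
    n, ..., n + k. *)
Lemma radius_disc_point_spectrum : finite_branching_index E root ->
  open_disc (convergence_radius E root lam S) `<=` point_spectrum S'.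
Proof.
move=> fbi w; rewrite /open_disc/= /convergence_radius limn_einf_lim.
set a := (X in einfs X); rewrite (cvg_lim (@ereal_hausdorff R) (@cvg_einfs_sup _ a)).
move=> /ereal_sup_gt[_ [N _ <-]] wN.
have [T [bT ST _ Tv]] := cauchy_dual.
have [linT [M M0 TM]] := (bounded_operatorP T).1 bT.
pose x n : l2 R V := w ^+ n *: iter n T (e root).
have [wz|w0] := eqVneq w 0.
  exists (e root); last by rewrite adjS_root wz scale0r.
  apply/eqP => /(congr1 (fun f : l2 R V => f root)); rewrite basis_vecE eqxx l2val0.
  by move/eqP; rewrite oner_eq0.
have wp : 0 < normc w by rewrite normc_gt0.
have [r [wr rN]] : exists r, normc w < r /\ (r%:E <= einfs a N)%E.
  move: wN; case: (einfs a N) => [s| |]//.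
    by rewrite lte_fin => ws; exists s.
  by move=> _; exists (normc w + 1); rewrite ltrDl ltr01 leey.
have r0 : 0 < r by exact: lt_trans wr.
have anr n : (N <= n)%N -> (r%:E <= a n)%E.
  move=> Nn; apply: le_trans rN _; apply: ereal_inf_lbound.
  by exists n.
have Tn n : (N.+1 <= n)%N -> l2norm (iter n T (e root)) <= r^-1 ^+ n.
  move=> Nn; rewrite -sqsum_le_l2norm; last by rewrite exprn_ge0// invr_ge0 ltW.
  apply: le_trans (le_of_poweR_root _ r0 _ (anr n (ltnW Nn))); last 2 first.
  - by apply: esum_ge0 => v _; rewrite lee_fin sqr_ge0.
  - exact: leq_trans Nn.
  rewrite [leRHS]esum_mkcond; apply: le_esum => v _.
  rewrite (cauchy_dual_root Tv); have [vn|_] := eqVneq (depth v) n; last first.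
    rewrite Normc.normc0 expr0n/=; case: ifP => _ //.
    by rewrite lee_fin sqr_ge0.
  rewrite mem_set; last first.
    by exists n; split; rewrite ?leq_addl//; exact/(depthP treeE rootE).
  by rewrite normc_id real_normK ?num_real.
pose q := normc w / r.
have q01 : 0 <= q < 1 by rewrite divr_ge0 ?normc_ge0 ?(ltW r0)//= ltr_pdivrMr// mul1r.
(* covers the terms before the rank N from which the root test applies *)
pose C := Num.max 1 (r * M) ^+ N.
have Nw n : l2norm (iter n (fun f => w *: T f) (e root)) <= C * q ^+ n.
  rewrite iter_scale// l2normZ normcX /q exprMn mulrCA.
  rewrite ler_wpM2l ?exprn_ge0 ?normc_ge0//.
  have [nN|Nn] := leqP n N; last first.
    apply: le_trans (Tn _ Nn) _; rewrite ler_peMl ?exprn_ge0 ?invr_ge0 ?(ltW r0)//.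
    by rewrite exprn_ege1// le_max lexx.
  have := bounded_iter n (ltW M0) TM (e root); rewrite l2norm_basis mulr1 => /le_trans; apply.
  apply: (@le_trans _ _ (Num.max 1 (r * M) ^+ n * r^-1 ^+ n)).
    rewrite -exprMn lerXn2r ?nnegrE ?(ltW M0)//.
      by rewrite mulr_ge0 ?invr_ge0 ?(ltW r0)// le_max ler01.
    by rewrite ler_pdivlMr// mulrC le_max lexx orbT.
  rewrite ler_wpM2r ?exprn_ge0 ?invr_ge0 ?(ltW r0)//.
  by rewrite ler_weXn2l// le_max lexx.
have linwT : linear (fun f => w *: T f) by move=> c f g; rewrite linT; l2ring.
have bwT : bounded_by (fun f => w *: T f) (normc w * M).
  by move=> f; rewrite l2normZ -mulrA ler_wpM2l ?normc_ge0.
have wM : 0 <= normc w * M by rewrite mulr_ge0 ?normc_ge0 ?(ltW M0).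
have [y yw _] := neumann_vector linwT wM bwT q01 Nw.
exists y.
  apply/eqP => y0; have := congr1 (fun f : l2 R V => f root) yw.
  rewrite y0 (lin0 linT) scaler0 subr0 basis_vecE eqxx l2val0.
  by move/eqP; rewrite eq_sym oner_eq0.
have -> : S' y = S' (w *: T y + e root) by rewrite -yw; congr S'; l2ring.
by rewrite (linZD adjS_linear) ST adjS_root addr0.
Qed.

(** The closure of the span is T-invariant: if S^* f = w f with w != 0, then
    f - w T f is in the kernel of S^*, so T f is in the span; for w = 0, T f is
    a limit of vectors T F, where F = f + t T F is an eigenvector for a small t > 0. *)
Lemma adj_eigenvectors_total (eps : R) : 0 < eps ->
  closed_span (\bigcup_(w in open_disc eps%:E) ker (shifted S' w)) = setT.
Proof.
move=> eps0; set G := \bigcup_(w in _) _.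
have [T [bT ST _ Tv]] := cauchy_dual.
have [linT [M M0 TM]] := (bounded_operatorP T).1 bT.
rewrite /closed_span; set A := [set x | _].
have A0 : A 0.
  by exists 0%N, (fun=> 0), (fun=> 0); split => [[]//|]; rewrite big_ord0.
have AD c x y : A x -> A y -> A (c *: x + y).
  move=> [n [a [b [Gb ->]]]] [m [a' [b' [Gb' ->]]]].
  exists (n + m)%N, (fun i => match fintype.split i with inl j => c * a j | inr j => a' j end),
    (fun i => match fintype.split i with inl j => b j | inr j => b' j end); split.
    by move=> i; case: fintype.split.
  rewrite big_split_ord/= scaler_sumr; congr (_ + _); apply: eq_bigr => i _.
    by rewrite (unsplitK (inl i)) scalerA.
  by rewrite (unsplitK (inr i)).
have AG x : G x -> A x.
  move=> Gx; exists 1%N, (fun=> 1), (fun=> x); split => //.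
  by rewrite big_ord1 scale1r.
have clD c x y : closure A x -> closure A y -> closure A (c *: x + y).
  exact: closure_lin AD _ _ _.
have AE g : S' g = 0 -> A g.
  move=> Sg; apply: AG; exists 0; first by rewrite /open_disc/mkset Normc.normc0 lte_fin.
  by rewrite /ker/= /shifted Sg scale0r subr0.
have AT x : closure A x -> closure A (T x).
  have TG z : G z -> closure A (T z).
    move=> Gz; have [w] := Gz; rewrite /open_disc/= lte_fin => weps; rewrite /ker/= /shifted.
    move=> /eqP; rewrite subr_eq0 => /eqP Sz.
    have [w0|w0] := eqVneq w 0; last first.
      have Sg : S' (z - w *: T z) = 0.
        by rewrite (linB adjS_linear) (linZ adjS_linear) ST Sz subrr.
      have -> : T z = - w^-1 *: (z - w *: T z) + (w^-1 *: z + 0).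
        by apply: l2_eq => v; rewrite !l2valE; field.
      apply: subset_closure; apply: (AD _ _ _ (AE _ Sg)).
      exact: AD (AG _ Gz) A0.
    apply/l2_closureP => d d0.
    move: Sz; rewrite w0 scale0r => Sz.
    (* t < eps makes F an admissible eigenvector, t M <= 1/2 bounds F by 2 |z|, and
       the last term then brings T F within d of T z *)
    pose t := Num.min (Num.min (eps / 2) (2 * M)^-1) (d / 2 / (2 * M * M * l2norm z + 1)).
    have D0 : 0 < 2 * M * M * l2norm z + 1.
      by rewrite ltr_wpDl// !mulr_ge0 ?l2norm_ge0 ?(ltW M0).
    have t0 : 0 < t by rewrite !lt_min !divr_gt0// invr_gt0 mulr_gt0.
    have [t1 t2] : t <= eps / 2 /\ t <= (2 * M)^-1.
      by split; rewrite /t ge_min ge_min lexx ?orbT.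
    have t3 : t <= d / 2 / (2 * M * M * l2norm z + 1) by rewrite /t ge_min lexx orbT.
    have tM : t * M <= 2^-1.
      by move: t2; rewrite invfM ler_pdivlMr.
    pose tc : R[i] := (t%:C)%C.
    have ntc : normc tc = t by rewrite normc_id gtr0_norm.
    have tc0 : tc != 0 by rewrite -normc_gt0 ntc.
    have linN : linear (fun f => tc *: T f) by move=> c f g; rewrite linT; l2ring.
    have bN : bounded_by (fun f => tc *: T f) (t * M).
      by move=> f; rewrite l2normZ ntc -mulrA ler_wpM2l// ltW.
    have tM0 : 0 <= t * M by rewrite mulr_ge0 ?ltW.
    have [||F Fz FC] := @neumann_vector _ _ _ _ (l2norm z) (t * M) z linN tM0 bN.
    - by rewrite tM0/=; lra.
    - by move=> k; rewrite mulrC; exact: bounded_iter.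
    have SF : S' F = tc *: F.
      have -> : S' F = S' (tc *: T F + z) by rewrite -Fz; congr S'; l2ring.
      by rewrite (linZD adjS_linear) ST Sz addr0.
    exists (T F).
      have -> : T F = - tc^-1 *: z + (tc^-1 *: F + 0).
        by apply: l2_eq => v; rewrite -Fz !l2valE; field.
      apply: (AD _ _ _ (AE _ Sz)); apply: AD A0; apply: AG; exists tc.
        by rewrite /open_disc/mkset ntc lte_fin; move: t1 eps0; lra.
      by rewrite /ker/= /shifted SF subrr.
    rewrite -(linB linT); apply: le_lt_trans (TM _) _.
    have -> : z - F = - tc *: T F by rewrite -Fz; l2ring.
    rewrite l2normZ (_ : normc (- tc) = t); last by rewrite [LHS]normcN.
    have FC2 : l2norm F <= 2 * l2norm z.
      apply: le_trans FC _; rewrite ler_pdivrMr; last by move: tM; lra.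
      have := l2norm_ge0 z; move: tM; move: (t * M) (l2norm z) => p q; nra.
    have TF := TM F.
    apply: (@le_lt_trans _ _ (t * (2 * M * M * l2norm z))).
      rewrite mulrCA ler_wpM2l ?(ltW t0)//.
      have -> : 2 * M * M * l2norm z = M * (M * (2 * l2norm z)) by ring.
      by rewrite ler_wpM2l ?(ltW M0)// (le_trans TF)// ler_wpM2l ?(ltW M0).
    apply: (@lt_trans _ _ (t * (2 * M * M * l2norm z + 1))).
      by rewrite ltr_pM2l// ltrDl.
    by move: t3; rewrite ler_pdivlMr// => /le_lt_trans; apply; move: d0; lra.
  have TA z : A z -> closure A (T z).
    move=> [n [a [b [Gb ->]]]]; rewrite (lin_sum linT).
    elim/big_ind : _ => [|f g Af Ag|i _].
    - exact: subset_closure.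
    - by rewrite -[f]scale1r; exact: clD.
    - rewrite (linZ linT) -[_ *: _]addr0; apply: clD; last exact: subset_closure.
      exact: TG.
  move=> /l2_closureP clx; apply: closed_closure; apply/l2_closureP => d d0.
  have [y Ay xy] := clx (d / M) (divr_gt0 d0 M0); exists (T y); first exact: TA.
  rewrite -(linB linT); apply: le_lt_trans (TM _) _.
  by rewrite mulrC -ltr_pdivlMr.
apply: subspace_dense => //; elim/(tree_ind treeE rootE) => [|v vr ih].
  by apply: subset_closure; apply: AE; exact: adjS_root.
have -> : e v = ((lam v)%:C)%C *: T (e (par v)) + (e v - ((lam v)%:C)%C *: T (e (par v))).
  by l2ring.
apply: clD; first exact: AT.
apply: subset_closure; apply: AE.
rewrite (linB adjS_linear) (linZ adjS_linear) ST; apply: l2_eq => u.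
rewrite l2valB l2valZ adjS inner_conj inner_basisr shift_basis basis_vecE l2val0.
rewrite (edgeE treeE rootE) vr/= [par v == u]eq_sym.
by case: eqP => _; rewrite ?rmorph0 ?mulr1 ?mulr0 ?subr0//= oppr0 subrr.
Qed.

End Shift.

(** * Exponential growth and decay of positive sequences *)

Section Growth.
Variable R : realType.
Implicit Types (P p : nat -> R) (s : R).

(** Decay at a rate strictly below s, uniformly over all starting points n
    from N on; this uniformity is what bounds powers of the shift on a ray. *)
Definition decays_from N P s := exists C q : R, 0 < q < s /\
  forall n k, (N <= n)%N -> P (n + k)%N <= C * q ^+ k * P n.
Definition grows_from N P s := exists C q : R, s < q /\
  forall n k, (N <= n)%N -> q ^+ k * P n <= C * P (n + k)%N.
Notation decays := (decays_from 0).
Notation grows := (grows_from 0).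

Lemma decays_open P s : decays P s -> exists2 s', 0 < s' < s & decays P s'.
Proof.
move=> [C [q [/andP[q0 qs] h]]]; exists ((q + s) / 2); first by apply/andP; split; lra.
by exists C, q; split => //; apply/andP; split; lra.
Qed.

Lemma decays_up P s s' : s <= s' -> decays P s -> decays P s'.
Proof.
move=> ss' [C [q [/andP[q0 qs] h]]]; exists C, q; split => //.
by rewrite q0 (lt_le_trans qs).
Qed.

Lemma grows_open P s : grows P s -> exists2 s', s < s' & grows P s'.
Proof.
move=> [C [q [sq h]]]; exists ((q + s) / 2); first by lra.
by exists C, q; split => //; lra.
Qed.

Lemma grows_down P s s' : s' <= s -> grows P s -> grows P s'.
Proof.
move=> ss' [C [q [sq h]]]; exists C, q; split => //; exact: le_lt_trans sq.
Qed.

Lemma decays_grows P s : 0 < s -> (forall n, 0 < P n) -> decays P s -> grows P s -> False.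
Proof.
move=> s0 P0 [C [q [/andP[q0 qs] hd]]] [D [t [st hg]]].
have t0 : 0 < t by exact: lt_trans st.
have qt : 0 <= q / t < 1.
  by rewrite divr_ge0 ?(ltW q0) ?(ltW t0)//= ltr_pdivrMr// mul1r (lt_trans qs).
have D0 : 0 < D.
  have := hg 0%N 0%N isT; rewrite expr0 mul1r addn0 => h.
  by rewrite -(pmulr_lgt0 _ (P0 0%N)) (lt_le_trans (P0 0%N)).
have : 1 <= 0 :> R.
  apply: (@le_cvg0 _ (fun k => D * C * (q / t) ^+ k)); last first.
    by have := @cvg_geom0 _ (D * C) _ qt.
  move=> k; have h1 := hd 0%N k isT; have h2 := hg 0%N k isT.
  have h : t ^+ k * P 0%N <= D * (C * q ^+ k * P 0%N).
    by apply: le_trans h2 _; rewrite ler_pM2l.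
  rewrite expr_div_n mulrA ler_pdivlMr ?exprn_gt0// mul1r.
  by rewrite -(ler_pM2r (P0 0%N)); apply: le_trans h _; rewrite !mulrA.
by rewrite ler10.
Qed.

Section Ratio.
Variables (P : nat -> R) (c M : R).
Hypotheses (P0 : forall n, 0 < P n) (c0 : 0 < c).
Hypotheses (Pc : forall n, c * P n <= P n.+1) (PM : forall n, P n.+1 <= M * P n).

(** One more starting point only changes the constant, because consecutive
    terms have bounded ratios. *)
Lemma decays_from_step N s : decays_from N.+1 P s -> decays_from N P s.
Proof.
move=> [C [q [/andP[q0 qs] h]]].
have M0 : 0 < M by rewrite -(pmulr_lgt0 _ (P0 0%N)) (lt_le_trans (P0 1%N)).
have C0 : 1 <= C.
  have := h N.+1 0%N (leqnn _); rewrite addn0 expr0 mulr1 => hC.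
  by rewrite -(ler_pM2r (P0 N.+1)) mul1r.
exists (C * (1 + M / q)), q; split; first by rewrite q0.
have D1 : 1 <= 1 + M / q by rewrite lerDl divr_ge0 ?ltW.
move=> n k; rewrite leq_eqVlt => /predU1P[<-|Nn]; last first.
  apply: le_trans (h _ _ Nn) _; rewrite ler_wpM2r ?(ltW (P0 _))//.
  rewrite ler_wpM2r ?exprn_ge0 ?(ltW q0)// ler_peMr//; lra.
case: k => [|k].
  by rewrite addn0 expr0 mulr1 ler_peMl ?(ltW (P0 _))// mulr_ege1.
rewrite addnS -addSn; apply: le_trans (h _ _ (leqnn _)) _.
apply: (@le_trans _ _ (C * q ^+ k * (M * P N))).
  by rewrite ler_wpM2l ?mulr_ge0 ?exprn_ge0 ?(ltW q0)//; lra.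
rewrite mulrA ler_wpM2r ?(ltW (P0 _))// exprS.
have -> : C * q ^+ k * M = C * (M / q) * (q * q ^+ k) by field; rewrite gt_eqF.
rewrite ler_wpM2r ?mulr_ge0 ?exprn_ge0 ?(ltW q0)//.
by rewrite ler_wpM2l ?lerDr//; lra.
Qed.

Lemma decays_from0 N s : decays_from N P s -> decays P s.
Proof. by elim: N => // N ih /decays_from_step/ih. Qed.

Lemma grows_from_step N s : 0 < s -> grows_from N.+1 P s -> grows_from N P s.
Proof.
move=> s0 [C [q [sq h]]]; have q0 : 0 < q by exact: lt_trans sq.
have C0 : 1 <= C.
  have := h N.+1 0%N (leqnn _); rewrite addn0 expr0 mul1r => hC.
  by rewrite -(ler_pM2r (P0 N.+1)) mul1r.
exists (C * (1 + q / c)), q; split => //.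
have D1 : 1 <= 1 + q / c by rewrite lerDl divr_ge0 ?ltW.
move=> n k; rewrite leq_eqVlt => /predU1P[<-|Nn]; last first.
  apply: le_trans (h _ _ Nn) _; rewrite ler_wpM2r ?(ltW (P0 _))//.
  by rewrite ler_peMr//; lra.
case: k => [|k].
  by rewrite addn0 expr0 mul1r ler_peMl ?(ltW (P0 _))// mulr_ege1.
rewrite addnS -addSn; have := h N.+1 k (leqnn _) => hk.
have hN : P N <= c^-1 * P N.+1 by rewrite ler_pdivlMl.
apply: (@le_trans _ _ (q / c * (q ^+ k * P N.+1))).
  rewrite exprS -!mulrA ler_wpM2l ?(ltW q0)// mulrCA.
  by rewrite ler_wpM2l ?exprn_ge0 ?(ltW q0).
apply: (@le_trans _ _ (q / c * (C * P (N.+1 + k)%N))).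
  by rewrite ler_wpM2l ?divr_ge0 ?(ltW q0) ?(ltW c0).
rewrite mulrCA -mulrA ler_wpM2l//; first lra.
by rewrite ler_wpM2r ?(ltW (P0 _))// lerDr.
Qed.

Lemma grows_from0 N s : 0 < s -> grows_from N P s -> grows P s.
Proof. by move=> s0; elim: N => // N ih /(grows_from_step s0)/ih. Qed.

End Ratio.

Section Dichotomy.
Variables (p : nat -> R) (K : R).
Hypotheses (p0 : forall n, 0 < p n) (K2 : 2 <= K).
Hypothesis pK : forall m l, (m < l)%N -> \sum_(m <= n < l) p n <= K * (p m + p l).

Let s l := \sum_(0 <= n < l) p n.

Let sS l : s l.+1 = s l + p l. Proof. by rewrite /s big_nat_recr. Qed.

Let s_mono m l : (m <= l)%N -> s m <= s l.
Proof.
move=> /subnKC <-; elim: (l - m)%N => [|j ih]; first by rewrite addn0.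
by rewrite addnS sS (le_trans ih)// lerDl ltW.
Qed.

Let K0 : 0 < K. Proof. exact: lt_le_trans K2. Qed.

(** When the sum converges, the hypothesis bounds each tail by a multiple of its
    first term, so the tails decrease geometrically. *)
Lemma bounded_sum_decays B : (forall l, s l <= B) -> decays p 1.
Proof.
move=> sB; pose I := sup (range s).
have hs : has_sup (range s).
  by split; [exists (s 0%N); exists 0%N | exists B => _ [l _ <-]].
have sI l : s l <= I by apply: (sup_upper_bound hs); exists l.
pose t m := I - s m.
have tS m : t m = p m + t m.+1 by rewrite /t sS; lra.
have t0 m : 0 <= t m by rewrite subr_ge0.
have pt m : p m <= t m by rewrite tS lerDl.
have tK m : t m <= K * p m.
  apply/ler_addgt0Pr => d d0.
  have : I - Num.min (d / 2) (d / 2 / K) < sup (range s) by rewrite ltrBlDr ltrDl lt_min !divr_gt0.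
  move=> /(sup_gt hs.1)[_ [l0 _ <-] sl0].
  pose l := maxn l0 m.+1.
  have ml : (m < l)%N by rewrite leq_max leqnn orbT.
  have sl : I - Num.min (d / 2) (d / 2 / K) < s l by apply: lt_le_trans sl0 (s_mono (leq_maxl _ _)).
  have pl : p l <= Num.min (d / 2) (d / 2 / K).
    by have := sI l.+1; rewrite sS; move: sl; lra.
  have e1 : I - s m = (I - s l) + \sum_(m <= n < l) p n.
    by rewrite /s (big_cat_nat (leq0n m) (ltnW ml))/=; lra.
  rewrite /t e1; have := pK ml => h.
  have m1 : Num.min (d / 2) (d / 2 / K) <= d / 2 by rewrite ge_min lexx.
  have m2 : K * p l <= d / 2.
    by rewrite mulrC -ler_pdivlMr// (le_trans pl)// ge_min lexx orbT.
  by move: h m1 m2 sl; rewrite mulrDr; lra.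
(* t m <= K p m gives t (m + 1) = t m - p m <= (1 - 1/K) t m *)
exists K, (1 - K^-1); split.
  have Kv : 0 < K^-1 by rewrite invr_gt0.
  have : K^-1 <= 2^-1 by rewrite lef_pV2 ?posrE.
  by move=> h; apply/andP; split; lra.
move=> n k _; apply: le_trans (pt _) _.
have tq m : t m.+1 <= (1 - K^-1) * t m.
  have : K^-1 * t m <= p m by rewrite mulrC ler_pdivrMr// mulrC.
  by rewrite mulrBl mul1r; have := tS m; lra.
have q0 : 0 <= 1 - K^-1.
  by rewrite subr_ge0 invf_le1// (le_trans _ K2)// ler1n.
have : t (n + k)%N <= (1 - K^-1) ^+ k * t n.
  elim: k => [|k ih]; first by rewrite addn0 expr0 mul1r.
  by rewrite addnS (le_trans (tq _))// exprS -mulrA ler_wpM2l.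
move=> /le_trans; apply; rewrite mulrAC mulrC.
by rewrite ler_wpM2r ?exprn_ge0.
Qed.

(** When the sum diverges, the term p 0 becomes negligible and the partial sums
    are bounded by a multiple of the next term, so they increase geometrically. *)
Lemma unbounded_sum_grows : (forall B, exists l, B < s l) -> exists N, grows_from N p 1.
Proof.
(* past l0, the term K p 0 is at most half of s l *)
move=> sB; have [l0 hl0] := sB (2 * K * p 0%N).
have sl0 : 0 < s l0 by apply: lt_trans hl0; rewrite !mulr_gt0.
exists (maxn l0 1).
have sp l : (maxn l0 1 <= l)%N -> s l <= 2 * K * p l.
  rewrite geq_max => /andP[h1 h2]; have := pK h2; rewrite -/(s l).
  by have := s_mono h1; lra.
pose q := 1 + (2 * K)^-1; have K20 : 0 < 2 * K by rewrite mulr_gt0.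
have q1 : 1 < q by rewrite ltrDl invr_gt0.
exists (2 * K * q), q; split => // n k hn.
have sq m : (maxn l0 1 <= m)%N -> q * s m <= s m.+1.
  move=> hm; rewrite sS mulrDl mul1r lerD2l ler_pdivrMl//; exact: sp.
have sk j : q ^+ j * s n.+1 <= s (n.+1 + j)%N.
  elim: j => [|j ih]; first by rewrite addn0 mul1r.
  rewrite addnS; apply: le_trans (sq _ _); last first.
    by apply: leq_trans hn _; rewrite addSn ltnW// ltnS leq_addr.
  by rewrite exprS -mulrA ler_pM2l//; lra.
have pn : p n <= s n.+1.
  by rewrite sS lerDr; apply: sumr_ge0 => i _; exact: ltW.
case: k => [|k].
  rewrite addn0 mul1r ler_peMl ?(ltW (p0 _))// mulr_ege1 ?(ltW q1)//.
  by have K2' : (2 : R) <= K := K2; lra.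
rewrite addnS -addSn exprS -!mulrA [leRHS]mulrA.
have hk : (maxn l0 1 <= n.+1 + k)%N.
  by apply: leq_trans hn _; rewrite addSn ltnW// ltnS leq_addr.
have := sp _ hk; move=> h.
rewrite [leRHS](_ : _ = q * (2 * K * p (n.+1 + k)%N)); last by ring.
rewrite ler_pM2l; last by lra.
apply: le_trans h; apply: le_trans (sk k).
by rewrite ler_wpM2l// exprn_ge0//; lra.
Qed.

Lemma quasiconvex_dichotomy : decays p 1 \/ exists N, grows_from N p 1.
Proof.
have [[B sB]|h] := pselect (exists B, forall l, s l <= B).
  by left; exact: bounded_sum_decays sB.
right; apply: unbounded_sum_grows => B; apply: contrapT => hB; apply: h.
by exists B => l; rewrite leNgt; apply/negP => Bl; apply: hB; exists l.
Qed.

End Dichotomy.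

(** If long blocks were dominated by their end terms from some N on,
    the dichotomy would apply to the sequence from N on. *)
Lemma late_blocks P (c M s : R) : (forall n, 0 < P n) -> 0 < c ->
  (forall n, c * P n <= P n.+1) -> (forall n, P n.+1 <= M * P n) -> 0 < s ->
  ~ decays P s -> ~ grows P s ->
  forall (N : nat) (K : R), exists m l, [/\ (N <= m)%N, (m < l)%N &
    K * (P m / s ^+ m + P l / s ^+ l) < \sum_(m <= n < l) P n / s ^+ n].
Proof.
move=> P0 c0 Pc PM s0 nd ng N K; apply: contrapT => h.
pose p n := P (N + n)%N / s ^+ (N + n).
have p0 n : 0 < p n by rewrite divr_gt0// exprn_gt0.
pose K' := Num.max 2 K.
have K2 : 2 <= K' by rewrite le_max lexx.
have pK m l : (m < l)%N -> \sum_(m <= n < l) p n <= K' * (p m + p l).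
  move=> ml; rewrite leNgt; apply/negP => hK; apply: h.
  exists (N + m)%N, (N + l)%N; split; rewrite ?leq_addr ?ltn_add2l//.
  rewrite [X in \sum_(X <= _ < _) _]addnC [X in \sum_(_ <= _ < X) _]addnC.
  rewrite big_addn addnK; under [ltRHS]eq_bigr do rewrite addnC.
  apply: le_lt_trans hK; rewrite ler_wpM2r ?addr_ge0 ?(ltW (p0 _))//.
  by rewrite le_max lexx orbT.
have sc n k : P (N + (n + k))%N = p (n + k)%N * s ^+ (N + n) * s ^+ k.
  by rewrite /p -mulrA -exprD addnA mulfVK// gt_eqF// exprn_gt0.
have sc0 n : P (N + n)%N = p n * s ^+ (N + n).
  by rewrite /p mulfVK// gt_eqF// exprn_gt0.
have [[C [q [/andP[q0 q1] hq]]]|[N' [C [q [q1 hq]]]]] := quasiconvex_dichotomy p0 K2 pK.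
  apply: nd; apply: (@decays_from0 P M P0 PM N).
  exists C, (q * s); split; first by rewrite mulr_gt0//= -[ltRHS]mul1r ltr_pM2r.
  move=> n k /subnKC <-; move: (n - N)%N => j.
  rewrite -addnA sc sc0 exprMn.
  rewrite [leRHS](_ : _ = C * q ^+ k * p j * s ^+ (N + j) * s ^+ k); last by ring.
  by rewrite !ler_pM2r ?exprn_gt0//; exact: hq.
apply: ng; apply: (@grows_from0 P c P0 c0 Pc (N + N') s s0).
exists C, (q * s); split; first by rewrite -[ltLHS]mul1r ltr_pM2r.
move=> n k; move=> hn; have Nn : (N <= n)%N by exact: leq_trans (leq_addr _ _) hn.
move: hn; rewrite -(subnKC Nn) leq_add2l; move: (n - N)%N => j hj.
rewrite -addnA sc sc0 exprMn.
rewrite [leLHS](_ : _ = q ^+ k * p j * s ^+ (N + j) * s ^+ k); last by ring.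
by rewrite 2!mulrA !ler_pM2r ?exprn_gt0//; exact: hq.
Qed.
End Growth.

Section Radii.
Variable R : realType.
Notation decays := (decays_from 0).
Notation grows := (grows_from 0).

(** a is the supremum of the radii at which P grows and b the infimum of those
    at which it decays.  Both conditions are open, so that neither holds at a
    or b, and bounded ratios make both sets nonempty. *)
Lemma growth_radii (P : nat -> R) (c M : R) : (forall n, 0 < P n) -> 0 < c -> 0 < M ->
  (forall n, c * P n <= P n.+1) -> (forall n, P n.+1 <= M * P n) ->
  exists a b : R, [/\ 0 < a <= b,
    forall r, 0 < r -> r < a -> grows P (r ^+ 2),
    forall r, 0 < r -> b < r -> decays P (r ^+ 2)
  & forall r, 0 < r -> a <= r <= b -> ~ grows P (r ^+ 2) /\ ~ decays P (r ^+ 2)].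
Proof.
move=> P0 c0 M0 Pc PM.
pose A := [set r | 0 < r /\ grows P (r ^+ 2)].
pose B := [set r | 0 < r /\ decays P (r ^+ 2)].
have sq2 (x y : R) : 0 < x -> 0 < y -> x ^+ 2 <= y ^+ 2 -> x <= y.
  by move=> x0 y0; rewrite ler_sqr// nnegrE ltW.
pose r0 := Num.sqrt (c / 2); have r00 : 0 < r0 by rewrite sqrtr_gt0 divr_gt0.
have Ar0 : A r0.
  split=> //; rewrite sqr_sqrtr ?divr_ge0 ?(ltW c0)//; exists 1, c; split; first lra.
  move=> n k _; rewrite mul1r; elim: k => [|k ih]; first by rewrite addn0 mul1r.
  by rewrite addnS exprS -mulrA (le_trans _ (Pc _))// ler_pM2l.
pose r1 := Num.sqrt (2 * M); have r10 : 0 < r1 by rewrite sqrtr_gt0 mulr_gt0.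
have Br1 : B r1.
  split=> //; rewrite sqr_sqrtr ?mulr_ge0 ?(ltW M0)//; exists 1, M; split.
    by rewrite M0/=; lra.
  move=> n k _; rewrite mul1r; elim: k => [|k ih]; first by rewrite addn0 mul1r.
  by rewrite addnS exprS (le_trans (PM _))// -mulrA ler_pM2l.
have AB r s : A r -> B s -> r <= s.
  move=> [r00' Gr] [s0 Ds]; rewrite leNgt; apply/negP => sr.
  apply: (decays_grows (exprn_gt0 2 s0) P0 Ds); apply: grows_down Gr.
  by rewrite ler_sqr ?nnegrE ?ltW.
have A0 : A !=set0 by exists r0.
have B0 : B !=set0 by exists r1.
have sA : has_sup A by split => //; exists r1 => r Ar; exact: AB.
have iB : has_inf B by split => //; exists r0 => r Br; exact: AB.
exists (sup A), (inf B); split.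
- apply/andP; split; first by apply: lt_le_trans r00 _; exact: (sup_upper_bound sA).
  by apply: ge_sup => // r Ar; apply: lb_le_inf => // s Bs; exact: AB.
- move=> r rp /(sup_gt A0)[s [s0 Gs] rs]; apply: grows_down Gs.
  by rewrite ler_sqr ?nnegrE ?ltW.
- move=> r rp /(inf_lt B0)[s [s0 Ds] sr]; apply: decays_up Ds.
  by rewrite ler_sqr ?nnegrE ?ltW.
move=> r rp /andP[ar rb]; split=> [/grows_open|/decays_open].
  move=> [s rs Gs]; have s0 : 0 < s by apply: lt_trans rs; rewrite exprn_gt0.
  have As : A (Num.sqrt s) by split; rewrite ?sqrtr_gt0// sqr_sqrtr// ltW.
  have := sup_upper_bound sA As; rewrite leNgt => /negP; apply.
  apply: le_lt_trans ar _; rewrite -(@ltr_pXn2r _ 2)// ?nnegrE ?sqrtr_ge0 ?(ltW rp)//.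
  by rewrite sqr_sqrtr// ltW.
move=> [s /andP[s0 sr] Ds].
have Bs : B (Num.sqrt s) by split; rewrite ?sqrtr_gt0// sqr_sqrtr// ltW.
have := ge_inf iB.2 Bs; rewrite leNgt => /negP; apply.
apply: lt_le_trans rb; rewrite -(@ltr_pXn2r _ 2)// ?nnegrE ?sqrtr_ge0 ?(ltW rp)//.
by rewrite sqr_sqrtr// ltW.
Qed.

Lemma decays_uniform (T : eqType) (F : T -> nat -> R) (l : seq T) s :
  0 < s -> (forall j n, 0 < F j n) ->
  exists C q : R, [/\ 0 < C, 0 < q < s & forall j, j \in l -> decays (F j) s ->
     forall n k, F j (n + k)%N <= C * q ^+ k * F j n].
Proof.
move=> s0 F0; elim: l => [|j l [C [q [C0 /andP[q0 qs] h]]]].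
  by exists 1, (s / 2); split => //; apply/andP; split; lra.
have [[C' [q' [/andP[q'0 q's] h']]]|nd] := pselect (decays (F j) s); last first.
  exists C, q; split => //; first by rewrite q0.
  by move=> i; rewrite in_cons => /predU1P[->//|]; exact: h.
exists (Num.max C C'), (Num.max q q'); split.
- by rewrite lt_max C0.
- by rewrite lt_max q0/= gt_max qs.
move=> i il Di n k.
have m0 : 0 <= Num.max C C' by rewrite le_max (ltW C0).
have big D p : 0 <= p -> D <= Num.max C C' -> p <= Num.max q q' ->
    D * p ^+ k * F i n <= Num.max C C' * Num.max q q' ^+ k * F i n.
  move=> p0 DC pq; rewrite ler_wpM2r ?(ltW (F0 _ _))//.
  apply: (@le_trans _ _ (Num.max C C' * p ^+ k)).
    by rewrite ler_wpM2r ?exprn_ge0.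
  by rewrite ler_wpM2l// lerXn2r ?nnegrE// le_max (ltW q0).
move: il; rewrite in_cons => /predU1P[ij|il].
  by rewrite ij in big *; apply: le_trans (h' n k isT) (big _ _ _ _ _);
    rewrite ?(ltW q'0) ?le_max ?lexx ?orbT.
apply: le_trans (h i il Di n k) (big _ _ _ _ _); rewrite ?(ltW q0) ?le_max ?lexx//.
Qed.

Lemma grows_uniform (T : eqType) (F : T -> nat -> R) (l : seq T) s :
  0 < s -> (forall j n, 0 < F j n) ->
  exists C q : R, [/\ 0 < C, s < q & forall j, j \in l -> grows (F j) s ->
     forall n k, q ^+ k * F j n <= C * F j (n + k)%N].
Proof.
move=> s0 F0; elim: l => [|j l [C [q [C0 qs h]]]].
  by exists 1, (s + 1); split => //; lra.
have [[C' [q' [q's h']]]|nd] := pselect (grows (F j) s); last first.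
  exists C, q; split => //.
  by move=> i; rewrite in_cons => /predU1P[->//|]; exact: h.
have q0 : 0 < q by exact: lt_trans qs.
have q'0 : 0 < q' by exact: lt_trans q's.
exists (Num.max C C'), (Num.min q q'); split.
- by rewrite lt_max C0.
- by rewrite lt_min qs.
move=> i il Gi n k.
have m0 : 0 <= Num.min q q' by rewrite le_min !ltW.
have big D p : 0 <= p -> D <= Num.max C C' -> Num.min q q' <= p ->
    p ^+ k * F i n <= D * F i (n + k)%N ->
    Num.min q q' ^+ k * F i n <= Num.max C C' * F i (n + k)%N.
  move=> p0 DC pq hp; apply: (@le_trans _ _ (p ^+ k * F i n)).
    by rewrite ler_wpM2r ?(ltW (F0 _ _))// lerXn2r ?nnegrE.
  by apply: le_trans hp _; rewrite ler_wpM2r ?(ltW (F0 _ _)).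
move: il; rewrite in_cons => /predU1P[ij|il].
  rewrite ij in big *; apply: big (h' n k isT); by rewrite ?(ltW q'0) ?le_max ?ge_min ?lexx ?orbT.
by apply: big (h i il Gi n k); rewrite ?(ltW q0) ?le_max ?ge_min ?lexx ?orbT.
Qed.

End Radii.

(** * Operators with a bounded left inverse *)

Section LeftInverse.
Variables (R : realType) (V : choiceType) (T Gam : l2 R V -> l2 R V).
Hypotheses (bT : bounded_operator T) (bG : bounded_operator Gam) (GT : cancel T Gam).

(** The range is the set of fixed points of the bounded operator T Gam. *)
Lemma left_inverse_closed_range : closed (range T).
Proof.
have /bounded_operatorP[linTG [M M0 TGM]] := bounded_comp bT bG.
move=> y /l2_closureP cl; exists (Gam y) => //.
apply/eqP; rewrite -subr_eq0; apply/eqP/l2norm_le0/ler_addgt0Pr => d d0.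
have [_ [x _ <-] yx] := cl (d / (M + 1)) ltac:(by rewrite divr_gt0// addr_gt0).
have -> : T (Gam y) - y = T (Gam (y - T x)) - (y - T x).
  have -> : T (Gam (y - T x)) = T (Gam y) - T (Gam (T x)) by exact: (linB linTG).
  by rewrite GT; l2ring.
apply: le_trans (ler_l2normB _ _) _; rewrite add0r.
apply: le_trans (lerD (TGM _) (lexx _)) _.
rewrite -[X in _ + X]mul1r -mulrDl mulrC.
by rewrite -ler_pdivlMr ?addr_gt0// ltW.
Qed.

Lemma left_inverse_ker : ker T = [set 0].
Proof.
have /bounded_operatorP[linT _] := bT.
have /bounded_operatorP[linG _] := bG.
apply/seteqP; split => x; last by move=> ->; exact: (lin0 linT).
by rewrite /ker/= => Tx; rewrite -(GT x) Tx (lin0 linG).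
Qed.

Lemma left_inverse_fredholm n : has_codim (range T) n -> fredholm T.
Proof.
move=> cod; split; last by exists n.
  by exists 0%N; rewrite left_inverse_ker; exact: has_dim0.
exact: left_inverse_closed_range.
Qed.

Lemma left_inverse_index n : has_codim (range T) n -> fredholm_index T = - n%:Z.
Proof.
move=> cod; have /bounded_operatorP[linT _] := bT.
rewrite (@fredholm_indexE _ _ T 0 n linT) ?sub0r//.
by rewrite left_inverse_ker; exact: has_dim0.
Qed.

End LeftInverse.

Lemma left_inverse_not_ap (R : realType) (V : choiceType) (S Gam : l2 R V -> l2 R V) w :
  bounded_operator Gam -> cancel (shifted S w) Gam -> ~ ap_spectrum S w.
Proof.
move=> /bounded_operatorP[_ [M M0 GM]] GS [x [x1 /l2_cvg0P Sx]].
have : 1 <= 0 :> R.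
  apply: (@le_cvg0 _ (fun n => M * l2norm (shifted S w (x n)))).
    move=> n; have := GM (shifted S w (x n)); rewrite GS.
    by rewrite (_ : l2norm (x n) = 1)//; exact: (congr1 (@complex.Re R) (x1 n)).
  by rewrite -[X in _ --> X](mulr0 M); apply: cvgM => //; exact: cvg_cst.
by rewrite ler10.
Qed.

Lemma sum_basis_in (R : realType) (V : choiceType) n (v : 'I_n -> V) (c : 'I_n -> R[i]) i :
  injective v -> (\sum_i c i *: basis_vec R (v i)) (v i) = c i.
Proof.
move=> vinj; rewrite l2val_sum (bigD1 i)//; set s := \sum_(_ | _) _.
have -> : s = 0.
  rewrite /s big1// => j ji; rewrite l2valZ basis_vecE (inj_eq vinj).
  by rewrite eq_sym (negbTE ji) mulr0.
by rewrite [LHS]addr0 l2valZ basis_vecE eqxx mulr1.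
Qed.

Lemma sum_basis_notin (R : realType) (V : choiceType) n (v : 'I_n -> V) (c : 'I_n -> R[i]) u :
  (forall i, v i != u) -> (\sum_i c i *: basis_vec R (v i)) u = 0.
Proof.
move=> vu; rewrite l2val_sum big1// => i _.
by rewrite l2valZ basis_vecE eq_sym (negbTE (vu i)) mulr0.
Qed.

(** * Splitting the tree into growing and decaying rays *)

Section Rays.
Variables (R : realType) (V : choiceType) (E : rel V) (root : V).
Variables (lam : V -> R) (S : l2 R V -> l2 R V).
Hypotheses (treeE : directed_tree E) (rootE : is_root E root) (leafE : leafless E).
Hypothesis lam_gt0 : forall v, ~ is_root E v -> 0 < lam v.
Hypothesis shS : weighted_shift E lam S.
Hypothesis bS : bounded_operator S.
Hypothesis liS : left_invertible S.
Variable K : nat.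
Hypothesis HK : forall u v w, (K <= depth E root u)%N -> E u v -> E u w -> v = w.

Local Notation depth := (depth E root).
Local Notation par := (par E).
Local Notation child := (child E).
Local Notation e := (basis_vec R).
Local Notation linS := (linS bS).
Implicit Types (f g x : l2 R V) (u v : V).

Definition weight_prod v : R := \prod_(i < depth v) lam (iter i par v).
Local Notation Pi := weight_prod.

Lemma weight_prod_par v : v != root -> Pi v = lam v * Pi (par v).
Proof.
move=> vr; rewrite /weight_prod (depth_par treeE rootE vr) big_ord_recl; congr (_ * _).
by apply: eq_bigr => i _; rewrite lift0 iterSr.
Qed.

Lemma weight_prod_child v : Pi (child v) = lam (child v) * Pi v.
Proof. by rewrite weight_prod_par ?(child_not_root treeE rootE)// (par_child treeE rootE). Qed.

Lemma weight_prod_gt0 v : 0 < Pi v.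
Proof.
elim/(tree_ind treeE rootE) : v => [|v vr ih].
  by rewrite /weight_prod (depth_root treeE rootE) big_ord0.
by rewrite weight_prod_par// mulr_gt0//; exact: (lam_pos treeE rootE lam_gt0 vr).
Qed.

Lemma lam_child_gt0 v : 0 < lam (child v).
Proof. apply: (lam_pos treeE rootE lam_gt0); exact: child_not_root. Qed.

Lemma deep_not_root v : (K < depth v)%N -> v != root.
Proof. by move=> Kv; rewrite -(depth_eq0 treeE rootE) -lt0n (leq_ltn_trans _ Kv). Qed.

Lemma deep_par v : (K < depth v)%N -> (K <= depth (par v))%N.
Proof. by move=> Kv; move: (Kv); rewrite (depth_par treeE rootE (deep_not_root Kv)). Qed.

Lemma child_par v : (K < depth v)%N -> child (par v) = v.
Proof.
move=> Kv; apply: (HK (deep_par Kv)); first exact: child_edge.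
exact: par_edge (deep_not_root Kv).
Qed.

Lemma shift_ray u : (K <= depth u)%N -> S (e u) = ((lam (child u))%:C)%C *: e (child u).
Proof.
move=> Ku; apply: l2_eq => v; rewrite l2valZ basis_vecE (shift_basis treeE rootE shS).
have [->|vu] := eqVneq v (child u); first by rewrite (child_edge leafE) mulr1.
case: ifP; last by rewrite mulr0.
by move=> uv; case/eqP: vu; apply: (HK Ku uv); exact: child_edge.
Qed.

Lemma norm_shift_ray u : (K <= depth u)%N -> l2norm (S (e u)) = lam (child u).
Proof.
move=> Ku; rewrite shift_ray// l2normZ l2norm_basis mulr1 normc_id ger0_norm//.
by rewrite ltW// lam_child_gt0.
Qed.

Section Split.
Variables (w : R[i]) (B : pred V) (C qa qb : R).
Hypotheses (w0 : w != 0) (B_deep : forall v, B v -> (K <= depth v)%N).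
Hypothesis B_child : forall v, (K <= depth v)%N -> B (child v) = B v.
Hypotheses (C0 : 0 < C) (qa0 : 0 < qa < normc w ^+ 2) (qb0 : normc w ^+ 2 < qb).
Hypothesis A_decay : forall u k, (K <= depth u)%N -> ~~ B u ->
  Pi (iter k child u) ^+ 2 <= C * qa ^+ k * Pi u ^+ 2.
Hypothesis B_grow : forall u k, B u ->
  qb ^+ k * Pi u ^+ 2 <= C * Pi (iter k child u) ^+ 2.

Let wp : 0 < normc w. Proof. by rewrite normc_gt0. Qed.

(** S cut off on B; it never carries mass out of B, nor into B below
    generation K. *)
Definition nonB_shift f := S (restr (predC B) f).
Local Notation N := nonB_shift.

Let linN : linear N.
Proof. by move=> c f g; rewrite /N restr_linear linS. Qed.

Let N_wcomp : wcomp N (fun v => if B (par v) then 0 else lam0 root lam v) par.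
Proof.
move=> f v; rewrite /N (shift_wcomp treeE rootE shS) restrE /=.
by case: (B (par v)); rewrite ?mul0r ?mulr0.
Qed.

Let N_B u : B u -> N (e u) = 0.
Proof.
move=> Bu; apply: l2_eq => v; rewrite N_wcomp basis_vecE l2val0.
case: ifP => [_|nB]; first by rewrite mul0r.
have [pv|_] := eqVneq (par v) u; last by rewrite mulr0.
by move: nB; rewrite pv Bu.
Qed.

Let N_A u k : (K <= depth u)%N -> ~~ B u ->
  iter k N (e u) = ((Pi (iter k child u) / Pi u)%:C)%C *: e (iter k child u)
  /\ ~~ B (iter k child u).
Proof.
move=> Ku Bu; elim: k => [|k [ih iB]].
  by rewrite /= divff ?gt_eqF ?weight_prod_gt0// (_ : (1%:C)%C = 1 :> R[i])// scale1r.
have Kk : (K <= depth (iter k child u))%N.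
  by rewrite (depth_iter_child treeE rootE leafE) (leq_trans Ku)// leq_addr.
split; last by rewrite iterS B_child.
rewrite iterS ih (linZ linN) /N.
have -> : restr (predC B) (e (iter k child u)) = e (iter k child u).
  apply: l2_eq => v; rewrite restrE basis_vecE; case: ifP => // /negbFE Bv.
  by have [vE|//] := eqVneq v (iter k child u); move: iB; rewrite -vE Bv.
rewrite shift_ray// scalerA -rmorphM/= weight_prod_child; congr ((_%:C)%C *: _).
by rewrite mulrC mulrA.
Qed.

Let q := Num.sqrt qa.
Let q_gt0 : 0 < q. Proof. by rewrite sqrtr_gt0; case/andP: qa0. Qed.
Let qw : q < normc w.
Proof.
case/andP: qa0 => a0 aw; rewrite -(sqr_sqrtr (ltW a0)) in aw.
by rewrite -(ltr_pXn2r (ltn0Sn 1)) ?nnegrE ?sqrtr_ge0 ?normc_ge0.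
Qed.

Let N_power_basis d : exists2 D : R, 0 <= D &
  forall u k, (K <= depth u + d)%N -> l2norm (iter k N (e u)) <= D * q ^+ k.
Proof.
have [c [M [c0 M0 SM _ SeM]]] := shift_bounds bS liS.
elim: d => [|d [D D0 ih]].
  exists (Num.max 1 (Num.sqrt C)); first by rewrite le_max ler01.
  move=> u k; rewrite addn0 => Ku; have [Bu|Bu] := boolP (B u).
    case: k => [|k]; first by rewrite (_ : iter 0 N (e u) = e u)// l2norm_basis mulr1 le_max lexx.
    rewrite iterSr N_B// (lin0 (lin_iter linN k)) l2norm0.
    by rewrite mulr_ge0 ?exprn_ge0 ?sqrtr_ge0// le_max ler01.
  have [-> _] := N_A k Ku Bu; rewrite l2normZ l2norm_basis mulr1 normc_id.
  rewrite ger0_norm ?divr_ge0 ?(ltW (weight_prod_gt0 _))//.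
  rewrite ler_pdivrMr ?weight_prod_gt0//.
  apply: (@le_trans _ _ (Num.sqrt C * q ^+ k * Pi u)).
    rewrite -(@ler_pXn2r _ 2)// ?nnegrE ?mulr_ge0 ?exprn_ge0 ?sqrtr_ge0
      ?(ltW (weight_prod_gt0 _))//.
    rewrite !exprMn sqr_sqrtr ?(ltW C0)// -exprM mulnC exprM sqr_sqrtr; last first.
      by case/andP: qa0 => /ltW.
    exact: A_decay.
  rewrite ler_wpM2r ?(ltW (weight_prod_gt0 _))// ler_wpM2r ?exprn_ge0 ?sqrtr_ge0//.
  by rewrite le_max lexx orbT.
exists (Num.max 1 (D * M / q)); first by rewrite le_max ler01.
move=> u [|k] Ku.
  by rewrite (_ : iter 0 N (e u) = e u)// l2norm_basis mulr1 le_max lexx.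
rewrite iterSr; have [mk Nk] := wcomp_iter k N_wcomp.
apply: (@le_trans _ _ (D * q ^+ k * l2norm (N (e u)))).
  apply: (wcomp_le Nk); first by rewrite mulr_ge0 ?exprn_ge0 ?sqrtr_ge0.
  move=> v; rewrite N_wcomp => hv; apply: ih.
  have vr : v != root.
    by apply: contraNneq hv => ->; rewrite /lam0 eqxx if_same mul0r.
  have pu : par v = u.
    by apply/eqP; apply: contraNT hv => /negbTE pu; rewrite basis_vecE pu mulr0.
  by rewrite (depth_par treeE rootE vr) pu addSnnS.
have NM : l2norm (N (e u)) <= M.
  apply: le_trans (SM _) _; rewrite -[leRHS]mulr1 ler_wpM2l ?(ltW M0)//.
  by rewrite -(l2norm_basis R u) l2norm_restr.
apply: (@le_trans _ _ (D * q ^+ k * M)).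
  by rewrite ler_wpM2l// mulr_ge0 ?exprn_ge0 ?sqrtr_ge0.
rewrite [leLHS](_ : _ = D * M / q * q ^+ k.+1).
  by rewrite ler_wpM2r ?exprn_ge0 ?sqrtr_ge0// le_max lexx orbT.
by rewrite exprS; field; rewrite gt_eqF.
Qed.

(** On a decaying ray the powers of N are controlled by the weights.  A vertex
    above generation K reaches the rays in at most K steps, at the price of a
    constant. *)
Lemma nonB_resolvent : invertible (shifted N w).
Proof.
have [D D0 hD] := N_power_basis K.
apply: (@invertible_shifted _ _ N w D q) => //; first by rewrite (ltW q_gt0).
move=> k f; have [mk Nk] := wcomp_iter k N_wcomp.
apply: (wcomp_le Nk); first by rewrite mulr_ge0 ?exprn_ge0 ?sqrtr_ge0.
by move=> u _; apply: hD; rewrite leq_addl.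
Qed.

Lemma backward_shift : exists L,
  wcomp L (fun v => if B v then ((lam (child v))^-1%:C)%C else 0) child /\ bounded_operator L.
Proof.
have [c [M [c0 M0 SM cS SeM]]] := shift_bounds bS liS.
have [|u|L Lw Lc] := @wcomp_ex R V
  (fun v => if B v then ((lam (child v))^-1%:C)%C else 0) child c^-1.
- by rewrite invr_ge0 ltW.
- rewrite (@sqsum_supp1 _ _ _ (par u)); last first.
    by move=> v vu; case: eqP => // cu; move: vu; rewrite -cu (par_child treeE rootE) ?eqxx.
  rewrite lee_fin ler_sqr ?nnegrE ?normc_ge0 ?invr_ge0 ?(ltW c0)//.
  have z0 : normc 0 <= c^-1 by rewrite Normc.normc0 invr_ge0 ltW.
  case: eqP => // cu; case: ifP => // Bp.
  rewrite normc_id ger0_norm ?invr_ge0 ?(ltW (lam_child_gt0 _))//.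
  rewrite lef_pV2 ?posrE ?lam_child_gt0// -norm_shift_ray//; exact: B_deep.
exists L; split => //; apply/bounded_operatorP; split; first exact: wcomp_linear Lw.
by exists c^-1; rewrite ?invr_gt0.
Qed.

Section Backward.
Variable L : l2 R V -> l2 R V.
Hypothesis Lw : wcomp L (fun v => if B v then ((lam (child v))^-1%:C)%C else 0) child.
Hypothesis bL : bounded_operator L.

Let linL : linear L. Proof. exact: wcomp_linear Lw. Qed.

Lemma backward_shiftK f : L (S f) = restr B f.
Proof.
apply: l2_eq => v; rewrite Lw restrE; case: ifP => Bv; last by rewrite mul0r.
rewrite (shift_edge treeE rootE shS _ (child_edge leafE v)) mulrA -rmorphM/=.
by rewrite mulVf ?mul1r// gt_eqF// lam_child_gt0.
Qed.

Lemma backward_restr f : L (restr B f) = L f.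
Proof.
apply: l2_eq => v; rewrite !Lw restrE; case: ifP => Bv; last by rewrite !mul0r.
by rewrite B_child ?Bv// B_deep.
Qed.

Lemma restr_backward f : restr B (L f) = L f.
Proof. by apply: l2_eq => v; rewrite restrE Lw; case: (B v); rewrite ?mul0r. Qed.

Lemma backward_top u : (~~ B u) || (depth u <= K)%N -> L (e u) = 0.
Proof.
move=> hu; apply: l2_eq => v; rewrite Lw basis_vecE l2val0.
case: ifP => Bv; last by rewrite mul0r.
have [cv|_] := eqVneq (child v) u; last by rewrite mulr0.
exfalso; move: hu; rewrite -cv B_child ?B_deep// Bv/= (depth_child treeE rootE) ?leafE//.
by rewrite leqNgt ltnS B_deep.
Qed.

Let L_basis k u : B u -> iter k L (e u) = 0 \/
  exists v, [/\ B v, u = iter k child v & iter k L (e u) = ((Pi v / Pi u)%:C)%C *: e v].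
Proof.
move=> Bu; elim: k => [|k [ih|[v [Bv uE ih]]]].
- right; exists u; split => //=.
  by rewrite divff ?gt_eqF ?weight_prod_gt0// (_ : (1%:C)%C = 1 :> R[i])// scale1r.
- by left; rewrite iterS ih (lin0 linL).
rewrite iterS ih (linZ linL).
have [vK|Kv] := leqP (depth v) K.
  by left; rewrite backward_top ?vK ?orbT// scaler0.
have cv := child_par Kv; have vr := deep_not_root Kv; have Kp := deep_par Kv.
have Bp : B (par v) by rewrite -B_child// cv.
right; exists (par v); split => //.
  by rewrite iterSr cv.
have -> : L (e v) = ((lam v)^-1%:C)%C *: e (par v).
  apply: l2_eq => x; rewrite Lw l2valZ !basis_vecE.
  have [->|xp] := eqVneq x (par v); first by rewrite Bp cv eqxx.
  rewrite mulr0; case: ifP => Bx; last by rewrite mul0r.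
  have [cx|_] := eqVneq (child x) v; last by rewrite mulr0.
  by move: xp; rewrite -cx (par_child treeE rootE) ?eqxx.
rewrite scalerA -rmorphM/=; congr ((_%:C)%C *: _).
rewrite (weight_prod_par vr); field.
by rewrite !gt_eqF ?weight_prod_gt0//; exact: (lam_pos treeE rootE lam_gt0 vr).
Qed.

(** On growing rays going backward contracts faster than |w| expands. *)
Lemma backward_resolvent : exists J, [/\ bounded_operator J,
  forall f, J (f - w *: L f) = f & forall f, J f - w *: L (J f) = f].
Proof.
have qbp : 0 < qb by apply: lt_trans qb0; rewrite exprn_gt0.
pose t := (Num.sqrt qb)^-1.
have sq0 : 0 < Num.sqrt qb by rewrite sqrtr_gt0.
have t0 : 0 < t by rewrite invr_gt0.
have wt : normc w * t < 1.
  rewrite ltr_pdivrMr// mul1r -(ltr_pXn2r (ltn0Sn 1)) ?nnegrE ?normc_ge0 ?(ltW sq0)//.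
  by rewrite sqr_sqrtr// ltW.
pose D := Num.max 1 (Num.sqrt C).
have D0 : 0 <= D by rewrite le_max ler01.
have LD k f : l2norm (iter k L f) <= D * t ^+ k * l2norm f.
  have [mk Lk] := wcomp_iter k Lw.
  apply: (wcomp_le Lk); first by rewrite mulr_ge0 ?exprn_ge0 ?(ltW t0).
  move=> u _; have [Bu|Bu] := boolP (B u); last first.
    case: k {mk Lk} => [|k].
      by rewrite (_ : iter 0 L (e u) = e u)// l2norm_basis mulr1 le_max lexx.
    rewrite iterSr backward_top ?Bu// (lin0 (lin_iter linL k)) l2norm0.
    by rewrite mulr_ge0 ?exprn_ge0 ?(ltW t0).
  have [->|[v [Bv -> ->]]] := L_basis k Bu.
    by rewrite l2norm0 mulr_ge0 ?exprn_ge0 ?(ltW t0).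
  rewrite l2normZ l2norm_basis mulr1 normc_id.
  rewrite ger0_norm ?divr_ge0 ?(ltW (weight_prod_gt0 _))//.
  rewrite ler_pdivrMr ?weight_prod_gt0// /t exprVn.
  apply: (@le_trans _ _ (Num.sqrt C / Num.sqrt qb ^+ k * Pi (iter k child v))); last first.
    rewrite ler_wpM2r ?(ltW (weight_prod_gt0 _))// ler_wpM2r ?invr_ge0 ?exprn_ge0 ?(ltW sq0)//.
    by rewrite le_max lexx orbT.
  rewrite mulrAC ler_pdivlMr ?exprn_gt0//.
  rewrite -(@ler_pXn2r _ 2)// ?nnegrE ?mulr_ge0 ?exprn_ge0 ?(ltW sq0) ?sqrtr_ge0
    ?(ltW (weight_prod_gt0 _))//.
  rewrite !exprMn sqr_sqrtr ?(ltW C0)// -exprM mulnC exprM sqr_sqrtr ?(ltW qbp)//.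
  by rewrite mulrC; exact: B_grow.
apply: (@neumann _ _ (fun f => w *: L f) D (normc w * t)) => //.
- by move=> c f g; rewrite linL; l2ring.
- by rewrite mulr_ge0 ?normc_ge0 ?(ltW t0).
move=> k f; rewrite iter_scale// l2normZ normcX exprMn.
rewrite mulrCA -!mulrA ler_wpM2l ?exprn_ge0 ?normc_ge0//.
by rewrite mulrA; exact: LD.
Qed.

End Backward.

Lemma split_shifted f : restr B f = 0 -> shifted S w f = shifted N w f.
Proof.
move=> f0; rewrite /shifted /N (_ : restr _ f = f)//.
apply: l2_eq => v; have := congr1 (fun g : l2 R V => g v) f0.
by rewrite !restrE l2val0 /=; case: ifP.
Qed.

(** To solve (S - w) f = g, the part FB of f on B is found first, from
    L g = FB - w L FB; what remains involves N only.  The residue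
    g - (S - w) FB vanishes on B below generation K, so an arbitrary g is hit
    up to a vector supported by B at generation K. *)
Lemma split_resolvent : exists Gam FB J, [/\ bounded_operator Gam,
  cancel (shifted S w) Gam, forall g, Gam g = FB g + J (g - shifted S w (FB g)),
  forall g, shifted N w (J g) = g & 
  [/\ forall f, FB (shifted S w f) = restr B f,
     forall g v, B v -> (K < depth v)%N -> (g - shifted S w (FB g)) v = 0
    & forall v, (depth v <= K)%N -> FB (e v) = 0 ] /\ linear FB].
Proof.
have [L [Lw bL]] := backward_shift.
have [JB [bJB JB1 JB2]] := backward_resolvent Lw.
have [J [bJ J1 J2]] := nonB_resolvent.
have linL : linear L by exact: wcomp_linear Lw.
have /bounded_operatorP[linJB _] := bJB.
pose FB g := JB (L g).
have bFB : bounded_operator FB by exact: bounded_comp.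
have FBr g : restr B (FB g) = FB g.
  have := JB2 (L g); rewrite -/(FB g) => /eqP; rewrite subr_eq => /eqP ->.
  rewrite (linD (restr_linear B)) (linZ (restr_linear B)).
  by rewrite !(restr_backward Lw).
have bSw := bounded_shifted w bS.
have FBf f : FB (shifted S w f) = restr B f.
  rewrite /FB /shifted (linB linL) (linZ linL) (backward_shiftK Lw).
  by rewrite -(backward_restr Lw f) JB1.
exists (fun g => FB g + J (g - shifted S w (FB g))), FB, J; split => //.
- have b1 : bounded_operator (fun g => g - shifted S w (FB g)).
    have := bounded_lin (-1) (bounded_comp bSw bFB) (@bounded_id R V).
    by congr bounded_operator; apply/funext => g; l2ring.
  have := bounded_lin 1 bFB (bounded_comp bJ b1).
  by congr bounded_operator; apply/funext => g; l2ring.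
- move=> f; rewrite FBf.
  have -> : shifted S w f - shifted S w (restr B f) = shifted S w (f - restr B f).
    by rewrite /shifted (linB linS); l2ring.
  rewrite split_shifted; last first.
    apply: l2_eq => v; rewrite (linB (restr_linear B)) l2valB !restrE l2val0.
    by case: ifP => _; rewrite subrr.
  by rewrite J1; l2ring.
split; last by have /bounded_operatorP[] := bFB.
split=> // [g v Bv Kv|v vK]; last first.
  by rewrite /FB (backward_top Lw) ?vK ?orbT// (lin0 linJB).
set h := g - _; have Lh : L h = 0.
  rewrite /h /shifted !(linB linL) (linZ linL) (backward_shiftK Lw) FBr.
  have := JB2 (L g); rewrite -/(FB g) => ->.
  by rewrite subrr.
have Kp := deep_par Kv.
have := congr1 (fun x : l2 R V => x (par v)) Lh; rewrite Lw l2val0 child_par//.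
rewrite -(B_child Kp) child_par// Bv => /eqP; rewrite mulf_eq0 => /orP[|/eqP//].
by rewrite fmorph_eq0 invr_eq0 gt_eqF// -(child_par Kv) lam_child_gt0.
Qed.

(** A combination of the e (v i) in the range would have a preimage vanishing
    on B, but the only preimage for N - w is the combination itself divided by
    - w. *)
Lemma split_indep n (v : 'I_n -> V) : injective v ->
  (forall i, B (v i)) -> (forall i, depth (v i) = K) ->
  forall c : 'I_n -> R[i], range (shifted S w) (\sum_i c i *: e (v i)) ->
  forall i, c i = 0.
Proof.
move=> vinj Bv Kv c [f _ fc] i.
have [Gam [FB [J [_ GS GE JN [[FBf _ FBe] linFB]]]]] := split_resolvent.
have FB0 : FB (\sum_i c i *: e (v i)) = 0.
  rewrite (lin_sum linFB) big1// => j _.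
  by rewrite (linZ linFB) FBe ?Kv// scaler0.
have fJ : f = J (\sum_i c i *: e (v i)).
  rewrite -[LHS]GS fc GE FB0 add0r /shifted (lin0 linS) scaler0.
  by congr J; l2ring.
have [J' [_ J'1 _]] := nonB_resolvent.
pose g : l2 R V := - w^-1 *: \sum_i c i *: e (v i).
have Ng : shifted N w g = \sum_i c i *: e (v i).
  rewrite /shifted /g (linZ linN) (lin_sum linN) big1; last first.
    by move=> j _; rewrite (linZ linN) N_B// scaler0.
  by rewrite scaler0 sub0r scalerA mulrN mulfV// scaleN1r opprK.
have fg : f = g by rewrite -[LHS]J'1 -[RHS]J'1 Ng fJ JN.
have fv : f (v i) = - w^-1 * c i.
  by rewrite fg /g l2valZ sum_basis_in.
have rf : restr B f = 0 by rewrite -FBf fc.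
have : f (v i) = 0 by have := congr1 (fun x : l2 R V => x (v i)) rf; rewrite restrE Bv.
rewrite fv => /eqP; rewrite mulf_eq0 oppr_eq0 invr_eq0 (negbTE w0)/=.
by move/eqP.
Qed.

(** The coordinates on B of the solution for N - w are concentrated at
    generation K; removing them costs one correction for each growing ray. *)
Lemma split_codim n (v : 'I_n -> V) : injective v ->
  (forall u, (B u /\ depth u = K) <-> exists i, v i = u) ->
  has_codim (range (shifted S w)) n.
Proof.
move=> vinj vB; have Bv i : B (v i) by have [_ /(_ (ex_intro _ i erefl))[]] := vB (v i).
have Kv i : depth (v i) = K by have [_ /(_ (ex_intro _ i erefl))[]] := vB (v i).
have [Gam [FB [J [_ GS GE JN [[_ FBv FBe] linFB]]]]] := split_resolvent.
have lsw : linear (shifted S w) by move=> c f g; rewrite /shifted linS; l2ring.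
exists (fun i => e (v i)); split => // x _.
pose f0 := J (x - shifted S w (FB x)).
have f0v u : B u -> (K < depth u)%N -> f0 u = 0.
  move=> Bu Ku; have := congr1 (fun g : l2 R V => g u) (JN (x - shifted S w (FB x))).
  rewrite FBv// -/f0 /shifted l2valB l2valZ N_wcomp.
  have Kp := deep_par Ku.
  rewrite -(B_child Kp) child_par// Bu mul0r sub0r => /eqP.
  by rewrite oppr_eq0 mulf_eq0 (negbTE w0) => /eqP.
have rf0 : restr B f0 = \sum_i f0 (v i) *: e (v i).
  apply: l2_eq => u; rewrite restrE; case: ifP => Bu; last first.
    by rewrite sum_basis_notin// => i; apply: contraFneq Bu => <-.
  have := B_deep Bu; rewrite leq_eqVlt => /predU1P[/esym uK|Ku].
    have [i <-] := (vB u).1 (conj Bu uK).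
    by rewrite (sum_basis_in (fun i => f0 (v i))).
  rewrite f0v// sum_basis_notin// => i.
  by apply: contraTneq Ku => <-; rewrite Kv ltnn.
pose c : {ffun 'I_n -> R[i]} := [ffun i => - w * f0 (v i)].
have hc : range (shifted S w) (x - \sum_i c i *: e (v i)).
  exists (FB x + restr (predC B) f0) => //.
  have -> : restr (predC B) f0 = f0 - restr B f0.
    by apply: l2_eq => u; rewrite l2valB !restrE/=; case: (B u); rewrite ?subr0 ?subrr.
  have fs : shifted S w (f0 - restr B f0) = shifted N w f0 + w *: restr B f0.
    rewrite split_shifted; last first.
      apply: l2_eq => u; rewrite (linB (restr_linear B)) l2valB !restrE l2val0.
      by case: ifP => _; rewrite subrr.
    rewrite /shifted (linB linN) rf0 (lin_sum linN) big1 ?subr0.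
      by l2ring.
    by move=> i _; rewrite (linZ linN) N_B// scaler0.
  rewrite (linD lsw) fs JN rf0.
  have -> : \sum_i c i *: e (v i) = - w *: \sum_i f0 (v i) *: e (v i).
    by rewrite scaler_sumr; apply: eq_bigr => i _; rewrite ffunE scalerA.
  by l2ring.
exists c; split=> // c' hc'; apply/ffunP => i; apply/eqP; rewrite -subr_eq0; apply/eqP.
apply: (split_indep vinj Bv Kv (c := fun i => c i - c' i)).
have [[f1 _ h1] [f2 _ h2]] := (hc, hc').
exists (f2 - f1) => //; rewrite (linB lsw) h1 h2.
under [RHS]eq_bigr do rewrite scalerBl.
by rewrite sumrB; l2ring.
Qed.

End Split.
End Rays.

Lemma l2norm_disjoint (R : realType) (V : choiceType) (f g : l2 R V) :
  (forall v, f v = 0 \/ g v = 0) -> l2norm (f + g) ^+ 2 = l2norm f ^+ 2 + l2norm g ^+ 2.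
Proof.
move=> fg; apply: EFin_inj; rewrite EFinD -!l2norm_sq.
rewrite -esumD; try by move=> v _; rewrite lee_fin sqr_ge0.
apply: eq_esum => v _; rewrite l2valD -EFinD; congr EFin.
by case: (fg v) => ->; rewrite ?add0r ?addr0 Normc.normc0 expr0n/= ?add0r ?addr0.
Qed.

(** * A ray that neither grows nor decays *)

Section Blocks.
Variables (R : realType) (V : choiceType) (E : rel V) (root : V).
Variables (lam : V -> R) (S : l2 R V -> l2 R V).
Hypotheses (treeE : directed_tree E) (rootE : is_root E root) (leafE : leafless E).
Hypothesis lam_gt0 : forall v, ~ is_root E v -> 0 < lam v.
Hypothesis shS : weighted_shift E lam S.
Hypothesis bS : bounded_operator S.
Hypothesis liS : left_invertible S.
Variable K : nat.
Hypothesis HK : forall u v w, (K <= depth E root u)%N -> E u v -> E u w -> v = w.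

Local Notation depth := (depth E root).
Local Notation par := (par E).
Local Notation child := (child E).
Local Notation e := (basis_vec R).
Local Notation linS := (linS bS).
Local Notation Pi := (weight_prod E root lam).

Definition ray_weight g n := Pi (iter n child g) ^+ 2.

Lemma ray_weight_gt0 g n : 0 < ray_weight g n.
Proof. by rewrite exprn_gt0// weight_prod_gt0. Qed.

Lemma ray_ratio : exists c M : R, [/\ 0 < c, 0 < M,
  forall g n, (K <= depth g)%N -> c * ray_weight g n <= ray_weight g n.+1
  & forall g n, (K <= depth g)%N -> ray_weight g n.+1 <= M * ray_weight g n].
Proof.
have [c [M [c0 M0 _ cS SM]]] := shift_bounds bS liS.
have step g n : (K <= depth g)%N ->
    ray_weight g n.+1 = l2norm (S (e (iter n child g))) ^+ 2 * ray_weight g n.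
  move=> Kg; rewrite (norm_shift_ray treeE rootE leafE lam_gt0 shS HK).
    by rewrite /ray_weight iterS (weight_prod_child lam treeE rootE leafE) exprMn.
  by rewrite (depth_iter_child treeE rootE leafE) (leq_trans Kg)// leq_addr.
exists (c ^+ 2), (M ^+ 2); split; rewrite ?exprn_gt0// => g n Kg; rewrite step//.
  by rewrite ler_wpM2r ?(ltW (ray_weight_gt0 _ _))// ler_sqr ?nnegrE ?l2norm_ge0// ltW.
by rewrite ler_wpM2r ?(ltW (ray_weight_gt0 _ _))// ler_sqr ?nnegrE ?l2norm_ge0// ltW.
Qed.

Variables (w : R[i]) (g : V).
Hypotheses (w0 : w != 0) (Kg : (K <= depth g)%N).
Hypothesis ng : ~ grows_from 0 (ray_weight g) (normc w ^+ 2).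
Hypothesis nd : ~ decays_from 0 (ray_weight g) (normc w ^+ 2).

Let wp : 0 < normc w. Proof. by rewrite normc_gt0. Qed.
Let coef v : R[i] := ((Pi v)%:C)%C / w ^+ (depth v - depth g).
Let y n : l2 R V := coef (iter n child g) *: e (iter n child g).

Let depth_ray n : depth (iter n child g) = (depth g + n)%N.
Proof. exact: depth_iter_child. Qed.

Let Sy n : S (y n) = w *: y n.+1.
Proof.
rewrite /y (linZ linS) (shift_ray treeE rootE leafE shS HK); last first.
  by rewrite depth_ray (leq_trans Kg)// leq_addr.
rewrite !scalerA iterS; congr (_ *: _).
rewrite /coef -iterS !depth_ray ![(depth g + _)%N]addnC !addnK iterS.
rewrite (weight_prod_child lam treeE rootE leafE) rmorphM/= exprS.
by field; rewrite w0 expf_neq0.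
Qed.

Let block m l : l2 R V := \sum_(m <= n < l) y n.

Let block_finite_comb m l : block m l = finite_comb [seq iter n child g | n <- index_iota m l] coef.
Proof. by rewrite /finite_comb big_map. Qed.

Let ray_inj : injective (fun n => iter n child g).
Proof. by move=> n m /(congr1 depth); rewrite !depth_ray => /addnI. Qed.

Let uniq_block m l : uniq [seq iter n child g | n <- index_iota m l].
Proof. by rewrite (map_inj_uniq ray_inj) iota_uniq. Qed.

Let norm_coef n : normc (coef (iter n child g)) ^+ 2 = ray_weight g n / (normc w ^+ 2) ^+ n.
Proof.
rewrite /coef Normc.normcM Normc.normcV normcX normc_id depth_ray addnC addnK.
rewrite ger0_norm; last by rewrite ltW// weight_prod_gt0.
by rewrite exprMn exprVn -!exprM mulnC.
Qed.

Let norm_block m l : l2norm (block m l) ^+ 2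
  = \sum_(m <= n < l) ray_weight g n / (normc w ^+ 2) ^+ n.
Proof.
apply: EFin_inj; rewrite -l2norm_sq block_finite_comb sqsum_finite_comb ?uniq_block// big_map.
by congr EFin; apply: eq_bigr => n _; exact: norm_coef.
Qed.

Let norm_y n : l2norm (y n) ^+ 2 = ray_weight g n / (normc w ^+ 2) ^+ n.
Proof. by rewrite /y l2normZ l2norm_basis mulr1 norm_coef. Qed.

Let shifted_block m l : (m <= l)%N -> shifted S w (block m l) = w *: (y l - y m).
Proof.
move=> ml; rewrite -telescope_sumr// /shifted /block scaler_sumr.
rewrite scaler_sumr (big_morph S (linD linS) (lin0 linS)) -sumrB.
by apply: eq_bigr => n _; rewrite Sy scalerBr.
Qed.

(** On the formal eigenvector y, S y_n = w y_(n+1), so S - w maps the block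
    y_m + ... + y_(l-1) to w (y_l - y_m); [late_blocks] provides blocks much
    larger than their ends. *)
Lemma approx_eigenvector (N : nat) (eps : R) : 0 < eps -> exists x l,
  [/\ l2norm x = 1, l2norm (shifted S w x) <= eps, (N <= l)%N
    & forall v, x v != 0 -> (N <= depth v)%N && (depth v < l)%N].
Proof.
move=> eps0; have [c [M [c0 M0 Pc PM]]] := ray_ratio.
have w2 : 0 < normc w ^+ 2 by rewrite exprn_gt0.
have [m [l [Nm ml big]]] := late_blocks (ray_weight_gt0 g) c0
  (fun n => Pc g n Kg) (fun n => PM g n Kg) w2 nd ng N (2 * normc w ^+ 2 / eps ^+ 2).
rewrite -norm_block -!norm_y in big.
set b := l2norm (block m l) in big.
have b0 : 0 < b.
  rewrite lt_def l2norm_ge0 andbT; apply: contraTneq big => ->.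
  rewrite expr0n/= -leNgt; apply: mulr_ge0; last by rewrite addr_ge0// sqr_ge0.
  by apply: divr_ge0; [apply: mulr_ge0 => //; exact: sqr_ge0 | exact: sqr_ge0].
exists ((b^-1%:C)%C *: block m l), (depth g + l)%N; split.
- by rewrite l2normZ normc_id ger0_norm ?invr_ge0 ?(ltW b0)// mulVf// gt_eqF.
- have -> : shifted S w ((b^-1%:C)%C *: block m l) = (b^-1%:C)%C *: shifted S w (block m l).
    by rewrite /shifted (linZ linS); l2ring.
  rewrite shifted_block ?(ltnW ml)// !l2normZ normc_id ger0_norm ?invr_ge0 ?(ltW b0)//.
  rewrite ler_pdivrMl//.
  rewrite -(@ler_pXn2r _ 2)// ?nnegrE ?mulr_ge0 ?l2norm_ge0 ?normc_ge0 ?(ltW b0) ?(ltW eps0)//.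
  rewrite !exprMn.
  apply: (@le_trans _ _ (normc w ^+ 2 * (2 * (l2norm (y m) ^+ 2 + l2norm (y l) ^+ 2)))).
    rewrite ler_wpM2l ?(ltW w2)//.
    apply: (@le_trans _ _ ((l2norm (y l) + l2norm (y m)) ^+ 2)).
      by rewrite ler_sqr ?nnegrE ?addr_ge0 ?l2norm_ge0// ler_l2normB.
    by have := sqr_ge0 (l2norm (y l) - l2norm (y m)); nra.
  move: big; rewrite mulrAC ltr_pdivrMr ?exprn_gt0// => /ltW; apply: le_trans.
  by rewrite le_eqVlt; apply/orP; left; apply/eqP; ring.
- by rewrite (leq_trans Nm)// (leq_trans (ltnW ml))// leq_addl.
move=> v; rewrite l2valZ mulf_eq0 negb_or => /andP[_].
rewrite block_finite_comb finite_combE//; case: ifP => [|_]; last by rewrite eqxx.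
move=> /mapP[n]; rewrite mem_index_iota => /andP[mn nl] -> _.
by rewrite depth_ray ltn_add2l nl andbT (leq_trans Nm)// (leq_trans mn)// leq_addl.
Qed.

Lemma ray_ap_spectrum : ap_spectrum S w.
Proof.
have [x hx] := choice (fun n => let: ex_intro x (ex_intro l h) :=
   approx_eigenvector 0 (exprn_gt0 n (divr_gt0 ltr01 (ltr0Sn R 1))) in
   ex_intro (fun x => l2norm x = 1 /\ l2norm (shifted S w x) <= (1 / 2) ^+ n) x
   (match h with And4 a b _ _ => conj a b end)).
exists x; split; first by move=> n; rewrite l2_normE (hx n).1.
apply/l2_cvg0P; apply: (@cvg0_le _ _ (fun n => 1 * (1 / 2) ^+ n)).
  by move=> n; rewrite l2norm_ge0 mul1r; exact: (hx n).2.
by apply: cvg_geom0; apply/andP; split; lra.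
Qed.

(** Gliding hump.  Unit approximate eigenvectors x_n with disjoint supports and
    geometrically small images are summed: the images converge to some z in the
    closure of the range.  As S - w can be inverted coordinate by coordinate, a
    preimage of z must agree with every partial sum on its support, and its
    norm would be infinite. *)
Lemma ray_range_not_closed : ~ closed (range (shifted S w)).
Proof.
move=> cl.
have [X hX] := choice (fun Nn : nat * nat => let: ex_intro x (ex_intro l h) :=
   approx_eigenvector Nn.1 (exprn_gt0 Nn.2 (divr_gt0 ltr01 (ltr0Sn R 1))) in
   ex_intro (fun xl : l2 R V * nat => [/\ l2norm xl.1 = 1,
     l2norm (shifted S w xl.1) <= (1 / 2) ^+ Nn.2, (Nn.1 <= xl.2)%N
    & forall v, xl.1 v != 0 -> (Nn.1 <= depth v)%N && (depth v < xl.2)%N]) (x, l) h).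
(* b n is the depth from which the n-th hump is chosen; the hump ends before
   depth b (n + 1) *)
pose b := fix b n := if n is n'.+1 then (X (b n', n')).2 else 0%N.
pose x n := (X (b n, n)).1.
have x1 n : l2norm (x n) = 1 by have [] := hX (b n, n).
have Sx n : l2norm (shifted S w (x n)) <= 1 * (1 / 2) ^+ n.
  by rewrite mul1r; have [] := hX (b n, n).
have bS' n : (b n <= b n.+1)%N by have [] := hX (b n, n).
have xs n v : x n v != 0 -> (b n <= depth v)%N && (depth v < b n.+1)%N.
  by have [_ _ _] := hX (b n, n); exact.
have b_mono : {homo b : n m / (n <= m)%N} by apply: homo_leq => //; exact: leq_trans.
pose F n : l2 R V := \sum_(k < n) x k.
have FS n : F n.+1 = F n + x n by rewrite /F big_ord_recr.
have Fs n v : (b n <= depth v)%N -> F n v = 0.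
  move=> bn; rewrite /F l2val_sum big1// => k _; apply/eqP; apply: contraTT bn => /xs/andP[_ kv].
  by rewrite -ltnNge (leq_trans kv)// b_mono.
have Fnorm n : l2norm (F n) ^+ 2 = n%:R.
  elim: n => [|n ih]; first by rewrite /F big_ord0 l2norm0 expr0n.
  rewrite FS l2norm_disjoint ?ih ?x1 ?expr1n ?natr1// => v.
  have [->|/xs/andP[bv _]] := eqVneq (x n v) 0; first by right.
  by left; exact: Fs.
have lsw : linear (shifted S w) by move=> c f h; rewrite /shifted linS; l2ring.
have h01 : 0 <= (1 / 2 : R) < 1 by apply/andP; split; lra.
have [z hz] := l2_geometric_series h01 Sx.
have zF n : l2norm (z - shifted S w (F n)) <= 1 / (1 - 1 / 2) * (1 / 2) ^+ n.
  by rewrite (lin_sum lsw).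
have [f _ fz] : range (shifted S w) z.
  apply: cl; apply/l2_closureP => d d0.
  have /cvgrPdist_lt/(_ _ d0)[N _ hN] := @cvg_geom0 R (1 / (1 - 1 / 2)) _ h01.
  exists (shifted S w (F N)); first by exists (F N).
  apply: le_lt_trans (zF N) _; have := hN N (leqnn N); rewrite sub0r normrN.
  by apply: le_lt_trans; exact: ler_norm.
pose D n : l2 R V := f - F n.
have [a a0 DS] : exists2 a : nat -> R, a @ \oo --> (0 : R) &
    forall n, l2norm (shifted S w (D n)) <= a n.
  exists (fun n => 1 / (1 - 1 / 2) * (1 / 2) ^+ n); first exact: cvg_geom0.
  move=> n.
  by rewrite /D (linB lsw) fz.
have ptw v : (fun n => normc (D n v)) @ \oo --> (0 : R).
  elim/(tree_ind treeE rootE) : v => [|v vr ih].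
    apply: (@cvg0_le _ _ (fun n => (normc w)^-1 * a n)); last first.
      by rewrite -[X in _ --> X](mulr0 (normc w)^-1); apply: cvgM => //; exact: cvg_cst.
    move=> n; rewrite normc_ge0/= ler_pdivlMl//.
    have := normc_coord (shifted S w (D n)) root.
    rewrite /shifted l2valB l2valZ (shift_root treeE rootE shS) sub0r [normc (- _)]normcN.
    by rewrite Normc.normcM => /le_trans; apply; exact: DS.
  apply: (@cvg0_le _ _ (fun n => (normc w)^-1 * a n
      + (normc w)^-1 * lam v * normc (D n (par v)))); last first.
    rewrite -[X in _ --> X]addr0; apply: cvgD.
      by rewrite -[X in _ --> X](mulr0 (normc w)^-1); apply: cvgM => //; exact: cvg_cst.
    by rewrite -[X in _ --> X](mulr0 ((normc w)^-1 * lam v)); apply: cvgM => //; exact: cvg_cst.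
  move=> n; rewrite normc_ge0/= -!mulrA -mulrDr ler_pdivlMl//.
  have := normc_coord (shifted S w (D n)) v.
  rewrite /shifted l2valB l2valZ (shift_par treeE rootE shS)// => h.
  have lv : 0 <= lam v by rewrite ltW// (lam_pos treeE rootE lam_gt0 vr).
  rewrite -Normc.normcM -[lam v]ger0_norm// -normc_id -Normc.normcM.
  set p := (X in _ <= _ + normc X) in h *; set q := (X in normc X <= _).
  have -> : q = p - (p - q) by ring.
  apply: le_trans (ler_normcD _ _) _; rewrite [normc (- _)]normcN addrC lerD2r.
  by apply: le_trans h _; exact: DS.
have fF n v : (depth v < b n)%N -> f v = F n v.
  move=> vb; have st m : (n <= m)%N -> F m v = F n v.
    move=> /subnKC <-; elim: (m - n)%N => [|j ih]; first by rewrite addn0.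
    rewrite addnS FS l2valD ih.
    have [->|/xs/andP[bv _]] := eqVneq (x (n + j)%N v) 0; first by rewrite addr0.
    by move: vb; rewrite ltnNge (leq_trans _ bv)// b_mono// leq_addr.
  apply/eqP; rewrite -subr_eq0; apply/eqP/Normc.eq0_normc/eqP.
  rewrite eq_le normc_ge0 andbT.
  apply: (@le_cvg0 _ (fun m => normc (D (m + n)%N v))).
    by move=> m; rewrite /D l2valB st// leq_addl.
  by have := ptw v; rewrite -(cvg_shiftn n).
have fn n : n%:R <= l2norm f ^+ 2.
  rewrite -Fnorm ler_sqr ?nnegrE ?l2norm_ge0//; apply: l2norm_le_coord => v.
  have [vb|bv] := ltnP (depth v) (b n); first by rewrite (fF n).
  by rewrite Fs// Normc.normc0 normc_ge0.
have := fn (Num.bound (l2norm f ^+ 2)); rewrite leNgt => /negP; apply.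
by apply: archi_boundP; rewrite sqr_ge0.
Qed.

End Blocks.

(** * The number of rays is the dimension of the kernel of the adjoint *)

Section Codimension.
Variables (R : realType) (V : choiceType) (E : rel V) (root : V).
Variables (lam : V -> R) (S : l2 R V -> l2 R V).
Hypotheses (treeE : directed_tree E) (rootE : is_root E root) (leafE : leafless E).
Hypothesis lam_gt0 : forall v, ~ is_root E v -> 0 < lam v.
Hypothesis shS : weighted_shift E lam S.
Hypothesis bS : bounded_operator S.
Hypothesis liS : left_invertible S.
Variable K : nat.
Hypothesis HK : forall u v w, (K <= depth E root u)%N -> E u v -> E u w -> v = w.
Variable d : nat.
Hypothesis dimE : has_dim (ker (adjoint S)) d.

Local Notation depth := (depth E root).
Local Notation child := (child E).
Local Notation e := (basis_vec R).
Local Notation linS := (linS bS).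
Local Notation S' := (adjoint S).

(** x - T (S^* x) is the projection of x to the kernel of S^* along the range
    of S. *)
Lemma codim_shift : has_codim (range S) d.
Proof.
have [T [bT ST TS _]] := cauchy_dual treeE rootE shS bS liS.
have [linT _] := (bounded_operatorP T).1 bT.
have linS' := adjS_linear bS.
have [b [bker hb]] := dimE; exists b; split => // x _.
have kx : ker S' (x - T (S' x)) by rewrite /ker/= (linB linS') ST subrr.
have [c [hc uc]] := hb _ kx.
have TSr z : range S z -> T (S' z) = z by rewrite -TS => -[y _ <-]; rewrite ST.
have rT y : range S (T y) by rewrite -TS; exists y.
exists c; split.
  have -> : x - \sum_i c i *: b i = T (S' x) + (x - T (S' x) - \sum_i c i *: b i) by l2ring.
  by rewrite hc addr0.
move=> c' /TSr; rewrite (linB linS') (lin_sum linS') big1 ?subr0; last first.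
  move=> i _; have bi : S' (b i) = 0 by exact: bker.
  have := linZ linS' (c' i) (b i); rewrite bi => cb.
  by rewrite -[RHS](scaler0 _ (c' i)); exact: cb.
by move=> h; apply: uc; rewrite /= h; l2ring.
Qed.

(** If Lam is a left inverse of S, then S - w = (1 - w Lam) S with 1 - w Lam
    invertible for small w. *)
Lemma small_codim : exists2 eps : R, 0 < eps & forall w, normc w < eps ->
  has_codim (range (shifted S w)) d.
Proof.
have [Lam bL LS] := liS; have [linL [M M0 LM]] := (bounded_operatorP Lam).1 bL.
exists M^-1; first by rewrite invr_gt0.
move=> w wM.
have bwL : bounded_operator (fun x => w *: Lam x) by exact: bounded_scale.
have linwL : linear (fun x => w *: Lam x) by have /bounded_operatorP[] := bwL.
have [Q [bQ Q1 Q2]] : exists J, [/\ bounded_operator J,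
    forall x, J (x - w *: Lam x) = x & forall x, J x - w *: Lam (J x) = x].
  apply: (@neumann _ _ (fun x => w *: Lam x) 1 (normc w * M) linwL) => //.
    by rewrite mulr_ge0 ?normc_ge0 ?(ltW M0)//= -ltr_pdivlMr// div1r.
  move=> k x; rewrite mul1r; apply: bounded_iter.
    by rewrite mulr_ge0 ?normc_ge0 ?(ltW M0).
  by move=> y; rewrite l2normZ -mulrA ler_wpM2l ?normc_ge0.
have [linQ _] := (bounded_operatorP Q).1 bQ.
pose P x : l2 R V := x - w *: Lam x.
have linP : linear P by move=> c x y; rewrite /P linL; l2ring.
have rP x : range (shifted S w) x <-> range S (Q x).
  split=> [[f _ <-]|[f _ fx]].
    exists f => //; rewrite /shifted -[in LHS](Q1 (S f)).
    by rewrite LS.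
  by exists f => //; rewrite -(Q2 x) -fx LS.
have [b [_ hb]] := codim_shift; exists (fun i => P (b i)); split => // x _.
have QE (c : {ffun 'I_d -> R[i]}) :
    Q (x - \sum_i c i *: P (b i)) = Q x - \sum_i c i *: b i.
  rewrite (linB linQ) (lin_sum linQ); congr (_ - _); apply: eq_bigr => i _.
  by rewrite (linZ linQ) /P Q1.
have [c [hc uc]] := hb (Q x) I; exists c; split.
  by apply/rP; rewrite QE.
by move=> c' /rP; rewrite QE => /uc.
Qed.

(** For small w every ray grows.  Then the basis vectors at generation K are
    independent modulo the range of S - w, so there are at most d of them, and
    being finitely many they span a complement of this range, so there are
    exactly d. *)
Lemma generation_enum : exists v : 'I_d -> V, injective v /\
  forall u, depth u = K <-> exists i, v i = u.
Proof.
have [c [M [c0 M0 Pc PM]]] := ray_ratio treeE rootE leafE lam_gt0 shS bS liS HK.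
have [eps eps0 hcod] := small_codim.
(* t^2 < c makes every ray grow at t, and t < eps keeps the codimension d *)
pose t := Num.min (Num.sqrt c / 2) (eps / 2).
have t0 : 0 < t by rewrite lt_min !divr_gt0// sqrtr_gt0.
pose w : R[i] := (t%:C)%C.
have nw : normc w = t by rewrite normc_id gtr0_norm.
have w0 : w != 0 by rewrite -normc_gt0 nw.
have codw : has_codim (range (shifted S w)) d.
  apply: hcod; rewrite nw; have : t <= eps / 2 by rewrite /t ge_min lexx orbT.
  by lra.
pose B u := (K <= depth u)%N.
have B_child u : (K <= depth u)%N -> B (child u) = B u.
  by move=> Ku; rewrite /B (depth_child treeE rootE leafE) Ku leqW.
have w2 : normc w ^+ 2 < c.
  rewrite nw; apply: (@le_lt_trans _ _ ((Num.sqrt c / 2) ^+ 2)).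
    rewrite ler_sqr ?nnegrE ?divr_ge0 ?sqrtr_ge0 ?(ltW t0)//.
    by rewrite /t ge_min lexx.
  by rewrite expr_div_n sqr_sqrtr ?(ltW c0)//; lra.
have wp2 : 0 < normc w ^+ 2 by rewrite nw exprn_gt0.
have qa0 : 0 < normc w ^+ 2 / 2 < normc w ^+ 2 by apply/andP; split; lra.
have A_decay u k : (K <= depth u)%N -> ~~ B u ->
    weight_prod E root lam (iter k child u) ^+ 2
    <= 1 * (normc w ^+ 2 / 2) ^+ k * weight_prod E root lam u ^+ 2.
  by rewrite /B => ->.
have B_grow u k : B u -> c ^+ k * weight_prod E root lam u ^+ 2
    <= 1 * weight_prod E root lam (iter k child u) ^+ 2.
  move=> Ku; rewrite mul1r; elim: k => [|k ih]; first by rewrite mul1r.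
  by rewrite exprS -mulrA (le_trans _ (Pc u k Ku))// ler_pM2l.
have lrw : lin_closed (range (shifted S w)).
  have lsw : linear (shifted S w) by move=> a f g; rewrite /shifted linS; l2ring.
  split; first by exists 0 => //; rewrite (lin0 lsw).
  by move=> a _ _ [x _ <-] [y _ <-]; exists (a *: x + y) => //; rewrite (linZD lsw).
have indep n (v : 'I_n -> V) : injective v -> (forall i, depth (v i) = K) -> (n <= d)%N.
  move=> vinj vK; apply: (indep_le_dim lrw codw (b' := fun i => e (v i))) => // cf.
  have Bv i : B (v i) by rewrite /B vK.
  exact: (split_indep treeE rootE leafE lam_gt0 shS bS liS HK w0 (fun v h => h) B_child ltr01
    qa0 w2 A_decay B_grow vinj Bv vK).
have finG : finite_set [set u | depth u = K].
  apply: contrapT => /(@infinite_set_fset _ _ d.+1)[F FG dF].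
  have : (size (finmap.enum_fset F) <= d)%N.
    apply: (@indep _ (fun i => tnth (in_tuple (finmap.enum_fset F)) i)).
      by apply/tuple_uniqP; exact: finmap.fset_uniq.
    by move=> i; apply: FG; exact: mem_tnth.
  by rewrite leqNgt dF.
have [s0 sG] := (finite_seqP _).1 finG; pose s := undup s0.
pose v (i : 'I_(size s)) := tnth (in_tuple s) i.
have vinj : injective v.
  by apply/tuple_uniqP; exact: undup_uniq.
have vE u : depth u = K <-> exists i, v i = u.
  have -> : depth u = K <-> u \in s.
    rewrite mem_undup; have := congr1 (fun A : set V => A u) sG => /= <-.
    by [].
  split=> [/(tnthP (in_tuple s))[i ->]|[i <-]]; first by exists i.
  exact: mem_tnth.
have cods : has_codim (range (shifted S w)) (size s).
  apply: (split_codim treeE rootE leafE lam_gt0 shS bS liS HK w0 (fun v h => h) B_child ltr01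
    qa0 w2 A_decay B_grow vinj) => u.
  by rewrite -vE; split=> [[]//|uK]; rewrite /B uK.
have sd : size s = d by apply: dim_quot_uniq cods codw.
by move: v vinj vE {cods}; rewrite sd => v vinj vE; exists v.
Qed.

End Codimension.

(** * The essential spectrum *)

Lemma normc_continuous (R : realType) : continuous (@Normc.normc R : R[i]^o -> R).
Proof.
move=> x A /nbhs_ballP[d /= d0 dA].
have dc : 0 < (d%:C)%C :> R[i] by rewrite ltcR.
apply/(@nbhs_ballP _ R[i]^o); exists (d%:C)%C => // y xy; apply: dA.
move: xy; rewrite -!ball_normE /= -[X in X < _ -> _]normc_real ltcR.
exact: le_lt_trans (ler_normcB _ _).
Qed.

(** The modulus maps the component onto an interval. *)
Lemma component_crosses_circles (R : realType) (A : set R[i]) (z : R[i]) (r : R) :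
  plane_component A 0 z -> 0 <= r <= normc z -> exists2 y, A y & normc y = r.
Proof.
move=> [C [C0 CA conC] Cz] r01.
have : connected [set Normc.normc y | y in C].
  apply: (connected_continuous_connected conC).
  by apply: continuous_subspaceT; exact: normc_continuous.
move=> /connected_intervalP/(_ 0 (normc z)).
have h0 : [set Normc.normc y | y in C] 0 by exists 0; rewrite ?Normc.normc0.
have hz : [set Normc.normc y | y in C] (normc z) by exists z.
by move=> /(_ h0 hz r r01)[y Cy yr]; exists y => //; exact: CA.
Qed.

Section EssentialSpectrum.
Variables (R : realType) (V : choiceType) (E : rel V) (root : V).
Variables (lam : V -> R) (S : l2 R V -> l2 R V).
Hypotheses (treeE : directed_tree E) (rootE : is_root E root) (leafE : leafless E).
Hypothesis lam_gt0 : forall v, ~ is_root E v -> 0 < lam v.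
Hypothesis shS : weighted_shift E lam S.
Hypothesis bS : bounded_operator S.
Hypothesis liS : left_invertible S.
Variable K : nat.
Hypothesis HK : forall u v w, (K <= depth E root u)%N -> E u v -> E u w -> v = w.
Variables (d : nat) (v : 'I_d -> V).
Hypotheses (vinj : injective v)
  (vE : forall u, depth E root u = K <-> exists i, v i = u).

Local Notation depth := (depth E root).
Local Notation par := (par E).
Local Notation child := (child E).
Local Notation rayw := (ray_weight E root lam).
Notation decays := (decays_from 0).
Notation grows := (grows_from 0).

Let anc u := iter (depth u - K) par u.

Let anc_depth u : (K <= depth u)%N -> depth (anc u) = K.
Proof. by move=> Ku; rewrite /anc (depth_iter_par treeE rootE) subKn. Qed.

Let ancK u : (K <= depth u)%N -> iter (depth u - K) child (anc u) = u.
Proof.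
suff key n : forall x, (depth x - K)%N = n -> (K <= depth x)%N ->
    iter n child (iter n par x) = x by exact: key.
elim: n => [//|n ih] {}u nE Ku.
have Ku' : (K < depth u)%N by rewrite -subn_gt0 nE.
rewrite [iter n.+1 par u]iterSr iterS ih.
- exact: (child_par treeE rootE leafE HK).
- move: nE; rewrite (depth_par treeE rootE (deep_not_root treeE rootE Ku')).
  by rewrite subSn ?(deep_par treeE rootE Ku')// => -[].
- exact: (deep_par treeE rootE Ku').
Qed.

(** The rays that grow at |w| form the set B of the splitting; the constants
    are made uniform over the finitely many rays. *)
Lemma fredholm_off_annuli (w : R[i]) : w != 0 ->
  (forall i, grows (rayw (v i)) (normc w ^+ 2) \/ decays (rayw (v i)) (normc w ^+ 2)) ->
  (exists Gam, bounded_operator Gam /\ cancel (shifted S w) Gam) /\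
  has_codim (range (shifted S w)) #|[pred i | `[< grows (rayw (v i)) (normc w ^+ 2) >] ]|.
Proof.
move=> w0; set s := normc w ^+ 2 => hv.
have s0 : 0 < s by rewrite exprn_gt0// normc_gt0.
have rw0 (i : 'I_d) n : 0 < rayw (v i) n by exact: ray_weight_gt0.
have [Ca [qa [Ca0 qas hA]]] := decays_uniform (enum 'I_d) s0 rw0.
have [Cb [qb [Cb0 sqb hB]]] := grows_uniform (enum 'I_d) s0 rw0.
pose B u := (K <= depth u)%N && `[< grows (rayw (anc u)) s >].
have B_deep u : B u -> (K <= depth u)%N by case/andP.
have B_child u : (K <= depth u)%N -> B (child u) = B u.
  move=> Ku; rewrite /B /anc (depth_child treeE rootE leafE) Ku leqW// subSn// iterSr.
  by rewrite (par_child treeE rootE leafE).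
have ray_of u k : (K <= depth u)%N -> exists2 i, anc u = v i &
    weight_prod E root lam (iter k child u) ^+ 2 = rayw (v i) ((depth u - K) + k)%N.
  move=> Ku; have [i iE] := (vE _).1 (anc_depth Ku); exists i => //.
  by rewrite /ray_weight addnC iterD iE ancK.
pose C := Num.max Ca Cb.
have C0 : 0 < C by rewrite lt_max Ca0.
have A_decay u k : (K <= depth u)%N -> ~~ B u ->
    weight_prod E root lam (iter k child u) ^+ 2
      <= C * qa ^+ k * weight_prod E root lam u ^+ 2.
  move=> Ku; rewrite /B Ku /= => /asboolPn; have [i ai hk] := ray_of u k Ku.
  have [j aj h0] := ray_of u 0%N Ku; have ij : i = j by apply: vinj; rewrite -ai.
  subst j; rewrite ai => ngi; have [//|di] := hv i.
  rewrite hk -[X in _ <= _ * weight_prod _ _ _ X ^+ 2]/(iter 0 child u) h0 addn0.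
  apply: le_trans (hA i (mem_enum _ _) di _ _) _.
  rewrite ler_wpM2r ?(ltW (rw0 _ _))// ler_wpM2r ?exprn_ge0 ?le_max ?lexx//.
  by case/andP: qas => /ltW.
have B_grow u k : B u -> qb ^+ k * weight_prod E root lam u ^+ 2
    <= C * weight_prod E root lam (iter k child u) ^+ 2.
  move=> /andP[Ku /asboolP]; have [i ai hk] := ray_of u k Ku.
  have [j aj h0] := ray_of u 0%N Ku; have ij : i = j by apply: vinj; rewrite -ai.
  subst j; rewrite ai => gi.
  rewrite hk -[X in _ * weight_prod _ _ _ X ^+ 2 <= _]/(iter 0 child u) h0 addn0.
  apply: le_trans (hB i (mem_enum _ _) gi _ _) _.
  by rewrite ler_wpM2r ?(ltW (rw0 _ _))// le_max lexx orbT.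
split.
  have [Gam [_ [_ [bG GS _ _ _]]]] := split_resolvent treeE rootE leafE lam_gt0 shS bS
    liS HK w0 B_deep B_child C0 qas sqb A_decay B_grow.
  by exists Gam.
set A := [pred i | _].
apply: (split_codim treeE rootE leafE lam_gt0 shS bS liS HK w0 B_deep B_child C0 qas sqb
  A_decay B_grow (v := fun j : 'I_#|A| => v (enum_val j))).
  by move=> i j /vinj/enum_val_inj.
move=> u; split=> [[/andP[Ku /asboolP gu] uK]|[j <-]].
  have [i iu] := (vE u).1 uK.
  have iA : i \in A by apply/asboolP; move: gu; rewrite /anc uK subnn /= -iu.
  by exists (enum_rank_in iA i); rewrite (enum_rankK_in iA iA).
have vK : depth (v (enum_val j)) = K by apply/vE; eexists.
split=> //; rewrite /B vK leqnn /anc vK subnn /=.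
exact: enum_valP j.
Qed.

Lemma annuli_exist : exists a b : 'I_d -> R, forall i,
  [/\ 0 < a i <= b i,
    forall r, 0 < r -> r < a i -> grows (rayw (v i)) (r ^+ 2),
    forall r, 0 < r -> b i < r -> decays (rayw (v i)) (r ^+ 2)
  & forall r, 0 < r -> a i <= r <= b i ->
      ~ grows (rayw (v i)) (r ^+ 2) /\ ~ decays (rayw (v i)) (r ^+ 2)].
Proof.
have [c [M [c0 M0 Pc PM]]] := ray_ratio treeE rootE leafE lam_gt0 shS bS liS HK.
have vK i : (K <= depth (v i))%N by rewrite ((vE (v i)).2 (ex_intro _ i erefl)).
have ex i : exists ab : R * R, [/\ 0 < ab.1 <= ab.2,
    forall r, 0 < r -> r < ab.1 -> grows (rayw (v i)) (r ^+ 2),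
    forall r, 0 < r -> ab.2 < r -> decays (rayw (v i)) (r ^+ 2)
  & forall r, 0 < r -> ab.1 <= r <= ab.2 ->
      ~ grows (rayw (v i)) (r ^+ 2) /\ ~ decays (rayw (v i)) (r ^+ 2)].
  have [|a [b h]] := @growth_radii R (rayw (v i)) c M _ c0 M0
      (fun n => Pc _ n (vK i)) (fun n => PM _ n (vK i)).
    by move=> n; exact: ray_weight_gt0.
  by exists (a, b).
have [ab hab] := choice ex.
by exists (fun i => (ab i).1), (fun i => (ab i).2).
Qed.

Lemma shifted0 : shifted S 0 = S.
Proof. by apply/funext => x; rewrite /shifted scale0r subr0. Qed.

Lemma essential_spectrum : has_codim (range S) d ->
  [/\ ap_spectrum S = ess_spectrum S,
      exists (m : nat) (a b : 'I_m -> R),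
        [/\ (m <= d)%N, forall i, 0 < a i <= b i
          & ap_spectrum S = \bigcup_i annulus (a i) (b i)],
      forall z w, (~` ess_spectrum S) z ->
        plane_component (~` ess_spectrum S) z w ->
        - d%:Z <= fredholm_index (shifted S w)
    & (~` ess_spectrum S) 0 /\
      (forall w, plane_component (~` ess_spectrum S) 0 w ->
        fredholm_index (shifted S w) = - d%:Z)].
Proof.
move=> cod0; have [a [b hab]] := annuli_exist.
pose U : set R[i] := \bigcup_i annulus (a i) (b i).
have on w : U w -> ap_spectrum S w /\ ess_spectrum S w.
  move=> [i _ ai]; have [/andP[ap _] _ _ hn] := hab i.
  have wp : 0 < normc w by apply: lt_le_trans ap _; case/andP: ai.
  have w0 : w != 0 by rewrite -normc_gt0.
  have [ng nd] := hn _ wp ai.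
  have vK : (K <= depth (v i))%N by rewrite ((vE (v i)).2 (ex_intro _ i erefl)).
  split; first exact: (ray_ap_spectrum treeE rootE leafE lam_gt0 shS bS liS HK w0 vK ng nd).
  move=> [_ cl _]; move: cl.
  exact: (ray_range_not_closed treeE rootE leafE lam_gt0 shS bS liS HK w0 vK ng nd).
have off w : ~ U w -> ~ ap_spectrum S w /\ exists n, [/\ (n <= d)%N,
    fredholm (shifted S w), fredholm_index (shifted S w) = - n%:Z
    & (forall i, normc w < a i) -> n = d].
  move=> nU; have bSw := bounded_shifted w bS.
  have [w0|w0] := eqVneq w 0.
    have [Lam bL LS] := liS; rewrite w0.
    have LS0 : cancel (shifted S 0) Lam by rewrite shifted0.
    split; first exact: (left_inverse_not_ap bL LS0).
    exists d; rewrite shifted0; split => //; first exact: (left_inverse_fredholm bS bL LS cod0).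
    exact: (left_inverse_index bS bL LS cod0).
  have wp : 0 < normc w by rewrite normc_gt0.
  have hv i : grows (rayw (v i)) (normc w ^+ 2) \/ decays (rayw (v i)) (normc w ^+ 2).
    have [_ hg hd _] := hab i; have [wa|aw] := ltP (normc w) (a i); first by left; exact: hg.
    right; apply: hd => //; rewrite ltNge; apply/negP => wb.
    by apply: nU; exists i => //; rewrite /annulus/= aw.
  have [[Gam [bG GS]] cod] := fredholm_off_annuli w0 hv.
  split; first exact: (left_inverse_not_ap bG GS).
  exists #|[pred i | `[< grows (rayw (v i)) (normc w ^+ 2) >] ]|; split.
  - by rewrite -[X in (_ <= X)%N]card_ord max_card.
  - exact: (left_inverse_fredholm bSw bG GS cod).
  - exact: (left_inverse_index bSw bG GS cod).
  move=> wa; rewrite -[RHS]card_ord; apply: eq_card => i.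
  have [_ hg _ _] := hab i; rewrite !inE; apply/asboolP; apply: hg => //; exact: wa.
have apE : ap_spectrum S = U.
  apply/seteqP; split=> w; last by move=> /on[].
  by move=> apw; apply: contrapT => /off[].
have essE : ess_spectrum S = U.
  apply/seteqP; split=> w; last by move=> /on[].
  by move=> ew; apply: contrapT => /off[_ [n [_ fr _ _]]].
rewrite essE apE; split => //.
- exists d, a, b; split => // i; by have [] := hab i.
- move=> z w _ zw; have : (~` U) w by exact: connected_component_sub zw.
  move=> /off[_ [n [nd _ -> _]]].
  by rewrite lerN2 lez_nat.
have U0 : ~ U 0.
  move=> [i _]; rewrite /annulus/mkset Normc.normc0; have [/andP[ap _] _ _ _] := hab i.
  by rewrite leNgt ap.
split=> // w w_comp.
have wa i : normc w < a i.
  rewrite ltNge; apply/negP => aw; have [/andP[ap ab] _ _ _] := hab i.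
  have [|y nUy ya] := component_crosses_circles w_comp (r := a i).
    by rewrite (ltW ap).
  by apply: nUy; exists i => //; rewrite /annulus/= ya lexx.
have : (~` U) w by exact: connected_component_sub w_comp.
by move=> /off[_ [n [_ _ -> /(_ wa) ->]]].
Qed.

End EssentialSpectrum.

Theorem theorem5p1 (R : realType) (V : choiceType) (E : rel V) (root : V)
    (lam : V -> R) (S : l2 R V -> l2 R V) :
  countable [set: V] -> infinite_set [set: V] ->
  directed_tree E -> leafless E -> is_root E root ->
  finite_branching_index E root ->
  (forall v, ~ is_root E v -> 0 < lam v) ->
  weighted_shift E lam S -> bounded_operator S -> left_invertible S ->
  let S' := adjoint S in
  [/\ point_spectrum S = set0,
      [/\ open_disc (convergence_radius E root lam S)
                     `<=` point_spectrum S',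
                   point_spectrum S' `<=` spectrum S
                 & spectrum S = closed_disc (spectral_radius S)],
      forall eps : R, 0 < eps ->
        closed_span (\bigcup_(w in open_disc eps%:E) ker (shifted S' w)) = setT
    & forall d : nat, has_dim (ker S') d ->
      [/\ ap_spectrum S = ess_spectrum S,
          exists (m : nat) (a b : 'I_m -> R),
            [/\ (m <= d)%N, forall i, 0 < a i <= b i
              & ap_spectrum S = \bigcup_i annulus (a i) (b i)],
          forall z w, (~` ess_spectrum S) z ->
            plane_component (~` ess_spectrum S) z w ->
            - d%:Z <= fredholm_index (shifted S w),
          (~` ess_spectrum S) 0 /\
          (forall w, plane_component (~` ess_spectrum S) 0 w ->
            fredholm_index (shifted S w) = - d%:Z)
        & forall k : nat, (0 < k)%N ->
          has_dim_quot (ker (iter k S')) (ker (iter k.-1 S')) d]].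
Proof.
move=> _ _ treeE leafE rootE fbi lam_gt0 shS bS liS S'; rewrite /S'; split.
- exact: (shift_point_spectrum treeE rootE shS bS liS).
- split.
  + exact: (radius_disc_point_spectrum treeE rootE shS bS liS fbi).
  + exact: (adj_point_spectrum treeE rootE shS bS liS).
  + exact: (shift_spectrum treeE rootE shS bS liS).
- exact: (adj_eigenvectors_total treeE rootE shS bS liS).
move=> d dimE; have [K HK] := branching_bound fbi.
have [v [vinj vE]] := generation_enum treeE rootE leafE lam_gt0 shS bS liS HK dimE.
have cod := codim_shift treeE rootE shS bS liS dimE.
have [] := essential_spectrum treeE rootE leafE lam_gt0 shS bS liS HK vinj vE cod.
split => //.
exact: (ker_power_dim treeE rootE shS bS liS dimE).
Qed.
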